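(* For any $n$-dimensional Riemannian manifold $M^n$ and any minimal unit-speed geodesic $C: [0,\gamma) \to M$ with $0<\gamma<\infty$, $$\liminf_{s \to \gamma} \;(\gamma-s)^2\,\mathrm{Ric}(C'(s),C'(s)) \leq \frac{n-1}{4}.$$ Equality can hold on a surface of positive curvature, i.e. there exist a two-dimensional Riemannian manifold $M$ of positive Gaussian curvature and a minimal unit-speed geodesic $C:[0,\gamma)\to M$, $0<\gamma<\infty$, for which the $\liminf$ equals $\frac14$.
   Context: $M$ is connected and is not assumed to be complete. A unit-speed geodesic $C:[0,\gamma)\to M$ is minimal if $d(C(s),C(t))=|s-t|$ for all $s,t\in[0,\gamma)$, where $d$ is the Riemannian distance. $\mathrm{Ric}$ is the Ricci tensor. *)

(* Defs.v *)
From HB Require Import structures.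
From mathcomp Require Import all_boot all_order all_algebra.
From mathcomp Require Import all_classical all_reals all_analysis.
Set Implicit Arguments.
Unset Strict Implicit.
Unset Printing Implicit Defensive.
Import Order.TTheory GRing.Theory Num.Theory.
Import numFieldNormedType.Exports.
Local Open Scope classical_set_scope.
Local Open Scope ring_scope.

Definition partial (R : realType) (n : nat) (k : 'I_n) (f : 'rV[R]_n -> R) :
  'rV[R]_n -> R := fun x => 'D_(delta_mx 0 k) f x.

(* C^oo on an open set [U]: the iterated partial derivatives of all orders
   exist and are continuous at every point of [U]. *)
Definition smooth_on (R : realType) (n : nat) (U : set 'rV[R]_n)
    (f : 'rV[R]_n -> R) : Prop :=
  forall (s : seq 'I_n) (x : 'rV[R]_n), U x ->
    {for x, continuous (foldr (@partial R n) f s)} /\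
    forall k : 'I_n, derivable (foldr (@partial R n) f s) x (delta_mx 0 k).

(* [chart_map i] is a homeomorphism from the open set [chart_dom i] onto an open
   subset of R^n, with inverse [chart_inv i]; the values of these maps outside
   the chart are irrelevant.  Boundaryless, Hausdorff and second countable;
   connectedness is not included. *)
Record smoothManifold (R : realType) (n : nat) := SmoothManifold {
  carrier :> topologicalType ;
  carrier_hausdorff : hausdorff_space carrier ;
  carrier_second_countable : @second_countable carrier ;
  chart_index : Type ;
  chart_dom : chart_index -> set carrier ;
  chart_map : chart_index -> carrier -> 'rV[R]_n ;
  chart_inv : chart_index -> 'rV[R]_n -> carrier ;
  chart_at : carrier -> chart_index ;
  chart_atP : forall p, chart_dom (chart_at p) p ;
  chart_dom_open : forall i, open (chart_dom i) ;
  chart_img_open : forall i, open (chart_map i @` chart_dom i) ;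
  chart_mapK : forall i p, chart_dom i p -> chart_inv i (chart_map i p) = p ;
  chart_map_continuous : forall i p,
    chart_dom i p -> {for p, continuous (chart_map i)} ;
  chart_inv_continuous : forall i x,
    (chart_map i @` chart_dom i) x -> {for x, continuous (chart_inv i)} ;
  transition_smooth : forall i j (k : 'I_n),
    smooth_on (chart_map i @` (chart_dom i `&` chart_dom j))
      (fun x => chart_map j (chart_inv i x) 0 k) }.

Definition chart_img (R : realType) (n : nat) (M : smoothManifold R n)
  (i : chart_index M) : set 'rV[R]_n := chart_map i @` chart_dom i.

(* A smooth Riemannian metric, given by its Gram matrices
   [metric i x] = (g(d_a, d_b))_{a,b} in the chart [i], at the point of
   coordinates [x].  Vectors are rows, so that a vector [v] in the chart [i]
   becomes [v *m jacobian] in the chart [j]. *)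
Record riemannianManifold (R : realType) (n : nat) := RiemannianManifold {
  base_manifold :> smoothManifold R n ;
  metric : chart_index base_manifold -> 'rV[R]_n -> 'M[R]_n ;
  metric_smooth : forall i (a b : 'I_n),
    smooth_on (chart_img i) (fun x => metric i x a b) ;
  metric_sym : forall i x, chart_img i x -> (metric i x)^T = metric i x ;
  metric_posdef : forall i x (v : 'rV[R]_n),
    chart_img i x -> v != 0 -> 0 < (v *m metric i x *m v^T) 0 0 ;
  metric_transition : forall i j p,
    chart_dom i p -> chart_dom j p ->
    let J := jacobian (chart_map j \o chart_inv i) (chart_map i p) in
    metric i (chart_map i p) = J *m metric j (chart_map j p) *m J^T }.

Section LocalGeometry.
Variables (R : realType) (n : nat) (g : 'rV[R]_n -> 'M[R]_n).

(* [christoffel k i j x] is Gamma^k_{ij}, with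
   nabla_{d_i} d_j = \sum_k Gamma^k_{ij} d_k. *)
Definition christoffel (k i j : 'I_n) (x : 'rV[R]_n) : R :=
  2^-1 * \sum_(l < n) invmx (g x) k l *
    (partial i (fun y => g y j l) x + partial j (fun y => g y i l) x
     - partial l (fun y => g y i j) x).

(* [riemann l k i j x] is the coefficient on d_l of R(d_i, d_j) d_k, where
   R(X, Y) Z = nabla_X nabla_Y Z - nabla_Y nabla_X Z - nabla_[X, Y] Z. *)
Definition riemann (l k i j : 'I_n) (x : 'rV[R]_n) : R :=
  partial i (christoffel l j k) x - partial j (christoffel l i k) x
  + \sum_(m < n) (christoffel m j k x * christoffel l i m x
                  - christoffel m i k x * christoffel l j m x).

(* Ric(Y, Z) is the trace of X |-> R(X, Y) Z; it is positive on round
   spheres. *)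
Definition ricci_coef (j k : 'I_n) (x : 'rV[R]_n) : R :=
  \sum_(i < n) riemann i k i j x.

End LocalGeometry.

Section Geometry.
Variables (R : realType) (n : nat) (M : riemannianManifold R n).

Definition coord_at (p : M) : 'rV[R]_n := chart_map (chart_at p) p.
Definition metric_at (p : M) : 'rV[R]_n -> 'M[R]_n := metric (chart_at p).

(* In the next three definitions, a tangent vector at [p] is represented by its
   components in the preferred chart [chart_at p]. *)
Definition tangent_norm (p : M) (v : 'rV[R]_n) : R :=
  Num.sqrt ((v *m metric_at p (coord_at p) *m v^T) 0 0).

Definition Ric (p : M) (v w : 'rV[R]_n) : R :=
  \sum_(j < n) \sum_(k < n)
    ricci_coef (metric_at p) j k (coord_at p) * v 0 j * w 0 k.

Definition velocity (c : R -> M) (t : R) : 'rV[R]_n :=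
  (chart_map (chart_at (c t)) \o c)^`()%classic t.

Definition speed (c : R -> M) (t : R) : R := tangent_norm (c t) (velocity c t).

Definition C1_on (D : set R) (c : R -> M) : Prop :=
  forall t, D t -> {for t, continuous c} /\
    forall i, chart_dom i (c t) ->
      derivable (chart_map i \o c) t 1 /\
      {for t, continuous (chart_map i \o c)^`()%classic}.

(* A C^1 curve on the compact interval [0, 1] is one which is C^1 on an open
   neighbourhood of it. *)
Definition C1_segment (c : R -> M) : Prop :=
  exists2 e : R, 0 < e & C1_on `](- e), (1 + e)[ c.

(* [path_length p q l]: some piecewise C^1 path from [p] to [q] has length [l];
   each C^1 piece is parametrized by [0, 1]. *)
Inductive path_length : M -> M -> R -> Prop :=
| path_nil p : path_length p p 0
| path_cons (c : R -> M) q l :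
    C1_segment c -> path_length (c 1) q l ->
    path_length (c 0) q
      ((\int[lebesgue_measure]_(t in `[0, 1]) speed c t) + l).

(* The set is nonempty for all [p] and [q] when M is connected. *)
Definition riemannian_dist (p q : M) : R := inf [set l | path_length p q l].

Definition geodesic_on (D : set R) (c : R -> M) : Prop :=
  forall t, D t -> {for t, continuous c} /\
    forall i, chart_dom i (c t) ->
      let x := chart_map i \o c in
      [/\ derivable x t 1, derivable x^`()%classic t 1 &
        forall k : 'I_n,
          x^`(2)%classic t 0 k
          + \sum_(a < n) \sum_(b < n)
              christoffel (metric i) k a b (x t) * x^`()%classic t 0 a * x^`()%classic t 0 b
          = 0].

(* A curve on [0, gam) is a total function whose values outside [0, gam) are
   ignored; it is a geodesic if it extends to a geodesic on an open interval
   (-e, gam). *)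
Definition unit_speed_geodesic (gam : R) (C : R -> M) : Prop :=
  exists (e : R) (E : R -> M),
    [/\ 0 < e, geodesic_on `](- e), gam[ E,
      forall t, t \in `[0, gam[ -> E t = C t &
      forall t, t \in `[0, gam[ -> speed E t = 1].

Definition minimal_curve (gam : R) (C : R -> M) : Prop :=
  forall s t, s \in `[0, gam[ -> t \in `[0, gam[ ->
    riemannian_dist (C s) (C t) = `|s - t|.

End Geometry.

(* <R(d_0, d_1) d_1, d_0> / det g *)
Definition gaussian_curvature (R : realType) (M : riemannianManifold R 2)
    (p : M) : R :=
  let g := metric_at p in let x := coord_at p in
  (\sum_(l < 2) riemann g l 1 0 1 x * g x l 0) / \det (g x).

(* Main.v *)
(* The upper bound is Synge's argument.  Let m = n - 1 and suppose that (gam - s)^2 Ric(C', C') > c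
   near gam, with c > m/4.  Move C along each of m parallel orthonormal normal fields times a
   function phi which vanishes at two times a0 < b.  The second variations of length add up to the
   integral of m phi'^2 - Ric(C', C') phi^2 over [a0, b], which is less than that of
   m phi'^2 - c phi^2 / (gam - s)^2.  For phi = sqrt(gam - s) psi(y) with y = - ln (gam - s) the
   latter is the integral in y of m (psi' - psi/2)^2 - c psi^2, that is, up to a boundary term, of
   m psi'^2 - (c - m/4) psi^2; it is negative when psi is a quadratic bump on a long interval.
   Hence some variation is shorter than C, against minimality.

   The geodesic need not lie in one chart, so the varied paths are built piece by piece, each piece
   being given in the coordinates of one chart.  Since the variations x + e v + O(e^2) used in two
   charts differ at second order, the length gained also contains the boundary term
   <Gamma(v, v), C'>, Gamma being the Christoffel symbols of the chart; its change under a
   transition map, [chrl_glue], makes the pieces fit.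

   Equality holds on the surface dr^2 + r dy^2, r > 0, of curvature 1 / (4 r^2), along the geodesic
   r = 1 - s, which is minimal because |dr| is at most the length element. *)
Require Import Defs.
From HB Require Import structures.
From mathcomp Require Import all_boot all_order all_algebra.
From mathcomp Require Import all_classical all_reals all_analysis.
From mathcomp Require Import ring lra.
Set Implicit Arguments.
Unset Strict Implicit.
Unset Printing Implicit Defensive.
Import Order.TTheory GRing.Theory Num.Theory.
Import numFieldNormedType.Exports.
Local Open Scope classical_set_scope.
Local Open Scope ring_scope.
(* With these instances, applying a lemma with an [is_derive] premise would let type class
   resolution choose the derivative. *)
#[local] Remove Hints is_derive_cst is_deriveD is_derive_sum is_deriveN is_deriveB is_deriveZ
  is_derive_id is_deriveNid is_deriveM is_deriveX is_derive1_comp is_deriveV : typeclass_instances.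

(** * Calculus *)

(** Lengths are controlled through energies. Since C has unit speed, sqrt A <= (1 + A) / 2 bounds
    the length of an explicit varied path, and nothing is lost at second order because the first
    variation of the energy density vanishes pointwise for a normal field. The m variations are kept
    apart, each with its own second-order constant: minimality makes every constant nonnegative,
    while only their sum sees Ric. Two obstacles come from the charts. Parallel transport is solved
    on short intervals inside one chart, so the induction along C carries a frame at a single time
    and transports it to the next one. And [Ric] is read in the preferred chart of each point, which
    may jump as the point moves; a strict inequality at one time is therefore spread to neighbouring
    times by continuity in a fixed chart. This is why the curvature is compared with a continuous
    function, and why c is taken strictly above m/4. *)

Lemma near_all T (I : finType) (F : set_system T) {FF : Filter F} (P : I -> T -> Prop) :
  (forall i, \forall x \near F, P i x) -> \forall x \near F, forall i, P i x.
Proof. by move=> h; exact: filter_forall. Qed.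

Section ContRules.
Variables (R : realType) (T : topologicalType).
Implicit Types (f g : T -> R) (x : T).

Lemma cont_cst (c : R) x : {for x, continuous (fun _ : T => c)}.
Proof. exact: cvg_cst. Qed.

Lemma contD f g x : {for x, continuous f} -> {for x, continuous g} ->
  {for x, continuous (fun y => f y + g y)}.
Proof. by move=> hf hg; exact: cvgD. Qed.

Lemma contB f g x : {for x, continuous f} -> {for x, continuous g} ->
  {for x, continuous (fun y => f y - g y)}.
Proof. by move=> hf hg; exact: cvgB. Qed.

Lemma contM f g x : {for x, continuous f} -> {for x, continuous g} ->
  {for x, continuous (fun y => f y * g y)}.
Proof. by move=> hf hg; exact: cvgM. Qed.

Lemma contV f x : f x != 0 -> {for x, continuous f} ->
  {for x, continuous (fun y => (f y)^-1)}.
Proof. by move=> f0 hf; exact: cvgV. Qed.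

Lemma cont_sum (I : finType) (P : pred I) (F : I -> T -> R) x :
  (forall i, P i -> {for x, continuous (F i)}) ->
  {for x, continuous (fun y => \sum_(i | P i) F i y)}.
Proof.
move=> h; rewrite (_ : (fun y => _) = \sum_(i | P i) F i); last first.
  by apply/funext => y; rewrite fct_sumE.
elim/big_ind: _ => //; first exact: cont_cst.
by move=> *; exact: contD.
Qed.

Lemma cont_congr (V : topologicalType) (f g : T -> V) x : (\forall y \near x, f y = g y) ->
  {for x, continuous f} -> {for x, continuous g}.
Proof.
move=> fg hf; have E := nbhs_singleton fg.
rewrite /prop_for /continuous_at -E.
by apply: cvg_trans hf; apply: near_eq_cvg; apply: filterS fg => y ->.
Qed.

End ContRules.

Section DeriveRules.
Variables (R : realType) (V : normedModType R).
Implicit Types (f g : V -> R) (x v : V).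

Lemma der_congr f g x v (d d' : R) :
  (\forall y \near x, f y = g y) -> d = d' -> is_derive x v f d -> is_derive x v g d'.
Proof. by move=> fg <-; exact: near_eq_is_derive. Qed.

Lemma derD f g x v (df dg : R) : is_derive x v f df -> is_derive x v g dg ->
  is_derive x v (fun y => f y + g y) (df + dg).
Proof. by move=> ? ?; exact: is_deriveD. Qed.

Lemma derB f g x v (df dg : R) : is_derive x v f df -> is_derive x v g dg ->
  is_derive x v (fun y => f y - g y) (df - dg).
Proof. by move=> ? ?; exact: is_deriveB. Qed.

Lemma derM f g x v (df dg : R) : is_derive x v f df -> is_derive x v g dg ->
  is_derive x v (fun y => f y * g y) (df * g x + f x * dg).
Proof.
move=> hf hg; have h := @is_deriveM _ _ f g x v df dg hf hg.
by apply: (is_derive_eq h); rewrite addrC [g x *: _]mulrC.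
Qed.

Lemma derV f x v (df : R) : f x != 0 -> is_derive x v f df ->
  is_derive x v (fun y => (f y)^-1) (- df * (f x)^-1 * (f x)^-1).
Proof.
move=> f0 [hf <-]; apply: DeriveDef; first exact: derivableV.
rewrite deriveV // -[LHS]/(- (f x) ^- 2 * 'D_v f x) -exprVn expr2; ring.
Qed.

Lemma der_cst (c : R) x v : is_derive x v (fun=> c) 0.
Proof. exact: is_derive_cst. Qed.

Lemma der_sum (I : finType) (P : pred I) (F : I -> V -> R) (dF : I -> R) x v :
  (forall i, P i -> is_derive x v (F i) (dF i)) ->
  is_derive x v (fun y => \sum_(i | P i) F i y) (\sum_(i | P i) dF i).
Proof.
move=> h; rewrite (_ : (fun y => _) = \sum_(i | P i) F i); last first.
  by apply/funext => y; rewrite fct_sumE.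
elim/big_ind2: _ => //; first exact: is_derive_cst.
by move=> *; exact: is_deriveD.
Qed.

End DeriveRules.

Lemma der_id (R : realType) (t : R) : is_derive t 1 (fun s : R => s) 1.
Proof. exact: is_derive_id. Qed.

Lemma der_comp (R : realType) (f g : R -> R) (t df dg : R) :
  is_derive t 1 f df -> is_derive (f t) 1 g dg ->
  is_derive t 1 (fun s => g (f s)) (dg * df).
Proof.
by move=> hf hg; exact: is_derive1_comp.
Qed.

Lemma der_cont (R : realType) (W : normedModType R) (f : R -> W) (t : R) d :
  is_derive t 1 f d -> {for t, continuous f}.
Proof. by move=> [/derivable1_diffP/differentiable_continuous]. Qed.

Lemma der_line (R : realType) (V W : normedModType R) (f : V -> W) (p e : V) (t : R) :
  derivable f (p + t *: e) e ->
  is_derive t 1 (fun s => f (p + s *: e)) ('D_e f (p + t *: e)).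
Proof.
move=> hf.
have E : (fun h : R => h^-1 *: (f (p + (h *: (1 : R) + t) *: e) - f (p + t *: e))) =
   (fun h => h^-1 *: (f (h *: e + (p + t *: e)) - f (p + t *: e))).
  apply/funext => h; congr (_ *: (f _ - _)).
  by rewrite [h *: 1]mulr1 scalerDl addrCA.
apply: DeriveDef; first by rewrite /derivable /= E.
by rewrite /derive /= E.
Qed.

Lemma MVT01 (R : realType) (f df : R -> R) :
  (forall t : R, 0 <= t <= 1 -> is_derive t 1 f (df t)) ->
  exists2 t, 0 <= t <= 1 & f 1 - f 0 = df t.
Proof.
move=> h; have [|||c] := @MVT R f df 0 1.
- by [].
- by move=> t; rewrite in_itv /= => /andP[a b]; apply: h; rewrite !ltW.
- apply: continuous_in_subspaceT => t; rewrite inE /= in_itv /= => t01.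
  by apply: der_cont; exact: h.
rewrite in_itv /= => /andP[a b]; rewrite subr0 mulr1 => ->.
by exists c => //; rewrite !ltW.
Qed.

Lemma MVT_gen (R : realType) (f df : R -> R) (a b : R) :
  a <= b -> (forall t, a <= t <= b -> is_derive t 1 f (df t)) ->
  exists2 t, a <= t <= b & f b - f a = df t * (b - a).
Proof.
move=> ab h; have [|||c] := @MVT_segment R f df a b.
- by [].
- by move=> t; rewrite in_itv /= => /andP[? ?]; apply: h; rewrite !ltW.
- apply: continuous_in_subspaceT => t; rewrite inE /= in_itv /= => t01.
  by apply: der_cont; exact: h.
by rewrite in_itv /= => ? ->; exists c.
Qed.

Lemma nondecr_le (R : realType) (f df : R -> R) (a b : R) :
  a <= b -> (forall t, a <= t <= b -> is_derive t 1 f (df t)) ->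
  (forall t, a <= t <= b -> 0 <= df t) -> f a <= f b.
Proof.
move=> ab h h0; have [t tab e] := MVT_gen ab h.
by rewrite -subr_ge0 e mulr_ge0 ?subr_ge0 ?h0.
Qed.

Lemma zero_der_const (R : realType) (f : R -> R) (a b : R) :
  a <= b -> (forall t, a <= t <= b -> is_derive t 1 f 0) -> f a = f b.
Proof.
move=> ab h; have [t tab] := MVT_gen ab h.
by rewrite mul0r => /eqP; rewrite subr_eq0 => /eqP.
Qed.

(** Rescaling to t in [0, 1] treats both signs of e at once. The remainder G has G'' <= 0 and G'(0)
    = 0, so G' <= 0 and G 1 <= G 0; a one-sided bound on the second derivative is enough. *)
Lemma taylor2_le (R : realType) (f f1 f2 : R -> R) (e K : R) :
  (forall s : R, `|s| <= `|e| -> is_derive s 1 f (f1 s)) ->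
  (forall s : R, `|s| <= `|e| -> is_derive s 1 f1 (f2 s)) ->
  (forall s, `|s| <= `|e| -> f2 s <= K) ->
  f e <= f 0 + e * f1 0 + 2^-1 * e ^+ 2 * K.
Proof.
move=> h1 h2 h3.
have le (t : R) : 0 <= t <= 1 -> `|t * e| <= `|e|.
  by move=> /andP[t0 t1]; rewrite normrM (ger0_norm t0) ler_piMl.
have lin (t : R) : is_derive t 1 (fun s : R => s * e) e.
  apply: is_derive_eq; first exact: derM (der_id _) (der_cst _ _ _).
  by rewrite mul1r mulr0 addr0.
pose G (t : R) := f (t * e) - t * (e * f1 0) - 2^-1 * (t * t) * (e ^+ 2 * K).
pose dG (t : R) := f1 (t * e) * e - e * f1 0 - t * (e ^+ 2 * K).
pose ddG (t : R) := f2 (t * e) * e * e - (e ^+ 2 * K).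
have dGP (t : R) : 0 <= t <= 1 -> is_derive t 1 G (dG t).
  move=> t01; apply: is_derive_eq.
    apply: derB; first (apply: derB).
    - by apply: (der_comp (lin t)); apply: h1; exact: le.
    - exact: derM (der_id _) (der_cst _ _ _).
    - apply: derM (der_cst _ _ _).
      apply: derM (der_cst _ _ _) (derM (der_id _) (der_id _)).
  by rewrite /dG; field.
have ddGP (t : R) : 0 <= t <= 1 -> is_derive t 1 dG (ddG t).
  move=> t01; apply: is_derive_eq.
    apply: derB; first (apply: derB).
    - apply: derM (der_cst _ _ _).
      by apply: (der_comp (lin t)); apply: h2; exact: le.
    - exact: der_cst.
    - exact: derM (der_id _) (der_cst _ _ _).
  by rewrite /ddG; ring.
have ddG0 (t : R) : 0 <= t <= 1 -> ddG t <= 0.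
  move=> t01; rewrite /ddG -mulrA -expr2 mulrC -mulrBr mulr_ge0_le0 ?sqr_ge0//.
  by rewrite subr_le0 h3 ?le.
have dG0 (t : R) : 0 <= t <= 1 -> dG t <= 0.
  move=> /andP[t0 t1].
  have h (s : R) : 0 <= s <= t -> is_derive s 1 dG (ddG s).
    by move=> /andP[s0 st]; apply: ddGP; rewrite s0 (le_trans st).
  have [s /andP[s0 st] E] := MVT_gen t0 h.
  have -> : dG t = ddG s * (t - 0).
    by rewrite -E /dG !mul0r; ring.
  by rewrite subr0 mulr_le0_ge0 // ddG0 // s0 (le_trans st).
have [t t01 E] := MVT01 dGP.
have := dG0 t t01; rewrite -E /G !mul0r !mul1r !mulr1 mulr0 mul0r subr0.
lra.
Qed.

(** * Functions with continuous partial derivatives, and the chain rule along curves *)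

Section C1.
Variables (R : realType) (n : nat).
Implicit Types (f : 'rV[R]_n -> R) (x h : 'rV[R]_n).

Let trunc h (j : nat) : 'rV[R]_n := \row_i (if (i < j)%N then h 0 i else 0).

Let truncS h (j : 'I_n) : trunc h j.+1 = trunc h j + h 0 j *: delta_mx 0 j.
Proof.
apply/rowP => i; rewrite !mxE eqxx /= ltnS leq_eqVlt.
by have [->|ne] := eqVneq i j; rewrite ?eqxx ?ltnn ?mulr1 ?add0r //
  (_ : (nat_of_ord i == j) = false) ?mulr0 ?addr0 //; apply/negbTE.
Qed.

Lemma normrV_le h (e : R) : 0 <= e -> (forall i, `|h 0 i| <= e) -> `|h| <= e.
Proof.
move=> e0 he; rewrite /Num.Def.normr /= mx_normrE; apply: bigmax_le => //.
by move=> -[i j] _ /=; rewrite ord1.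
Qed.

Lemma normrV_ge h i : `|h 0 i| <= `|h|.
Proof.
rewrite {2}/Num.Def.normr /= mx_normrE.
exact: (le_bigmax _ (fun ij => `|h ij.1 ij.2|) (0, i)).
Qed.

Definition grad f x h : R := \sum_k h 0 k * partial k f x.

Lemma grad_linear f x : linear (grad f x).
Proof.
move=> a u v; rewrite scaler_sumr -big_split; apply: eq_bigr => k _ /=.
by rewrite !mxE mulrDl -mulrA.
Qed.

HB.instance Definition _ f x := GRing.isLinear.Build R 'rV[R]_n R _
  (grad f x) (grad_linear f x).

(** One moves from x to x + h by changing one coordinate at a time, [trunc h k] being the successive
    corners, and applies the mean value theorem on each edge. *)
Lemma C1_expand f x (e : R) : 0 < e ->
  (\forall y \near x, forall k, derivable f y (delta_mx 0 k)) ->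
  (forall k, {for x, continuous (partial k f)}) ->
  \forall h \near (0 : 'rV[R]_n),
    `|f (x + h) - f x - grad f x h| <= e * `|h|.
Proof.
move=> e0 hd hc.
have n0 : (0 : R) < n.+1%:R by rewrite ltr0n.
(* The n edges contribute at most e' [|h|] each; dividing by n + 1 also covers n = 0. *)
pose e' := e / n.+1%:R.
have e'0 : 0 < e' by rewrite divr_gt0.
have : \forall y \near x, forall k, derivable f y (delta_mx 0 k) /\
    `|partial k f y - partial k f x| <= e'.
  have hc' : \forall y \near x, forall k, `|partial k f y - partial k f x| <= e'.
    apply: (near_all (F := nbhs x)) => k.
    have /cvgrPdist_le/(_ e' e'0) := hc k.
    by apply: filterS => y; rewrite distrC.
  near=> y => k; split; first by move: k; near: y.
  by move: k; near: y.
move=> /nbhs_ballP[d /= d0 hdd].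
near=> h.
have hd1 : `|h| < d.
  near: h; apply/nbhs_ballP; exists d => // y.
  by rewrite -ball_normE /= sub0r normrN.
have ball_ok (z : 'rV[R]_n) : `|z| <= `|h| -> ball x d (x + z).
  move=> zh; rewrite -ball_normE /= opprD addNKr normrN; exact: le_lt_trans hd1.
have E1 : trunc h n = h by apply/rowP => i; rewrite mxE ltn_ord.
have E0 : trunc h 0 = 0 by apply/rowP => i; rewrite !mxE.
have -> : f (x + h) - f x = \sum_(k < n) (f (x + trunc h k.+1) - f (x + trunc h k)).
  rewrite -(big_mkord xpredT (fun k => f (x + trunc h k.+1) - f (x + trunc h k))).
  by rewrite (telescope_sumr (fun k => f (x + trunc h k))) // E1 E0 addr0.
rewrite /grad -sumrB; apply: (le_trans (ler_norm_sum _ _ _)).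
apply: (@le_trans _ _ (\sum_(k < n) e' * `|h|)); last first.
  rewrite sumr_const card_ord -mulr_natl mulrA ler_wpM2r // /e'.
  by rewrite mulrA ler_pdivrMr // mulrC ler_wpM2l ?ltW // ltr_nat.
apply: ler_sum => k _.
pose g t := f (x + trunc h k + t *: delta_mx 0 k).
have lek (t : R) : 0 <= t <= 1 -> `|trunc h k + (t * h 0 k) *: delta_mx 0 k| <= `|h|.
  move=> /andP[t0 t1]; apply: normrV_le => // i; rewrite !mxE eqxx /=.
  have [->|ne] := eqVneq i k; rewrite ?ltnn ?add0r ?mulr1 ?mulr0 ?addr0.
    rewrite normrM (ger0_norm t0) (le_trans _ (normrV_ge h k)) //.
    by rewrite ler_piMl.
  by case: ifP => _; rewrite ?normr0 // normrV_ge.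
have dg (t : R) : 0 <= t <= 1 -> is_derive t 1 (fun t => g (t * h 0 k))
    (partial k f (x + trunc h k + (t * h 0 k) *: delta_mx 0 k) * h 0 k).
  move=> t01; apply: (der_comp (f := fun t => t * h 0 k)).
    apply: is_derive_eq; first exact: derM (der_id _) (der_cst _ _ _).
    by rewrite mul1r mulr0 addr0.
  apply: der_line; rewrite -addrA; apply: (hdd _ (ball_ok _ (lek _ t01)) k).1.
have [t t01] := MVT01 dg.
rewrite /g mul1r mul0r scale0r addr0 -addrA -truncS => ->.
rewrite [h 0 k * _]mulrC -mulrBl normrM -addrA.
apply: ler_pM => //; last exact: normrV_ge.
exact: (hdd _ (ball_ok _ (lek _ t01)) k).2.
Unshelve. all: by end_near. Qed.

(** [smooth_on] speaks of partial derivatives only; their continuity yields total differentiability,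
    on which the chain rule rests. *)
Lemma C1_differentiable f x :
  (\forall y \near x, forall k, derivable f y (delta_mx 0 k)) ->
  (forall k, {for x, continuous (partial k f)}) ->
  is_diff x f (grad f x).
Proof.
move=> hd hc.
pose L : {linear 'rV[R]_n -> R} := grad f x.
have cL : continuous L.
  move=> y; apply: cont_sum => k _ /=; apply: contM; last exact: cont_cst.
  exact: coord_continuous.
have dL : f \o shift x = cst (f x) + L +o_ (0 : 'rV[R]_n) id.
  apply/eqaddoP => _ /posnumP[e]; near=> h.
  rewrite /= /cst /= /L /= -[X in X <= _]/(`|(f (h + x) - (f x + grad f x h))|).
  by rewrite opprD addrA [h + x]addrC; near: h; exact: C1_expand.
have E := diff_unique cL dL.
apply: DiffDef; last exact: E.
by apply/diff_locallyP; rewrite E; split.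
Unshelve. all: by end_near. Qed.

Lemma der_rV (V : normedModType R) (c : V -> 'rV[R]_n) t v d :
  is_derive t v c d <-> forall k, is_derive t v (fun s => c s 0 k) (d 0 k).
Proof.
split=> [[hc <-] k|h].
  apply: DeriveDef; first exact: ((derivable_mxP c t v).1 hc 0 k).
  by rewrite derive_mx // mxE.
have hc : derivable c t v.
  by apply/derivable_mxP => i k; rewrite ord1; have [] := h k.
apply: DeriveDef => //; rewrite derive_mx //; apply/rowP => k; rewrite mxE.
by have [_ <-] := h k.
Qed.

Lemma C1_chain f (c : R -> 'rV[R]_n) t d :
  (\forall y \near c t, forall k, derivable f y (delta_mx 0 k)) ->
  (forall k, {for c t, continuous (partial k f)}) ->
  is_derive t 1 c d ->
  is_derive t 1 (fun s => f (c s)) (grad f (c t) d).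
Proof.
move=> hd hc [/derivable1_diffP dc <-].
have df := C1_differentiable hd hc.
have dfc : differentiable (f \o c) t by apply: differentiable_comp => //; exact: ex_diff.
apply: DeriveDef; first exact/derivable1_diffP.
rewrite -[LHS]/('D_1 (f \o c) t) deriveE // diff_comp //= diff_val.
by rewrite deriveE.
Qed.

End C1.

(** * Symmetry of mixed partial derivatives *)

Section Schwarz.
Variables (R : realType) (n : nat) (U : set 'rV[R]_n) (f : 'rV[R]_n -> R).
Hypothesis oU : open U.
Hypothesis fd : forall x, U x -> forall k, derivable f x (delta_mx 0 k).
Hypothesis fdd : forall x, U x -> forall k l, derivable (partial k f) x (delta_mx 0 l).
Hypothesis fc : forall x, U x -> forall k l, {for x, continuous (partial l (partial k f))}.

(** The mean value theorem, applied in direction k to the difference of f along two parallel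
    segments and then in direction l, turns the second difference into h ^ 2 times the mixed
    derivative at a nearby point. *)
Lemma second_difference x k l (e : R) : U x -> 0 < e ->
  exists2 d : R, 0 < d & forall h : R, 0 < h < d ->
    `|(f (x + h *: delta_mx 0 k + h *: delta_mx 0 l) - f (x + h *: delta_mx 0 k)
      - f (x + h *: delta_mx 0 l) + f x)
      - h ^+ 2 * partial l (partial k f) x| <= e * h ^+ 2.
Proof.
move=> Ux e0.
have : \forall y \near x, U y /\
    `|partial l (partial k f) y - partial l (partial k f) x| <= e.
  near=> y; split; first by near: y; exact: open_nbhs_nbhs.
  by rewrite distrC; near: y; move: (@fc _ Ux k l) => /cvgrPdist_le/(_ e e0).
move=> /nbhs_ballP[d /= d0 hd]; exists (d / 2); first by rewrite divr_gt0.
move=> h /andP[h0 hd2].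
have ok (s t : R) : 0 <= s <= h -> 0 <= t <= h ->
    ball x d (x + s *: delta_mx 0 k + t *: delta_mx 0 l).
  move=> /andP[s0 sh] /andP[t0 th]; rewrite -ball_normE /= -addrA opprD addNKr normrN.
  have dn (i : 'I_n) : `|delta_mx 0 i : 'rV[R]_n| <= 1.
    by apply: normrV_le => // j; rewrite mxE eqxx /=; case: eqP; rewrite ?normr0 ?normr1.
  apply: le_lt_trans (ler_normD _ _) _; rewrite !normrZ !ger0_norm //.
  have : s * `|delta_mx 0 k : 'rV[R]_n| <= s by rewrite ler_piMr.
  have : t * `|delta_mx 0 l : 'rV[R]_n| <= t by rewrite ler_piMr.
  lra.
have h00 : 0 <= h <= h by rewrite lexx ltW.
have h01 : 0 <= (0 : R) <= h by rewrite lexx ltW.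
pose p (s : R) := f (x + h *: delta_mx 0 l + s *: delta_mx 0 k) - f (x + s *: delta_mx 0 k).
have pd (s : R) : 0 <= s <= h -> is_derive s 1 p
   (partial k f (x + h *: delta_mx 0 l + s *: delta_mx 0 k)
    - partial k f (x + s *: delta_mx 0 k)).
  move=> sh; apply: derB; apply: der_line; apply: fd.
    by rewrite addrAC; exact: (hd _ (ok _ _ sh h00)).1.
  by have := (hd _ (ok _ _ sh h01)).1; rewrite scale0r addr0.
have [s sh E1] := MVT_gen (ltW h0) pd.
have qd (t : R) : 0 <= t <= h -> is_derive t 1
   (fun t => partial k f (x + s *: delta_mx 0 k + t *: delta_mx 0 l))
   (partial l (partial k f) (x + s *: delta_mx 0 k + t *: delta_mx 0 l)).
  by move=> th; apply: der_line; apply: fdd; exact: (hd _ (ok _ _ sh th)).1.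
have [t th E2] := MVT_gen (ltW h0) qd.
have -> : f (x + h *: delta_mx 0 k + h *: delta_mx 0 l) - f (x + h *: delta_mx 0 k)
      - f (x + h *: delta_mx 0 l) + f x =
    h ^+ 2 * partial l (partial k f) (x + s *: delta_mx 0 k + t *: delta_mx 0 l).
  transitivity (p h - p 0).
    by rewrite /p scale0r !addr0 [x + _ + h *: delta_mx 0 k]addrAC; ring.
  rewrite E1 subr0 expr2.
  move: E2; rewrite scale0r addr0 subr0 => E2.
  rewrite [x + h *: _ + _]addrAC E2; ring.
rewrite -mulrBr normrM ger0_norm ?sqr_ge0 // mulrC ler_wpM2r ?sqr_ge0 //.
exact: (hd _ (ok _ _ sh th)).2.
Unshelve. all: by end_near. Qed.

(** The second difference is symmetric in k and l, and after division by h ^ 2 it is close to both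
    mixed derivatives. *)
Lemma schwarz x k l : U x -> partial l (partial k f) x = partial k (partial l f) x.
Proof.
move=> Ux; apply/eqP; rewrite -subr_eq0 -normr_le0.
suff key (e : R) : 0 < e -> `|partial l (partial k f) x - partial k (partial l f) x| <= e.
  by apply/ler_addgt0Pl => e e0; rewrite addr0; exact: key.
move=> e0.
have e2 : 0 < e / 2 by rewrite divr_gt0.
have [d1 d10 h1] := second_difference k l Ux e2.
have [d2 d20 h2] := second_difference l k Ux e2.
pose h := Num.min d1 d2 / 2.
have m0 : 0 < Num.min d1 d2 by rewrite lt_min d10.
have h0 : 0 < h by rewrite divr_gt0.
have hm : h < Num.min d1 d2 by rewrite /h; lra.
move: (hm); rewrite lt_min => /andP[hd1 hd2].
have := h1 h; rewrite h0 hd1 => /(_ isT).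
have := h2 h; rewrite h0 hd2 => /(_ isT).
rewrite [x + h *: delta_mx 0 l + _]addrAC.
set A := f (x + _ + _); set B := f (x + _); set C := f (x + h *: delta_mx 0 k).
set P := partial l _ _; set Q := partial k _ _ => H1 H2.
have hh : 0 < h ^+ 2 by rewrite exprn_gt0.
rewrite -(ler_pM2r hh) -{1}(ger0_norm (ltW hh)) -normrM.
have -> : (P - Q) * h ^+ 2 = (A - B - C + f x - h ^+ 2 * Q) - (A - C - B + f x - h ^+ 2 * P).
  by ring.
apply: le_trans (ler_normB _ _) _; apply: le_trans (lerD H1 H2) _.
by rewrite -mulrDl -splitr.
Qed.

End Schwarz.

(** * Closure properties of smooth functions *)

Section Smooth.
Variables (R : realType) (n : nat).
Implicit Types (U : set 'rV[R]_n) (f g : 'rV[R]_n -> R).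

Record C1_at f x : Prop := C1At {
  C1_cont : {for x, continuous f} ;
  C1_der : forall k, derivable f x (delta_mx 0 k) }.

(** Finite orders allow inductions: the derivative of a product or an inverse again contains the
    functions themselves, which [Ck_le] supplies one order lower. *)
Fixpoint Ck (N : nat) U f : Prop :=
  (forall x, U x -> C1_at f x) /\
  (if N is N'.+1 then forall k, Ck N' U (partial k f) else True).

Lemma CkP N U f : Ck N U f <-> (forall x, U x -> C1_at f x) /\
  (if N is N'.+1 then forall k, Ck N' U (partial k f) else True).
Proof. by case: N. Qed.

Lemma smooth_partial U f k : smooth_on U f -> smooth_on U (partial k f).
Proof. by move=> h s x Ux; have := h (rcons s k) x Ux; rewrite foldr_rcons. Qed.

Lemma smooth_C1 U f x : smooth_on U f -> U x -> C1_at f x.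
Proof. by move=> h /(h [::]) []; split. Qed.

Lemma smoothP U f : smooth_on U f <-> forall N, Ck N U f.
Proof.
split=> [h N|h s].
  elim: N f h => [|N IH] f h; apply/CkP; split.
  - by move=> x; exact: smooth_C1.
  - exact: I.
  - by move=> x; exact: smooth_C1.
  - by move=> k; apply: IH; exact: smooth_partial.
elim/last_ind: s f h => [|s k IH] f h x Ux; first by have [? ?] := (h 0).1 x Ux.
rewrite foldr_rcons; apply: IH Ux => N.
exact: (h N.+1).2.
Qed.

(** A coinduction principle: it serves for explicit families, such as exponentials, that are stable
    under partial derivatives. *)
Lemma smooth_stable (P : ('rV[R]_n -> R) -> Prop) U f :
  (forall f x, P f -> U x -> C1_at f x) -> (forall f k, P f -> P (partial k f)) ->
  P f -> smooth_on U f.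
Proof.
move=> hC hP Pf s x Ux.
have Ps : P (foldr (@partial R n) f s) by elim: s => [|k s IH] //=; exact: hP.
by have [h1 h2] := hC _ x Ps Ux.
Qed.

#[local] Opaque Ck smooth_on.

Lemma Ck_le N U f : Ck N.+1 U f -> Ck N U f.
Proof.
elim: N f => [|N IH] f /CkP[h h']; apply/CkP; split; [exact: h|exact: I|exact: h|].
by move=> k; apply: IH; exact: h'.
Qed.

Lemma partial_der f x k : derivable f x (delta_mx 0 k) ->
  is_derive x (delta_mx 0 k) f (partial k f x).
Proof. exact: derivableP. Qed.

Lemma C1_partial f x k : C1_at f x -> is_derive x (delta_mx 0 k) f (partial k f x).
Proof. by move=> [_ h]; exact: partial_der. Qed.

Lemma der_partial f x k d : is_derive x (delta_mx 0 k) f d -> partial k f x = d.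
Proof. by move=> [_ <-]. Qed.

Lemma open_near U x : open U -> U x -> \forall y \near x, U y.
Proof. by move=> oU Ux; exact: open_nbhs_nbhs. Qed.

Lemma partial_congr U f g k x : open U -> (forall x, U x -> f x = g x) -> U x ->
  partial k f x = partial k g x.
Proof.
move=> oU fg Ux; apply: near_eq_derive.
by apply: filterS (open_near oU Ux) => y; exact: fg.
Qed.

Lemma C1_congr U f g x : open U -> (forall x, U x -> f x = g x) -> U x ->
  C1_at f x -> C1_at g x.
Proof.
move=> oU fg Ux [h1 h2].
have nfg : \forall y \near x, f y = g y.
  by apply: filterS (open_near oU Ux) => y; exact: fg.
by split=> [|k]; [exact: cont_congr nfg h1 | exact: near_eq_derivable nfg (h2 k)].
Qed.

Lemma Ck_congr N U f g : open U -> (forall x, U x -> f x = g x) -> Ck N U f -> Ck N U g.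
Proof.
move=> oU; elim: N f g => [|N IH] f g fg /CkP[h h']; apply/CkP; split.
- by move=> x Ux; exact: C1_congr fg Ux (h x Ux).
- exact: I.
- by move=> x Ux; exact: C1_congr fg Ux (h x Ux).
- by move=> k; apply: IH (h' k) => x Ux; exact: partial_congr fg Ux.
Qed.

Lemma C1_D f g x : C1_at f x -> C1_at g x -> C1_at (fun x => f x + g x) x.
Proof.
move=> hf hg; split; first exact: contD (C1_cont hf) (C1_cont hg).
by move=> k; have [] := derD (C1_partial k hf) (C1_partial k hg).
Qed.

Lemma C1_M f g x : C1_at f x -> C1_at g x -> C1_at (fun x => f x * g x) x.
Proof.
move=> hf hg; split; first exact: contM (C1_cont hf) (C1_cont hg).
by move=> k; have [] := derM (C1_partial k hf) (C1_partial k hg).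
Qed.

Lemma C1_V f x : f x != 0 -> C1_at f x -> C1_at (fun x => (f x)^-1) x.
Proof.
move=> f0 hf; split; first exact: contV f0 (C1_cont hf).
by move=> k; have [] := derV f0 (C1_partial k hf).
Qed.

Lemma C1_cst (c : R) x : C1_at (fun=> c) x.
Proof.
split; first exact: cont_cst.
by move=> k; have [] := der_cst c x (delta_mx 0 k).
Qed.

Lemma CkD N U f g : open U -> Ck N U f -> Ck N U g -> Ck N U (fun x => f x + g x).
Proof.
move=> oU; elim: N f g => [|N IH] f g /CkP[hf hf'] /CkP[hg hg']; apply/CkP; split.
- by move=> x Ux; exact: C1_D (hf x Ux) (hg x Ux).
- exact: I.
- by move=> x Ux; exact: C1_D (hf x Ux) (hg x Ux).
move=> k; apply: (Ck_congr (f := fun x => partial k f x + partial k g x) oU).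
  move=> x Ux; apply/esym/der_partial.
  exact: derD (C1_partial k (hf x Ux)) (C1_partial k (hg x Ux)).
exact: IH (hf' k) (hg' k).
Qed.

Lemma CkM N U f g : open U -> Ck N U f -> Ck N U g -> Ck N U (fun x => f x * g x).
Proof.
move=> oU; elim: N f g => [|N IH] f g hhf hhg; have /CkP[hf hf'] := hhf;
  have /CkP[hg hg'] := hhg; apply/CkP; split.
- by move=> x Ux; exact: C1_M (hf x Ux) (hg x Ux).
- exact: I.
- by move=> x Ux; exact: C1_M (hf x Ux) (hg x Ux).
move=> k; apply: (Ck_congr (f := fun x => partial k f x * g x + f x * partial k g x) oU).
  move=> x Ux; apply/esym/der_partial.
  exact: derM (C1_partial k (hf x Ux)) (C1_partial k (hg x Ux)).
apply: (CkD oU _ _); first exact: IH (hf' k) (Ck_le hhg).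
exact: IH (Ck_le hhf) (hg' k).
Qed.

Lemma Ck_cst N U (c : R) : open U -> Ck N U (fun=> c).
Proof.
move=> oU; elim: N c => [|N IH] c; apply/CkP; split.
- by move=> x _; exact: C1_cst.
- exact: I.
- by move=> x _; exact: C1_cst.
move=> k; apply: (Ck_congr (f := fun=> 0) oU _ (IH 0)).
by move=> x Ux; apply/esym/der_partial; exact: der_cst.
Qed.

Lemma CkV N U f : open U -> (forall x, U x -> f x != 0) ->
  Ck N U f -> Ck N U (fun x => (f x)^-1).
Proof.
move=> oU f0; elim: N => [|N IH] hhf; have /CkP[hf hf'] := hhf; apply/CkP; split.
- by move=> x Ux; exact: C1_V (f0 x Ux) (hf x Ux).
- exact: I.
- by move=> x Ux; exact: C1_V (f0 x Ux) (hf x Ux).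
move=> k; apply: (Ck_congr (f := fun x => (-1 * partial k f x) * (f x)^-1 * (f x)^-1) oU).
  move=> x Ux; apply/esym/der_partial; rewrite mulN1r.
  exact: derV (f0 x Ux) (C1_partial k (hf x Ux)).
have IH' := IH (Ck_le hhf).
apply: (CkM oU _ IH'); apply: (CkM oU _ IH'); apply: (CkM oU _ (hf' k)).
exact: Ck_cst.
Qed.

Lemma smoothD U f g : open U -> smooth_on U f -> smooth_on U g ->
  smooth_on U (fun x => f x + g x).
Proof. by move=> oU /smoothP hf /smoothP hg; apply/smoothP => N; exact: CkD. Qed.

Lemma smoothM U f g : open U -> smooth_on U f -> smooth_on U g ->
  smooth_on U (fun x => f x * g x).
Proof. by move=> oU /smoothP hf /smoothP hg; apply/smoothP => N; exact: CkM. Qed.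

Lemma smooth_cst U (c : R) : open U -> smooth_on U (fun=> c).
Proof. by move=> oU; apply/smoothP => N; exact: Ck_cst. Qed.

Lemma smoothV U f : open U -> (forall x, U x -> f x != 0) ->
  smooth_on U f -> smooth_on U (fun x => (f x)^-1).
Proof. by move=> oU h /smoothP hf; apply/smoothP => N; exact: CkV. Qed.

Lemma smooth_congr U f g : open U -> (forall x, U x -> f x = g x) ->
  smooth_on U f -> smooth_on U g.
Proof. by move=> oU fg /smoothP hf; apply/smoothP => N; exact: Ck_congr fg (hf N). Qed.

Lemma smoothB U f g : open U -> smooth_on U f -> smooth_on U g ->
  smooth_on U (fun x => f x - g x).
Proof.
move=> oU hf hg; apply: (smooth_congr (f := fun x => f x + (-1) * g x) oU).
  by move=> x _; rewrite mulN1r.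
by apply: (smoothD oU hf _); apply: (smoothM oU _ hg); exact: smooth_cst.
Qed.

Lemma smooth_sum (I : finType) (P : pred I) U (F : I -> 'rV[R]_n -> R) : open U ->
  (forall i, P i -> smooth_on U (F i)) -> smooth_on U (fun x => \sum_(i | P i) F i x).
Proof.
move=> oU h; rewrite (_ : (fun y => _) = \sum_(i | P i) F i); last first.
  by apply/funext => y; rewrite fct_sumE.
elim/big_ind: _; [exact: smooth_cst | by move=> *; exact: smoothD | exact: h].
Qed.

Lemma smooth_prod (I : finType) (P : pred I) U (F : I -> 'rV[R]_n -> R) : open U ->
  (forall i, P i -> smooth_on U (F i)) -> smooth_on U (fun x => \prod_(i | P i) F i x).
Proof.
move=> oU h; rewrite (_ : (fun y => _) = \prod_(i | P i) F i); last first.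
  by apply/funext => y; rewrite fct_prodE.
elim/big_ind: _; [exact: smooth_cst | by move=> *; exact: smoothM | exact: h].
Qed.

Lemma smooth_det m U (A : 'rV[R]_n -> 'M[R]_m) : open U ->
  (forall i j, smooth_on U (fun x => A x i j)) -> smooth_on U (fun x => \det (A x)).
Proof.
move=> oU h; rewrite /determinant; apply: (smooth_sum oU _) => s _.
apply: (smoothM oU _ _); [exact: smooth_cst | apply: (smooth_prod oU _) => i _; exact: h].
Qed.

Lemma smooth_invmx m U (A : 'rV[R]_n -> 'M[R]_m) : open U ->
  (forall x, U x -> A x \in unitmx) ->
  (forall i j, smooth_on U (fun x => A x i j)) ->
  forall i j, smooth_on U (fun x => invmx (A x) i j).
Proof.
move=> oU hu h i j.
apply: (smooth_congr (f := fun x =>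
  (\det (A x))^-1 * ((-1) ^+ (j + i) * \det (row' j (col' i (A x))))) oU).
  by move=> x Ux; rewrite /invmx hu // !mxE.
apply: (smoothM oU _ _).
  apply: (smoothV oU _ _); last exact: smooth_det.
  by move=> x /hu; rewrite unitmxE unitfE.
apply: (smoothM oU _ _); first exact: smooth_cst.
apply: (smooth_det oU _) => k l.
by under eq_fun do rewrite !mxE; exact: h.
Qed.

Lemma smooth_cont U f x : smooth_on U f -> U x -> {for x, continuous f}.
Proof. by move=> h /(smooth_C1 h)[]. Qed.

Lemma smooth_derivable U f x k : smooth_on U f -> U x -> derivable f x (delta_mx 0 k).
Proof. by move=> h /(smooth_C1 h)[]. Qed.

Lemma smooth_schwarz U f x k l : open U -> smooth_on U f -> U x ->
  partial l (partial k f) x = partial k (partial l f) x.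
Proof.
move=> oU h Ux; apply: (@schwarz _ _ U) => // y Uy => [i|i j|i j].
- exact: smooth_derivable h Uy.
- exact: smooth_derivable (smooth_partial i h) Uy.
- exact: smooth_cont (smooth_partial j (smooth_partial i h)) Uy.
Qed.

Lemma smooth_diff U f x : open U -> smooth_on U f -> U x -> is_diff x f (grad f x).
Proof.
move=> oU h Ux; apply: C1_differentiable => [|k].
  apply: filterS (open_near oU Ux) => y Uy k; exact: smooth_derivable h Uy.
exact: smooth_cont (smooth_partial k h) Ux.
Qed.

Lemma smooth_chain U f (c : R -> 'rV[R]_n) t d : open U -> smooth_on U f -> U (c t) ->
  is_derive t 1 c d -> is_derive t 1 (fun s => f (c s)) (grad f (c t) d).
Proof.
move=> oU h Ux; apply: C1_chain => [|k].
  apply: filterS (open_near oU Ux) => y Uy k; exact: smooth_derivable h Uy.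
exact: smooth_cont (smooth_partial k h) Ux.
Qed.

End Smooth.

#[local] Opaque Ck smooth_on.

(** * The Levi-Civita connection and the curvature in a chart *)

Section InnerProduct.
Variables (R : realType) (n : nat).
Implicit Types (G H : 'M[R]_n) (a b c : 'rV[R]_n).

Definition ip G a b : R := (a *m G *m b^T) 0 0.

Lemma ipE G a b : ip G a b = \sum_i \sum_j a 0 i * G i j * b 0 j.
Proof.
rewrite /ip mxE exchange_big /=; apply: eq_bigr => j _.
by rewrite !mxE mulr_suml.
Qed.

Lemma ipDl G a b c : ip G (a + b) c = ip G a c + ip G b c.
Proof. by rewrite /ip !mulmxDl mxE. Qed.
Lemma ipDr G a b c : ip G c (a + b) = ip G c a + ip G c b.
Proof. by rewrite /ip linearD mulmxDr mxE. Qed.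
Lemma ipDm G H a b : ip (G + H) a b = ip G a b + ip H a b.
Proof. by rewrite /ip mulmxDr mulmxDl mxE. Qed.
Lemma ipZl G k a c : ip G (k *: a) c = k * ip G a c.
Proof. by rewrite /ip -!scalemxAl mxE. Qed.
Lemma ipZr G k a c : ip G c (k *: a) = k * ip G c a.
Proof. by rewrite /ip linearZ -!scalemxAr mxE. Qed.
Lemma ipZm G k a c : ip (k *: G) c a = k * ip G c a.
Proof. by rewrite /ip -scalemxAr -scalemxAl mxE. Qed.
Lemma ipNl G a c : ip G (- a) c = - ip G a c.
Proof. by rewrite -scaleN1r ipZl mulN1r. Qed.
Lemma ipNr G a c : ip G c (- a) = - ip G c a.
Proof. by rewrite -scaleN1r ipZr mulN1r. Qed.
Lemma ip0l G c : ip G 0 c = 0.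
Proof. by rewrite /ip !mul0mx mxE. Qed.
Lemma ip0r G c : ip G c 0 = 0.
Proof. by rewrite /ip trmx0 mulmx0 mxE. Qed.
Lemma ipBl G a b c : ip G (a - b) c = ip G a c - ip G b c.
Proof. by rewrite ipDl ipNl. Qed.
Lemma ipBr G a b c : ip G c (a - b) = ip G c a - ip G c b.
Proof. by rewrite ipDr ipNr. Qed.

Lemma ip_sym G a b : G^T = G -> ip G a b = ip G b a.
Proof.
move=> GT; rewrite /ip -[in RHS]GT -[in RHS](trmxK b) -mulmxA -trmx_mul.
by rewrite -trmx_mul [RHS]mxE mulmxA.
Qed.

Lemma ip_delta G a (j : 'I_n) : ip G a (delta_mx 0 j) = (a *m G) 0 j.
Proof. by rewrite /ip trmx_delta -colE mxE. Qed.

Lemma row_expand (a : 'rV[R]_n) : a = \sum_i a 0 i *: delta_mx 0 i.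
Proof. exact: row_sum_delta. Qed.

Lemma der_ip (G : R -> 'M[R]_n) (a b : R -> 'rV[R]_n) (t : R)
    (dG : 'M[R]_n) (da db : 'rV[R]_n) :
  (forall i j, is_derive t 1 (fun s => G s i j) (dG i j)) ->
  is_derive t 1 a da -> is_derive t 1 b db ->
  is_derive t 1 (fun s => ip (G s) (a s) (b s))
    (ip dG (a t) (b t) + ip (G t) da (b t) + ip (G t) (a t) db).
Proof.
move=> hG /der_rV ha /der_rV hb.
apply: (der_congr (f := fun s => \sum_i \sum_j a s 0 i * G s i j * b s 0 j)).
- by near=> s; rewrite ipE.
- shelve.
- apply: der_sum => i _; apply: der_sum => j _.
  exact: derM (derM (ha i) (hG i j)) (hb j).
Unshelve.
- by end_near.
- rewrite !ipE -!big_split; apply: eq_bigr => i _ /=.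
  by rewrite -!big_split; apply: eq_bigr => j _ /=; ring.
Qed.

Lemma cont_ip (T : topologicalType) (G : T -> 'M[R]_n) (a b : T -> 'rV[R]_n) t :
  (forall i j, {for t, continuous (fun s => G s i j)}) ->
  (forall i, {for t, continuous (fun s => a s 0 i)}) ->
  (forall i, {for t, continuous (fun s => b s 0 i)}) ->
  {for t, continuous (fun s => ip (G s) (a s) (b s))}.
Proof.
move=> hG ha hb; apply: (cont_congr (f := fun s => \sum_i \sum_j a s 0 i * G s i j * b s 0 j)).
  by near=> s; rewrite ipE.
apply: cont_sum => i _; apply: cont_sum => j _.
exact: contM (contM (ha i) (hG i j)) (hb j).
Unshelve. all: by end_near. Qed.

End InnerProduct.

Section Grad.
Variables (R : realType) (n : nat).
Implicit Types (U : set 'rV[R]_n) (f : 'rV[R]_n -> R) (x u v : 'rV[R]_n).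

Lemma grad_delta f x k : grad f x (delta_mx 0 k) = partial k f x.
Proof.
rewrite /grad (bigD1 k) //= mxE !eqxx mul1r big1 ?addr0 // => i ik.
by rewrite mxE eqxx (negbTE ik) mul0r.
Qed.

Lemma grad_sum_dir (I : finType) f x (c : I -> R) (e : I -> 'rV[R]_n) :
  grad f x (\sum_i c i *: e i) = \sum_i c i * grad f x (e i).
Proof. by rewrite linear_sum; apply: eq_bigr => i _; rewrite linearZ. Qed.

Lemma smooth_grad U f v : open U -> smooth_on U f -> smooth_on U (fun y => grad f y v).
Proof.
move=> oU h; apply: (smooth_sum oU) => k _.
by apply: (smoothM oU); [exact: smooth_cst | exact: smooth_partial].
Qed.

Lemma gradZ_fun U f (k : R) x u : open U -> smooth_on U f -> U x ->
  grad (fun y => k * f y) x u = k * grad f x u.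
Proof.
move=> oU h Ux; rewrite /grad mulr_sumr; apply: eq_bigr => i _.
rewrite mulrCA; congr (_ * _); apply: der_partial.
apply: is_derive_eq; first exact: derM (der_cst _ _ _) (C1_partial i (smooth_C1 h Ux)).
by rewrite mul0r add0r.
Qed.

Lemma grad_sum_fun (I : finType) U (F : I -> 'rV[R]_n -> R) x u : open U ->
  (forall i, smooth_on U (F i)) -> U x ->
  grad (fun y => \sum_i F i y) x u = \sum_i grad (F i) x u.
Proof.
move=> oU h Ux; rewrite /grad exchange_big /=; apply: eq_bigr => k _.
rewrite -mulr_sumr; congr (_ * _); apply: der_partial.
by apply: der_sum => i _; exact: C1_partial (smooth_C1 (h i) Ux).
Qed.

Lemma grad_congr U f1 f2 x u : open U -> (forall x, U x -> f1 x = f2 x) -> U x ->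
  grad f1 x u = grad f2 x u.
Proof.
move=> oU h Ux; rewrite /grad; apply: eq_bigr => k _.
by rewrite (partial_congr k oU h Ux).
Qed.

Lemma grad_schwarz U f x u v : open U -> smooth_on U f -> U x ->
  grad (fun y => grad f y v) x u = grad (fun y => grad f y u) x v.
Proof.
move=> oU h Ux.
have E a b : grad (fun y => grad f y a) x b =
    \sum_k \sum_l a 0 k * b 0 l * partial l (partial k f) x.
  rewrite (grad_sum_fun (F := fun k y => a 0 k * partial k f y) _ oU _ Ux); last first.
    by move=> k; apply: (smoothM oU); [exact: smooth_cst | exact: smooth_partial].
  apply: eq_bigr => k _; rewrite (gradZ_fun _ _ oU (smooth_partial k h) Ux).
  by rewrite /grad mulr_sumr; apply: eq_bigr => l _; rewrite mulrA.
rewrite !E exchange_big; apply: eq_bigr => k _; apply: eq_bigr => l _ /=.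
by rewrite (smooth_schwarz l k oU h Ux) [v 0 l * _]mulrC.
Qed.

Lemma der_grad U f (c v : R -> 'rV[R]_n) t dc dv : open U -> smooth_on U f -> U (c t) ->
  is_derive t 1 c dc -> is_derive t 1 v dv ->
  is_derive t 1 (fun s => grad f (c s) (v s))
    (grad (fun y => grad f y (v t)) (c t) dc + grad f (c t) dv).
Proof.
move=> oU h Ux hc /der_rV hv.
apply: is_derive_eq.
  apply: der_sum => k _.
  exact: derM (hv k) (smooth_chain oU (smooth_partial k h) Ux hc).
rewrite big_split addrC /=; congr (_ + _).
rewrite (grad_sum_fun (F := fun k y => v t 0 k * partial k f y) _ oU _ Ux); last first.
  by move=> k; apply: (smoothM oU); [exact: smooth_cst | exact: smooth_partial].
by apply: eq_bigr => k _; rewrite (gradZ_fun _ _ oU (smooth_partial k h) Ux).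
Qed.

Lemma cont_grad (T : topologicalType) U f (c v : T -> 'rV[R]_n) t : open U -> smooth_on U f ->
  U (c t) -> {for t, continuous c} -> (forall i, {for t, continuous (fun s => v s 0 i)}) ->
  {for t, continuous (fun s => grad f (c s) (v s))}.
Proof.
move=> oU h Ux hc hv; apply: cont_sum => k _.
apply: contM (hv k) _.
apply: (@continuous_comp _ _ _ c (partial k f)); first exact: hc.
exact: smooth_cont (smooth_partial k h) Ux.
Qed.

End Grad.

Ltac gen_ip :=
  repeat match goal with |- context [ip ?G ?a ?b] => generalize (ip G a b); intro end.

Section Connection.
Variables (R : realType) (n : nat) (U : set 'rV[R]_n) (g : 'rV[R]_n -> 'M[R]_n).
Hypothesis oU : open U.
Hypothesis gs : forall i j, smooth_on U (fun x => g x i j).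
Hypothesis gsym : forall x, U x -> (g x)^T = g x.
Hypothesis gu : forall x, U x -> g x \in unitmx.
Implicit Types (x u v a b c T : 'rV[R]_n).

Definition dg x v : 'M[R]_n := \matrix_(i, j) grad (fun y => g y i j) x v.

Definition ddg x u v : 'M[R]_n :=
  \matrix_(i, j) grad (fun y => grad (fun z => g z i j) y v) x u.

Lemma dgZ x k v : dg x (k *: v) = k *: dg x v.
Proof. by apply/matrixP => i j; rewrite !mxE linearZ. Qed.

Lemma dgN x v : dg x (- v) = - dg x v.
Proof. by apply/matrixP => i j; rewrite !mxE linearN. Qed.

Lemma dg_sym x v : U x -> (dg x v)^T = dg x v.
Proof.
move=> Ux; apply/matrixP => i j; rewrite !mxE; apply: (grad_congr (U := U)) => // y Uy.
by have := gsym Uy => /matrixP/(_ i j); rewrite mxE.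
Qed.

Lemma ddg_schwarz x u v : U x -> ddg x u v = ddg x v u.
Proof. by move=> Ux; apply/matrixP => i j; rewrite !mxE (grad_schwarz u v oU (gs i j) Ux). Qed.

Lemma ddg_sym x u v : U x -> (ddg x u v)^T = ddg x u v.
Proof.
move=> Ux; apply/matrixP => i j; rewrite !mxE; apply: (grad_congr (U := U)) => // y Uy.
apply: (grad_congr (U := U)) => // z Uz.
by have := gsym Uz => /matrixP/(_ i j); rewrite mxE.
Qed.

Lemma ddgZl x k u v : ddg x (k *: u) v = k *: ddg x u v.
Proof. by apply/matrixP => i j; rewrite !mxE linearZ. Qed.
Lemma ddgZr x k u v : U x -> ddg x u (k *: v) = k *: ddg x u v.
Proof. by move=> Ux; rewrite ddg_schwarz // ddgZl ddg_schwarz. Qed.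

Lemma gipC x a b : U x -> ip (g x) a b = ip (g x) b a.
Proof. by move=> Ux; rewrite ip_sym // gsym. Qed.
Lemma dgipC x v a b : U x -> ip (dg x v) a b = ip (dg x v) b a.
Proof. by move=> Ux; rewrite ip_sym // dg_sym. Qed.
Lemma ddgipC x u v a b : U x -> ip (ddg x u v) a b = ip (ddg x u v) b a.
Proof. by move=> Ux; rewrite ip_sym // ddg_sym. Qed.

(** The Christoffel symbols of the first kind as a trilinear form, with the lowered index in the
    last slot. *)
Definition chrl x a b c : R :=
  2^-1 * (ip (dg x a) b c + ip (dg x b) a c - ip (dg x c) a b).

Definition chr x a b : 'rV[R]_n :=
  \row_k \sum_i \sum_j a 0 i * b 0 j * christoffel g k i j x.

Lemma chrl_expand x a b c : chrl x a b c = \sum_l c 0 l * chrl x a b (delta_mx 0 l).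
Proof.
have E (M : 'M[R]_n) d : ip M d c = \sum_l c 0 l * ip M d (delta_mx 0 l).
  rewrite {1}(row_expand c) /ip linear_sum mulmx_sumr summxE.
  by apply: eq_bigr => l _; rewrite linearZ -scalemxAr mxE.
rewrite {1}/chrl (E _ a) (E _ b).
have -> : ip (dg x c) a b = \sum_l c 0 l * ip (dg x (delta_mx 0 l)) a b.
  rewrite ipE; under [RHS]eq_bigr do rewrite ipE mulr_sumr.
  rewrite [RHS]exchange_big; apply: eq_bigr => i _ /=.
  under [RHS]eq_bigr do rewrite mulr_sumr.
  rewrite [RHS]exchange_big; apply: eq_bigr => j _ /=.
  rewrite mxE {1}(row_expand c) grad_sum_dir mulr_sumr mulr_suml.
  by apply: eq_bigr => l _; rewrite mxE; ring.
rewrite -big_split -sumrB mulr_sumr; apply: eq_bigr => l _ /=.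
by rewrite /chrl; ring.
Qed.

Lemma chr_invmx x a b : U x ->
  chr x a b = (\row_l chrl x a b (delta_mx 0 l)) *m invmx (g x).
Proof.
move=> Ux; apply/rowP => k; rewrite !mxE.
transitivity (\sum_l invmx (g x) k l * chrl x a b (delta_mx 0 l)); last first.
  apply: eq_bigr => l _; rewrite mxE mulrC; congr (_ * _).
  by rewrite -[in LHS](gsym Ux) -trmx_inv mxE.
have E l : chrl x a b (delta_mx 0 l) = \sum_i \sum_j a 0 i * b 0 j * (2^-1 *
    (partial i (fun y => g y j l) x + partial j (fun y => g y i l) x
     - partial l (fun y => g y i j) x)).
  rewrite /chrl !ip_delta ipE !mxE.
  under [X in X + _ - _]eq_bigr do rewrite mxE /grad mulr_sumr.
  rewrite exchange_big /=.
  under [X in _ + X - _]eq_bigr do rewrite mxE /grad mulr_sumr.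
  rewrite -big_split -sumrB mulr_sumr; apply: eq_bigr => i _ /=.
  rewrite -big_split -sumrB mulr_sumr; apply: eq_bigr => j _ /=.
  by rewrite mxE grad_delta; ring.
under [RHS]eq_bigr do rewrite E mulr_sumr.
rewrite [RHS]exchange_big; apply: eq_bigr => i _ /=.
under [RHS]eq_bigr do rewrite mulr_sumr.
rewrite [RHS]exchange_big; apply: eq_bigr => j _ /=.
rewrite /christoffel mulr_sumr mulr_sumr; apply: eq_bigr => l _; ring.
Qed.

(** Pairing with g cancels the inverse matrix hidden in [chr]. Inner products with Christoffel terms
    become combinations of first derivatives of the metric, which [ring] and [field] can compare. *)
Lemma koszul x a b c : U x -> ip (g x) (chr x a b) c = chrl x a b c.
Proof.
move=> Ux; rewrite chr_invmx // /ip mulmxKV ?gu // mxE chrl_expand.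
by apply: eq_bigr => l _; rewrite !mxE mulrC.
Qed.

Lemma smooth_christoffel k i j : smooth_on U (christoffel g k i j).
Proof.
have sp (a b c : 'I_n) : smooth_on U (partial a (fun y => g y b c)) by exact: smooth_partial.
rewrite /christoffel.
apply: (smoothM oU); first exact: smooth_cst.
apply: (smooth_sum oU) => l _; apply: (smoothM oU).
  by apply: smooth_invmx => //; exact: gs.
by apply: (smoothB oU) (sp _ _ _); apply: (smoothD oU); exact: sp.
Qed.

Lemma smooth_chr a b k : smooth_on U (fun x => chr x a b 0 k).
Proof.
apply: (smooth_congr (f := fun x => \sum_i \sum_j a 0 i * b 0 j * christoffel g k i j x) oU).
  by move=> x _; rewrite mxE.
apply: (smooth_sum oU) => i _; apply: (smooth_sum oU) => j _.
by apply: (smoothM oU); [exact: smooth_cst | exact: smooth_christoffel].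
Qed.

Lemma chrC x a b : U x -> chr x a b = chr x b a.
Proof.
move=> Ux; rewrite !chr_invmx //; congr (_ *m _); apply/rowP => l; rewrite !mxE /chrl.
by rewrite [ip (dg x (delta_mx 0 l)) a b]dgipC //; ring.
Qed.

Lemma chrZl x k a b : chr x (k *: a) b = k *: chr x a b.
Proof.
apply/rowP => l; rewrite !mxE mulr_sumr; apply: eq_bigr => i _.
by rewrite mulr_sumr; apply: eq_bigr => j _; rewrite mxE; ring.
Qed.

Lemma chrZr x k a b : U x -> chr x a (k *: b) = k *: chr x a b.
Proof. by move=> Ux; rewrite chrC // chrZl chrC. Qed.

Definition dchr x u a b : 'rV[R]_n := \row_k grad (fun y => chr y a b 0 k) x u.

Lemma der_g (c : R -> 'rV[R]_n) (t : R) d i j : U (c t) -> is_derive t 1 c d ->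
  is_derive t 1 (fun s => g (c s) i j) (dg (c t) d i j).
Proof. by move=> Ux hc; rewrite mxE; exact: smooth_chain oU (gs i j) Ux hc. Qed.

Lemma der_dg (c v : R -> 'rV[R]_n) (t : R) d dv i j : U (c t) ->
  is_derive t 1 c d -> is_derive t 1 v dv ->
  is_derive t 1 (fun s => dg (c s) (v s) i j) ((ddg (c t) d (v t) + dg (c t) dv) i j).
Proof.
move=> Ux hc hv; apply: (der_congr _ _ (der_grad oU (gs i j) Ux hc hv)).
  by near=> s; rewrite mxE.
by rewrite !mxE.
Unshelve. all: by end_near. Qed.

Lemma der_cstV (t : R) (a : 'rV[R]_n) : is_derive t 1 (fun=> a) 0.
Proof. exact: is_derive_cst. Qed.

Lemma der_lineV (t : R) x u : is_derive t 1 (fun s : R => x + s *: u) u.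
Proof.
apply/der_rV => k; apply: (der_congr (f := fun s : R => x 0 k + s * u 0 k)).
- by near=> s; rewrite !mxE.
- shelve.
- exact: derD (der_cst _ _ _) (derM (der_id _) (der_cst _ _ _)).
Unshelve.
- by end_near.
- by rewrite mul1r mulr0 addr0 add0r.
Qed.

Lemma is_derive_unique (f : R -> R) (t a b : R) :
  is_derive t 1 f a -> is_derive t 1 f b -> a = b.
Proof. by move=> [_ <-] [_ <-]. Qed.

Lemma open_line x u : U x -> \forall t \near (0 : R), U (x + t *: u).
Proof.
move=> Ux; have hc : {for (0 : R), continuous (fun t : R => x + t *: u)}.
  exact: der_cont (der_lineV _ _ _).
by apply: hc; rewrite scale0r addr0; exact: open_near.
Qed.

(** Both sides of [koszul] are differentiated along the line x + s u. This avoids differentiating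
    the inverse matrix; the last term comes from the derivative of g itself. *)
Lemma ip_dchr x u a b c : U x -> ip (g x) (dchr x u a b) c =
  2^-1 * (ip (ddg x u a) b c + ip (ddg x u b) a c - ip (ddg x u c) a b)
  - ip (dg x u) (chr x a b) c.
Proof.
move=> Ux; pose l (s : R) := x + s *: u.
have l0 : l 0 = x by rewrite /l scale0r addr0.
have hl : is_derive (0 : R) 1 l u by exact: der_lineV.
have Ul : U (l 0) by rewrite l0.
have h1 : is_derive (0 : R) 1 (fun s => ip (g (l s)) (chr (l s) a b) c)
    (ip (dg x u) (chr x a b) c + ip (g x) (dchr x u a b) c + ip (g x) (chr x a b) 0).
  have hchr : is_derive (0 : R) 1 (fun s => chr (l s) a b) (dchr (l 0) u a b).
    by apply/der_rV => k; rewrite mxE; exact: smooth_chain oU (smooth_chr a b k) Ul hl.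
  have := der_ip (fun i j => der_g i j Ul hl) hchr (der_cstV 0 c).
  by rewrite l0.
have hd p q r : is_derive (0 : R) 1 (fun s => ip (dg (l s) p) q r) (ip (ddg x u p) q r).
  have h0 : is_derive (0 : R) 1 (fun=> p) 0 by exact: der_cstV.
  have h := der_ip (G := fun s => dg (l s) p) (fun i j => der_dg i j Ul hl h0)
    (der_cstV _ q) (der_cstV _ r).
  apply: is_derive_eq h _; rewrite /= l0 ip0l ip0r !addr0; congr (ip _ _ _).
  by apply/matrixP => i j; rewrite !mxE linear0 addr0.
have h2 : is_derive (0 : R) 1 (fun s => ip (g (l s)) (chr (l s) a b) c)
  (2^-1 * (ip (ddg x u a) b c + ip (ddg x u b) a c - ip (ddg x u c) a b)).
  apply: (der_congr _ _ (derM (der_cst 2^-1 _ _)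
    (derB (derD (hd a b c) (hd b a c)) (hd c a b)))); last by rewrite /= mul0r add0r.
  near=> s; rewrite /= koszul //; near: s; exact: open_line.
have := is_derive_unique h1 h2; rewrite ip0r addr0 => <-; ring.
Unshelve. all: by end_near. Qed.

(* The row [a *m rhomx x T] is R(a, T) T, so that Ric(T, T) is the trace of [rhomx x T]. *)
Definition rhomx x T : 'M[R]_n :=
  \matrix_(i, l) \sum_j \sum_k riemann g l k i j x * T 0 j * T 0 k.

(** Gathers the index sums of [riemann] into vectors, so that curvature can be handled through [chr]
    and [dchr] without components. *)
Lemma rhomxE x a T : U x -> a *m rhomx x T =
  dchr x a T T - dchr x T a T + chr x a (chr x T T) - chr x T (chr x a T).
Proof.
move=> Ux; apply/rowP => l; rewrite !mxE.
have Ed u p q : grad (fun y => chr y p q 0 l) x u =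
    \sum_i \sum_j \sum_k u 0 i * p 0 j * q 0 k * partial i (christoffel g l j k) x.
  rewrite (grad_congr _ oU
    (f2 := fun y => \sum_i \sum_j p 0 i * q 0 j * christoffel g l i j y) _ Ux); last first.
    by move=> y _; rewrite mxE.
  have sm i j : smooth_on U (fun y => p 0 i * q 0 j * christoffel g l i j y).
    by apply: (smoothM oU); [exact: smooth_cst | exact: smooth_christoffel].
  rewrite (grad_sum_fun (F := fun i y => \sum_j p 0 i * q 0 j * christoffel g l i j y) _ oU _ Ux); last first.
    by move=> i; apply: (smooth_sum oU) => j _; exact: sm.
  rewrite [RHS]exchange_big; apply: eq_bigr => i _ /=.
  rewrite (grad_sum_fun (F := fun j y => p 0 i * q 0 j * christoffel g l i j y) _ oU (sm i) Ux).
  rewrite [RHS]exchange_big; apply: eq_bigr => j _ /=.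
  rewrite (gradZ_fun _ _ oU (smooth_christoffel l i j) Ux) /grad mulr_sumr.
  by apply: eq_bigr => k _; ring.
rewrite !Ed.
have Ec p q r : \sum_i \sum_j p 0 i * chr x q r 0 j * christoffel g l i j x =
   \sum_i \sum_j \sum_k p 0 i * q 0 j * r 0 k *
     \sum_m christoffel g m j k x * christoffel g l i m x.
  apply: eq_bigr => i _.
  under eq_bigr do rewrite mxE mulr_sumr mulr_suml.
  rewrite exchange_big; apply: eq_bigr => j _ /=.
  under eq_bigr do rewrite mulr_sumr mulr_suml.
  rewrite exchange_big; apply: eq_bigr => k _ /=.
  by rewrite mulr_sumr; apply: eq_bigr => m _; ring.
rewrite !Ec.
rewrite [X in _ - X + _ - _]exchange_big [X in _ + _ - X]exchange_big /=.
rewrite -sumrB -big_split -sumrB; apply: eq_bigr => i _ /=.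
rewrite mxE mulr_sumr -sumrB -big_split -sumrB; apply: eq_bigr => j _ /=.
rewrite mulr_sumr -sumrB -big_split -sumrB; apply: eq_bigr => k _ /=.
rewrite /riemann sumrB.
set A := \sum_m _; set B := \sum_m _.
by move: A B (partial i _ x) (partial j _ x) => A B C D; ring.
Qed.

(** This is the inner product of R(v, T) T with v, see [ip_rhomx], written with second derivatives
    of the metric: the form in which curvature arises when the energy of a variation is
    differentiated twice. *)
Definition curv x v T : R :=
  ip (ddg x v T) T v - 2^-1 * ip (ddg x v v) T T - 2^-1 * ip (ddg x T T) v v
  - ip (g x) (chr x T T) (chr x v v) + ip (g x) (chr x T v) (chr x T v).

(** Compatibility of the connection with the metric. *)
Lemma dg_compat x u p q : U x -> ip (dg x u) p q = chrl x u p q + chrl x u q p.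
Proof.
by move=> Ux; rewrite /chrl (dgipC u q p) //; field.
Qed.

Lemma ip_rhomx x v T : U x -> ip (rhomx x T *m g x) v v = curv x v T.
Proof.
move=> Ux.
have -> : ip (rhomx x T *m g x) v v = ip (g x) (v *m rhomx x T) v by rewrite /ip !mulmxA.
rewrite rhomxE // ipBl ipDl ipBl.
rewrite (ip_dchr v T T v Ux) (ip_dchr T v T v Ux).
rewrite (koszul v (chr x T T) v Ux) (koszul T (chr x v T) v Ux).
rewrite (dg_compat v (chr x T T) v Ux) (dg_compat T (chr x v T) v Ux).
rewrite -(koszul v v (chr x T T) Ux) -(koszul T v (chr x v T) Ux).
rewrite /curv (gipC (chr x T T) _ Ux) (chrC v T Ux).
rewrite (ddg_schwarz T v Ux) (ddgipC v T v T Ux).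
by field.
Qed.

Lemma ricci_trace x T :
  \sum_(j < n) \sum_(k < n) ricci_coef g j k x * T 0 j * T 0 k = \tr (rhomx x T).
Proof.
rewrite /mxtrace; under [RHS]eq_bigr do rewrite mxE.
rewrite [RHS]exchange_big; apply: eq_bigr => j _ /=.
rewrite [RHS]exchange_big; apply: eq_bigr => k _ /=.
by rewrite /ricci_coef !mulr_suml.
Qed.

Lemma rhomx_self x T : U x -> T *m rhomx x T = 0.
Proof. by move=> Ux; rewrite rhomxE // subrr add0r subrr. Qed.

(* Second derivative of the energy density of a variation with velocity [v] and
   acceleration [lam *: w] along a geodesic with velocity [T], as a total
   derivative plus the index form density. *)
Lemma second_variation x T v dv w (lam dlam : R) : U x ->
  2^-1 * ip (ddg x v v) T T + 2^-1 * lam * ip (dg x w) T T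
  + 2 * ip (dg x v) T dv + ip (g x) dv dv + dlam * ip (g x) T w =
  (dlam * ip (g x) T w + lam * (ip (dg x T) T w - ip (g x) (chr x T T) w))
  + (ip (ddg x T v + dg x dv) v T + ip (dg x v) dv T - ip (dg x v) v (chr x T T)
     - 2^-1 * (ip (ddg x T T - dg x (chr x T T)) v v + 2 * ip (dg x T) v dv))
  + ip (g x) (dv + chr x T v) (dv + chr x T v) - curv x v T.
Proof.
move=> Ux; rewrite /curv !(ipDl, ipDr, ipDm).
rewrite (gipC dv (chr x T v) Ux) (koszul T v dv Ux).
rewrite (koszul T T w Ux).
have -> : ip (- dg x (chr x T T)) v v = - ip (dg x (chr x T T)) v v.
  by rewrite -scaleN1r ipZm mulN1r.
rewrite (ddg_schwarz T v Ux) (ddgipC v T v T Ux).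
rewrite (gipC (chr x T T) (chr x v v) Ux) (koszul v v (chr x T T) Ux) /chrl.
rewrite (dgipC v dv T Ux) (dgipC dv v T Ux).
by gen_ip; field.
Qed.

End Connection.

(** * Integrals and linear differential equations *)

Section Antiderivative.
Variable R : realType.
Implicit Types (f F : R -> R).

Lemma continuous_within_cc f (a b : R) :
  (forall t, a <= t <= b -> {for t, continuous f}) -> {within `[a, b], continuous f}.
Proof.
by move=> h; apply: continuous_in_subspaceT => t; rewrite inE /= in_itv /=; exact: h.
Qed.

Lemma antiderivative f (a b : R) : a < b ->
  (forall t, a <= t <= b -> {for t, continuous f}) ->
  exists F, forall t : R, a < t < b -> is_derive t 1 F (f t).
Proof.
move=> ab h.
have fi : (@lebesgue_measure R).-integrable `[a, b] (EFin \o f).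
  apply: continuous_compact_integrable; first exact: segment_compact.
  exact: continuous_within_cc.
exists (fun x => \int[lebesgue_measure]_(t in `[a, x]) f t) => t /andP[at_ tb].
have ft : {for t, continuous f} by apply: h; rewrite !ltW.
have [dF EF] := continuous_FTC1_closed tb fi at_ ft.
exact: (DeriveDef dF (etrans (esym (derive1E _ _)) EF)).
Qed.

Lemma integral01 f F :
  (forall t : R, 0 <= t <= 1 -> is_derive t 1 F (f t)) ->
  (forall t, 0 <= t <= 1 -> {for t, continuous f}) ->
  \int[lebesgue_measure]_(t in `[0, 1]) f t = F 1 - F 0.
Proof.
move=> hF hf; rewrite /Rintegral.
rewrite (@continuous_FTC2 _ f F 0 1 ltr01) //.
- exact: continuous_within_cc.
- split.
  + by move=> t; rewrite in_itv /= => /andP[t0 t1]; have [|] := hF t; rewrite ?ltW.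
  + apply: cvg_at_right_filter; have h0 : is_derive (0 : R) 1 F (f 0) by apply: hF; rewrite lexx ler01.
    exact: der_cont h0.
  + apply: cvg_at_left_filter; have h1 : is_derive (1 : R) 1 F (f 1) by apply: hF; rewrite lexx ler01.
    exact: der_cont h1.
- move=> t; rewrite in_itv /= => /andP[t0 t1]; have [|? E] := hF t; first by rewrite !ltW.
  by rewrite derive1E.
Qed.

Section IntegralBounds.
Variables (f G dG : R -> R) (e : R).
Hypothesis e0 : 0 < e.
Hypothesis hf : forall t, - e <= t <= 1 + e -> {for t, continuous f}.
Hypothesis hG : forall t : R, 0 <= t <= 1 -> is_derive t 1 G (dG t).

(** Continuity of f slightly beyond [0, 1] makes F differentiable on both sides at 0 and 1. *)
Let antiderivative01 : exists2 F, forall t : R, 0 <= t <= 1 -> is_derive t 1 F (f t) &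
  \int[lebesgue_measure]_(t in `[0, 1]) f t = F 1 - F 0.
Proof.
have e1 : - e < 1 + e by move: e0 => ?; lra.
have [F hF] := antiderivative e1 hf.
have hF' (t : R) : 0 <= t <= 1 -> is_derive t 1 F (f t).
  by move: e0 => ? /andP[t0 t1]; apply: hF; apply/andP; split; lra.
exists F => //; apply: (integral01 hF') => t /andP[t0 t1]; apply: hf.
by move: e0 => ?; apply/andP; split; lra.
Qed.

Lemma integral01_le : (forall t, 0 <= t <= 1 -> f t <= dG t) ->
  \int[lebesgue_measure]_(t in `[0, 1]) f t <= G 1 - G 0.
Proof.
move=> le; have [F hF ->] := antiderivative01.
have h (t : R) : 0 <= t <= 1 -> is_derive t 1 (fun t => G t - F t) (dG t - f t).
  by move=> t01; exact: derB (hG t01) (hF t t01).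
have h2 (t : R) : 0 <= t <= 1 -> 0 <= dG t - f t by move=> t01; rewrite subr_ge0 le.
by have := nondecr_le ler01 h h2; lra.
Qed.

Lemma integral01_ge : (forall t, 0 <= t <= 1 -> dG t <= f t) ->
  G 1 - G 0 <= \int[lebesgue_measure]_(t in `[0, 1]) f t.
Proof.
move=> le; have [F hF ->] := antiderivative01.
have h (t : R) : 0 <= t <= 1 -> is_derive t 1 (fun t => F t - G t) (f t - dG t).
  by move=> t01; exact: derB (hF t t01) (hG t01).
have h2 (t : R) : 0 <= t <= 1 -> 0 <= f t - dG t by move=> t01; rewrite subr_ge0 le.
by have := nondecr_le ler01 h h2; lra.
Qed.

End IntegralBounds.

Lemma is_derive_eps f (t d : R) :
  (forall e : R, 0 < e -> \forall h \near (0 : R), `|f (t + h) - f t - h * d| <= e * `|h|) ->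
  is_derive t 1 f d.
Proof.
move=> H.
have L : (h^-1 *: (f (h *: (1 : R) + t) - f t)) @[h --> (0 : R)^'] --> d.
  apply/cvgrPdist_le => e e0; near=> h.
  have h0 : h != 0 by near: h; exact: nbhs_dnbhs_neq.
  rewrite -[h *: 1]/(h * 1) mulr1 [h + t]addrC -[_ *: _]/(h^-1 * (f (t + h) - f t)).
  rewrite distrC -(ler_pM2l (_ : 0 < `|h|)) ?normr_gt0 // -normrM mulrBr mulrA.
  rewrite divff // mul1r mulrC [`|h| * e]mulrC [d * h]mulrC.
  by near: h; apply: nbhs_dnbhs; exact: H.
by apply: DeriveDef; [apply/cvg_ex; exists d|exact: cvg_lim L].
Unshelve. all: by end_near. Qed.

(** Nested intervals: the lower ends u k - 2 C / 2 ^ k increase and the upper ends u k + 2 C / 2 ^ k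
    decrease, so the supremum of the lower ends lies in all of them. *)
Lemma geometric_limit (u : nat -> R) (C : R) : 0 <= C ->
  (forall k, `|u k.+1 - u k| <= C / 2 ^+ k) ->
  exists L, forall k, `|u k - L| <= 2 * C / 2 ^+ k.
Proof.
move=> C0 hu.
have p2 k : 0 < (2 : R) ^+ k by rewrite exprn_gt0.
pose a k := u k - 2 * C / 2 ^+ k; pose b k := u k + 2 * C / 2 ^+ k.
have hS k : 2 * C / 2 ^+ k = 2 * C / 2 ^+ k.+1 + C / 2 ^+ k.
  by rewrite exprS; field; rewrite gt_eqF.
have aS k : a k <= a k.+1.
  have := hu k; rewrite ler_norml => /andP[+ _]; rewrite /a (hS k); lra.
have bS k : b k.+1 <= b k.
  have := hu k; rewrite ler_norml => /andP[_ +]; rewrite /b (hS k); lra.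
have ab k : a k <= b k.
  have : 0 <= 2 * C / 2 ^+ k by rewrite divr_ge0 ?mulr_ge0 // ltW.
  by rewrite /a /b; lra.
have aD k j : a k <= a (k + j)%N.
  elim: j => [|j IH]; first by rewrite addn0.
  by rewrite addnS; exact: le_trans IH (aS _).
have bD k j : b (k + j)%N <= b k.
  elim: j => [|j IH]; first by rewrite addn0.
  by rewrite addnS; exact: le_trans (bS _) IH.
have abm k m : a k <= b m.
  apply: le_trans (aD k m) _; apply: le_trans (ab _) _.
  by rewrite addnC; exact: bD.
exists (sup (range a)) => k.
have h1 : a k <= sup (range a).
  by apply: ub_le_sup; [exists (b 0) => _ [m _ <-]; exact: abm | exists k].
have h2 : sup (range a) <= b k.
  by apply: ge_sup; [exists (a 0); exists 0 | move=> _ [m _ <-]; exact: abm].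
move: h1 h2; rewrite /a /b ler_norml => h1 h2; apply/andP; split; lra.
Qed.

(** Precomposition with it freezes a function outside [c, d], so that what is known on the segment
    holds on the whole line. *)
Definition clamp (c d t : R) : R := Num.max c (Num.min d t).

Lemma clamp_itv c d t : c <= d -> c <= clamp c d t <= d.
Proof.
by move=> cd; rewrite /clamp le_max lexx /= ge_max cd ge_min lexx.
Qed.

Lemma clamp_id c d t : c <= t <= d -> clamp c d t = t.
Proof. by move=> /andP[ct td]; rewrite /clamp min_r // max_r. Qed.

Lemma clamp_cont c d t : {for t, continuous (clamp c d)}.
Proof.
apply: continuous_max; first exact: cvg_cst.
by apply: continuous_min; [exact: cvg_cst|exact: cvg_id].
Qed.

Lemma eps_le (x y C : R) : (forall k, x <= y + C / 2 ^+ k) -> x <= y.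
Proof.
move=> h; apply/ler_addgt0Pr => e e0.
have [C0|C0] := leP C 0.
  by apply: le_trans (h 0%N) _; rewrite expr0 divr1; lra.
have [k hk] : exists k : nat, C / 2 ^+ k <= e.
  exists (Num.bound (C / e)); rewrite ler_pdivrMr ?exprn_gt0 // mulrC -ler_pdivrMr //.
  apply: le_trans (ltW (archi_boundP (ltW (divr_gt0 C0 e0)))) _.
  by rewrite -natrX ler_nat ltnW // ltn_expl.
by apply: le_trans (h k) _; rewrite lerD2l.
Qed.

End Antiderivative.

(** * Linear differential equations by Picard iteration *)

Section LinearODE.
Variables (R : realType) (n : nat) (A : R -> 'M[R]_n) (c d K t0 : R) (y0 : 'rV[R]_n).
Hypothesis cd : c < d.
Hypothesis Ac : forall t i j, {for t, continuous (fun s => A s i j)}.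
Hypothesis AK : forall t i j, `|A t i j| <= K.
Hypothesis K0 : 0 <= K.
Hypothesis Kcd : n%:R * K * (d - c) <= 2^-1.
Hypothesis t0cd : c < t0 < d.

Definition curve_cont (Y : R -> 'rV[R]_n) := forall t i, {for t, continuous (fun s => Y s 0 i)}.

(** The clamp keeps the new iterate continuous on the whole line, so that continuity is the only
    invariant of the iteration; the equation is claimed inside (c, d) only. *)
Lemma picard_step (Y : R -> 'rV[R]_n) : curve_cont Y ->
  exists Z, [/\ curve_cont Z, Z t0 = y0 &
    forall t : R, c < t < d -> is_derive t 1 Z (Y t *m A t)].
Proof.
move=> hY.
have fc j (t : R) : {for t, continuous (fun s => (Y s *m A s) 0 j)}.
  apply: (cont_congr (f := fun s => \sum_i Y s 0 i * A s i j)).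
    by near=> s; rewrite mxE.
  by apply: cont_sum => i _; apply: contM; [exact: hY|exact: Ac].
(* The primitives live on a wider interval in order to be continuous at c and d, where the clamp
   sends outer points. *)
have ab : c - 1 < d + 1 by move: cd; lra.
have /choice[F hF] : forall j, exists F, forall t : R, c - 1 < t < d + 1 ->
    is_derive t 1 F ((Y t *m A t) 0 j).
  by move=> j; apply: antiderivative => // t _; exact: fc.
have t0c : clamp c d t0 = t0 by case/andP: t0cd => *; rewrite clamp_id // !ltW.
exists (fun t => \row_j (y0 0 j + (F j (clamp c d t) - F j t0))); split.
- move=> t i; apply: (cont_congr (f := fun s => y0 0 i + (F i (clamp c d s) - F i t0))).
    by near=> s; rewrite mxE.
  apply: contD; first exact: cont_cst.
  apply: contB; last exact: cont_cst.
  apply: (@continuous_comp _ _ _ (clamp c d) (F i)); first exact: clamp_cont.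
  have /andP[h1 h2] := clamp_itv t (ltW cd).
  have h : is_derive (clamp c d t) 1 (F i) ((Y (clamp c d t) *m A (clamp c d t)) 0 i).
    by apply: hF; apply/andP; split; lra.
  exact: der_cont h.
- by apply/rowP => j; rewrite !mxE t0c subrr addr0.
- move=> t tcd; apply/der_rV => j.
  have h : is_derive t 1 (F j) ((Y t *m A t) 0 j).
    by apply: hF; case/andP: tcd => *; apply/andP; split; lra.
  apply: (der_congr _ _ (derD (der_cst (y0 0 j) t 1) (derB h (der_cst (F j t0) t 1)))).
    near=> s; rewrite mxE clamp_id //.
    by apply/andP; split; apply: ltW; near: s; case/andP: tcd => *;
      [exact: lt_nbhsr|exact: lt_nbhsl].
  by rewrite subr0 add0r.
Unshelve. all: by end_near. Qed.

Lemma mulmx_bound (Y : R -> 'rV[R]_n) e t j : (forall i, `|Y t 0 i| <= e) ->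
  `|(Y t *m A t) 0 j| <= n%:R * K * e.
Proof.
move=> h; rewrite mxE; apply: le_trans (ler_norm_sum _ _ _) _.
have -> : n%:R * K * e = \sum_(i < n) e * K by rewrite sumr_const card_ord -mulr_natl; ring.
by apply: ler_sum => i _; rewrite normrM ler_pM.
Qed.

(** By the mean value theorem D t is at most n K e (d - c), and [Kcd] makes this e / 2: the
    iteration contracts by one half. *)
Lemma ode_bound (D : R -> R) (dD : R -> R) e :
  (forall t : R, c < t < d -> is_derive t 1 D (dD t)) -> D t0 = 0 ->
  0 <= e -> (forall t, c < t < d -> `|dD t| <= n%:R * K * e) ->
  forall t, c < t < d -> `|D t| <= e / 2.
Proof.
move=> hD D0 e0 hb t /andP[ct td]; case/andP: t0cd => ct0 t0d.
have fin s (r : R) : c < s < d -> `|r| <= d - c -> `|dD s * r| <= e / 2.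
  move=> /hb hs hr; rewrite normrM.
  apply: (@le_trans _ _ (n%:R * K * e * (d - c))); first exact: ler_pM.
  have -> : n%:R * K * e * (d - c) = e * (n%:R * K * (d - c)) by ring.
  by rewrite ler_wpM2l.
have [le|/ltW le] := leP t0 t.
  have [s /andP[s1 s2]|s /andP[s1 s2]] := MVT_gen (f := D) (df := dD) le.
    by apply: hD; apply/andP; split; lra.
  rewrite D0 subr0 => ->; apply: fin; first by apply/andP; split; lra.
  by rewrite ger0_norm; lra.
have [s /andP[s1 s2]|s /andP[s1 s2]] := MVT_gen (f := D) (df := dD) le.
  by apply: hD; apply/andP; split; lra.
rewrite D0 sub0r => /eqP; rewrite eqr_oppLR => /eqP ->; rewrite -mulrN.
apply: fin; first by apply/andP; split; lra.
by rewrite opprB ler0_norm; lra.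
Qed.

Definition picard_next (Y : {Y | curve_cont Y}) : {Y | curve_cont Y} :=
  let h := cid (picard_step (projT2 Y)) in exist _ (projT1 h)
    (let: And3 hc _ _ := projT2 h in hc).

Lemma const_cont : curve_cont (fun=> y0). Proof. by move=> t i; exact: cont_cst. Qed.

Definition picard (k : nat) : R -> 'rV[R]_n :=
  projT1 (iter k picard_next (exist _ (fun=> y0) const_cont)).

Lemma picardS k : picard k.+1 t0 = y0 /\
  forall t : R, c < t < d -> is_derive t 1 (picard k.+1) (picard k t *m A t).
Proof. by rewrite /picard iterS /= /picard_next /=; case: cid => Z /= [hc h1 h2]. Qed.

Lemma picard0 t : picard 0 t = y0. Proof. by []. Qed.

Lemma picard_t0 k : picard k t0 = y0.
Proof. by case: k => [|k]; [exact: picard0 | exact: (picardS k).1]. Qed.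

Lemma picard_diff k t j : c < t < d ->
  `|picard k.+1 t 0 j - picard k t 0 j| <= `|y0| / 2 ^+ k.
Proof.
have [h0 hS] := (picardS 0); move=> tcd; elim: k t tcd j => [|k IH] t tcd j.
  rewrite expr0 divr1; apply: (@le_trans _ _ (`|y0| / 2)); last by have := normr_ge0 y0; lra.
  apply: (ode_bound (D := fun t => picard 1 t 0 j - picard 0 t 0 j)
     (dD := fun t => (picard 0 t *m A t) 0 j - 0)) => //.
  - move=> s scd; apply: derB; last exact: der_cst.
    exact: ((der_rV _ _ _ _).1 (hS s scd) j).
  - by rewrite !picard_t0 subrr.
  - by move=> s scd; rewrite subr0; apply: mulmx_bound => i; exact: normrV_ge.
rewrite exprS invfM mulrA [_ / 2]mulrC -mulrA mulrC.
apply: (ode_bound (D := fun t => picard k.+2 t 0 j - picard k.+1 t 0 j)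
   (dD := fun t => ((picard k.+1 t - picard k t) *m A t) 0 j)) => //.
- move=> s scd; rewrite mulmxBl mxE [in X in _ + X]mxE.
  apply: derB; first exact: ((der_rV _ _ _ _).1 ((picardS k.+1).2 s scd) j).
  exact: ((der_rV _ _ _ _).1 ((picardS k).2 s scd) j).
- by rewrite !picard_t0 subrr.
- move=> s scd; apply: (mulmx_bound (Y := fun s => picard k.+1 s - picard k s)) => i.
  by rewrite !mxE; exact: IH.
Qed.

(** The iterates converge geometrically and share a Lipschitz constant. Hence their difference
    quotients at t are within e of the right-hand side for all h in a neighbourhood independent of
    k, and the estimate survives the limit in k. *)
Lemma linear_ode : exists y : R -> 'rV[R]_n, y t0 = y0 /\
  forall t : R, c < t < d -> is_derive t 1 y (y t *m A t).
Proof.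
have /choice[y hy] : forall t, exists L : 'rV[R]_n, c < t < d ->
    forall k j, `|picard k t 0 j - L 0 j| <= 2 * `|y0| / 2 ^+ k.
  move=> t; have [tcd|tcd] := boolP (c < t < d); last by exists 0.
  have /choice[L hL] : forall j, exists L, forall k, `|picard k t 0 j - L| <= 2 * `|y0| / 2 ^+ k.
    by move=> j; apply: geometric_limit => // k; exact: picard_diff.
  by exists (\row_j L j) => _ k j; rewrite mxE.
(* An iterate differs from y by at most 2 [|y0|], and so does y0; hence iterates are bounded by 5
   [|y0|], below 2 B. *)
pose B := 3 * `|y0|.
have y00 := normr_ge0 y0.
have pB k t j : c < t < d -> `|picard k t 0 j| <= 2 * B.
  move=> tcd.
  have h1 := hy t tcd k j; have h2 := hy t tcd 0 j.
  have h3 : 2 * `|y0| / 2 ^+ k <= 2 * `|y0|.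
    by rewrite ler_pdivrMr ?exprn_gt0 // ler_peMr ?mulr_ge0 // exprn_ege1 // ler1n.
  have h4 := normrV_ge y0 j.
  rewrite expr0 divr1 picard0 in h2.
  have -> : picard k t 0 j = (picard k t 0 j - y t 0 j) - (y0 0 j - y t 0 j) + y0 0 j by ring.
  apply: le_trans (ler_normD _ _) _; apply: le_trans (lerD (ler_normB _ _) (lexx _)) _.
  rewrite /B; lra.
have B0 : 0 <= 2 * B by rewrite /B; lra.
pose M := n%:R * K * (2 * B).
have M0 : 0 <= M by rewrite !mulr_ge0.
have lip k s t j : c < s < d -> c < t < d -> `|picard k t 0 j - picard k s 0 j| <= M * `|t - s|.
  wlog st : s t / s <= t => [hw|].
    have [/hw|/ltW /hw h scd tcd] := leP s t; first exact.
    by rewrite distrC [`|t - s|]distrC; exact: h.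
  move=> /andP[cs sd] /andP[ct td]; case: k => [|k].
    by rewrite !picard0 subrr normr0 mulr_ge0.
  have [r /andP[sr rt]|r /andP[sr rt] ->] := MVT_gen (f := fun t => picard k.+1 t 0 j)
     (df := fun t => (picard k t *m A t) 0 j) st.
    by apply: ((der_rV _ _ _ _).1 ((picardS k).2 r _) j); apply/andP; split; lra.
  rewrite normrM ler_wpM2r //; apply: mulmx_bound => i.
  by apply: pB; apply/andP; split; lra.
exists y; split.
  apply/rowP => j; apply/eqP; rewrite -subr_eq0 -normr_le0; apply: (@eps_le _ _ _ (2 * `|y0|)) => k.
  by have := hy t0 t0cd k j; rewrite picard_t0 distrC add0r.
move=> t tcd; apply/der_rV => j; apply: is_derive_eps => e e0.
have nK : 0 <= n%:R * K by rewrite mulr_ge0.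
(* Each of the n terms of the vector-matrix product will vary by at most e' (K + 2 B). *)
pose e' := e / (1 + n%:R * (K + 2 * B)).
have den : 0 < 1 + n%:R * (K + 2 * B) by rewrite ltr_wpDr // mulr_ge0 // addr_ge0.
have e'0 : 0 < e' by rewrite divr_gt0.
have nA : \forall h \near (0 : R), forall i, `|A t i j - A (t + h) i j| <= e'.
  apply: (near_all (F := nbhs (0 : R))) => i.
  have /cvgrPdist_le/(_ e' e'0) := @Ac t i j.
  move=> /nbhs_ballP[r /= r0 hr]; apply/nbhs_ballP; exists r => // h.
  rewrite -ball_normE /= sub0r normrN => hh; apply: hr.
  by rewrite -ball_normE /= opprD addNKr normrN.
have nM : \forall h \near (0 : R), M * `|h| <= e'.
  have : 0 < e' / (1 + M) by rewrite divr_gt0 // ltr_wpDr.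
  move=> r0; apply/nbhs_ballP; exists (e' / (1 + M)) => // h.
  rewrite -ball_normE /= sub0r normrN ltr_pdivlMr ?ltr_wpDr // => /ltW.
  by rewrite mulrDr mulr1 mulrC; have := normr_ge0 h; lra.
have [r1 r10 h1] : exists2 r : R, 0 < r & forall h, `|h| < r -> c < t + h < d.
  case/andP: tcd => ct td; exists (Num.min (t - c) (d - t)).
    by rewrite lt_min !subr_gt0 ct.
  by move=> h; rewrite lt_min ltr_norml => /andP[/andP[? ?]]; rewrite ltr_norml => /andP[? ?];
    apply/andP; split; lra.
have [r2 /= r20 h2] := (nbhs_ballP _ _).1 nA.
have [r3 /= r30 h3] := (nbhs_ballP _ _).1 nM.
apply/nbhs_ballP; exists (Num.min r1 (Num.min r2 r3)); first by rewrite /= !lt_min r10 r20.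
move=> h; rewrite -ball_normE /= sub0r normrN !lt_min => /and3P[hr1 hr2 hr3].
have small s : `|s| <= `|h| -> [/\ c < t + s < d, forall i, `|A t i j - A (t + s) i j| <= e'
    & M * `|s| <= e'].
  move=> sh; split.
  - by apply: h1; exact: le_lt_trans sh hr1.
  - by apply: h2; rewrite -ball_normE /= sub0r normrN; exact: le_lt_trans sh hr2.
  - by apply: h3; rewrite -ball_normE /= sub0r normrN; exact: le_lt_trans sh hr3.
have dev k s : `|s| <= `|h| ->
   `|(picard k (t + s) *m A (t + s)) 0 j - (picard k t *m A t) 0 j| <= e.
  move=> /small[ts As Ms]; rewrite !mxE -sumrB.
  apply: le_trans (ler_norm_sum _ _ _) _.
  apply: (@le_trans _ _ (\sum_(i < n) e' * (K + 2 * B))).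
    apply: ler_sum => i _.
    have -> : picard k (t + s) 0 i * A (t + s) i j - picard k t 0 i * A t i j =
      (picard k (t + s) 0 i - picard k t 0 i) * A (t + s) i j
      - picard k t 0 i * (A t i j - A (t + s) i j) by ring.
    apply: le_trans (ler_normB _ _) _; rewrite !normrM mulrDr; apply: lerD.
      apply: ler_pM => //; apply: le_trans Ms.
      by have := lip k t (t + s) i tcd ts; rewrite addrAC subrr add0r.
    by rewrite mulrC; apply: ler_pM => //; exact: pB.
  have Ee : e = e' * (1 + n%:R * (K + 2 * B)) by rewrite divfK ?gt_eqF.
  have -> : \sum_(i < n) e' * (K + 2 * B) = e' * (n%:R * (K + 2 * B)).
    by rewrite sumr_const card_ord -mulr_natl; ring.
  by rewrite [leRHS]Ee [leRHS]mulrDr mulr1 lerDr ltW.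
(* The estimate is proved for iterate k + 1 up to an error that is a multiple of 1 / 2 ^ k. *)
apply: (@eps_le _ _ _ ((4 + `|h| * n%:R * K) * 2 * `|y0|)) => k.
have step : `|picard k.+1 (t + h) 0 j - picard k.+1 t 0 j - h * (picard k t *m A t) 0 j|
    <= e * `|h|.
  have dk s : `|s| <= `|h| -> is_derive (t + s) 1 (fun t => picard k.+1 t 0 j)
      ((picard k (t + s) *m A (t + s)) 0 j).
    by move=> /small[ts _ _]; exact: ((der_rV _ _ _ _).1 ((picardS k).2 _ ts) j).
  have dg (u : R) : 0 <= u <= 1 -> is_derive u 1 (fun u => picard k.+1 (t + u * h) 0 j)
      ((picard k (t + u * h) *m A (t + u * h)) 0 j * h).
    move=> /andP[u0 u1].
    have lu : is_derive u 1 (fun u : R => t + u * h) h.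
      apply: (is_derive_eq (derD (der_cst t u 1) (derM (der_id u) (der_cst h u 1)))).
      by rewrite mul1r mulr0 addr0 add0r.
    apply: (der_comp (g := fun t => picard k.+1 t 0 j) lu); apply: dk.
    by rewrite normrM (ger0_norm u0) ler_piMl.
  have [u /andP[u0 u1]] := MVT01 dg; rewrite mul1r mul0r addr0 => ->.
  rewrite mulrC -mulrBr normrM mulrC ler_wpM2r //; apply: dev.
  by rewrite normrM (ger0_norm u0) ler_piMl.
have [ts _ _] := small h (lexx _).
have E1 := hy (t + h) ts k.+1 j; have E2 := hy t tcd k.+1 j.
have E3 : `|(picard k t *m A t) 0 j - (y t *m A t) 0 j| <= n%:R * K * (2 * `|y0| / 2 ^+ k).
  have -> : (picard k t *m A t) 0 j - (y t *m A t) 0 j = ((picard k t - y t) *m A t) 0 j.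
    by rewrite mulmxBl !mxE.
  apply: (mulmx_bound (Y := fun t => picard k t - y t)) => i.
  by rewrite !mxE; exact: hy.
have p2 : 0 < (2 : R) ^+ k by rewrite exprn_gt0.
have half : 2 * `|y0| / 2 ^+ k.+1 = `|y0| / 2 ^+ k by rewrite exprS; field; rewrite gt_eqF.
rewrite half in E1 E2.
have -> : y (t + h) 0 j - y t 0 j - h * (y t *m A t) 0 j =
  (picard k.+1 (t + h) 0 j - picard k.+1 t 0 j - h * (picard k t *m A t) 0 j)
  - (picard k.+1 (t + h) 0 j - y (t + h) 0 j) + (picard k.+1 t 0 j - y t 0 j)
  + h * ((picard k t *m A t) 0 j - (y t *m A t) 0 j) by ring.
apply: le_trans (ler_normD _ _) _; rewrite normrM.
apply: le_trans (lerD (le_trans (ler_normD _ _) (lerD (ler_normB _ _) (lexx _)))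
  (ler_wpM2l (normr_ge0 h) E3)) _.
have : 0 <= `|y0| / 2 ^+ k by rewrite divr_ge0 // ltW.
have -> : (4 + `|h| * n%:R * K) * 2 * `|y0| / 2 ^+ k =
   8 * (`|y0| / 2 ^+ k) + `|h| * (n%:R * K * (2 * `|y0| / 2 ^+ k)) by ring.
lra.
Qed.

End LinearODE.

(** * The second variation of the energy *)

Section VectorCalculus.
Variables (R : realType) (n : nat).
Implicit Types (a b : R -> 'rV[R]_n).

Lemma derVD (V : normedModType R) (a b : V -> 'rV[R]_n) t v da db :
  is_derive t v a da -> is_derive t v b db ->
  is_derive t v (fun s => a s + b s) (da + db).
Proof. by move=> ? ?; exact: is_deriveD. Qed.

Lemma derVZ (k : R -> R) a (t : R) dk da : is_derive t 1 k dk -> is_derive t 1 a da ->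
  is_derive t 1 (fun s => k s *: a s) (dk *: a t + k t *: da).
Proof.
move=> hk /der_rV ha; apply/der_rV => i.
apply: (der_congr _ _ (derM hk (ha i))); last by rewrite !mxE.
by near=> s; rewrite mxE.
Unshelve. all: by end_near. Qed.

Lemma cont_coord (T : topologicalType) (f : T -> 'rV[R]_n) t :
  {for t, continuous f} -> forall i, {for t, continuous (fun s => f s 0 i)}.
Proof.
move=> hf i; apply: (@continuous_comp _ _ _ f (fun v : 'rV[R]_n => v 0 i)); first exact: hf.
exact: coord_continuous.
Qed.

Lemma cont_rV (T : topologicalType) (f : T -> 'rV[R]_n) t :
  (forall i, {for t, continuous (fun s => f s 0 i)}) -> {for t, continuous f}.
Proof.
move=> hf; apply/cvgrPdist_le => e e0.
have : \forall s \near t, forall i, `|f t 0 i - f s 0 i| <= e.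
  by apply: (near_all (F := nbhs t)) => i; have /cvgrPdist_le/(_ e e0) := hf i.
apply: filterS => s hs; apply: normrV_le; first exact: ltW.
by move=> i; rewrite !mxE.
Qed.

Lemma contVD (T : topologicalType) (f h : T -> 'rV[R]_n) t :
  {for t, continuous f} -> {for t, continuous h} -> {for t, continuous (fun s => f s + h s)}.
Proof. by move=> hf hh; exact: cvgD. Qed.

Lemma contVZ (T : topologicalType) (k : T -> R) (f : T -> 'rV[R]_n) t :
  {for t, continuous k} -> {for t, continuous f} -> {for t, continuous (fun s => k s *: f s)}.
Proof. by move=> hf hh; exact: cvgZ. Qed.

Lemma cont_compose (T U V : topologicalType) (f : T -> U) (h : U -> V) t :
  {for t, continuous f} -> {for f t, continuous h} -> {for t, continuous (fun s => h (f s))}.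
Proof. by move=> hf hh; exact: (@continuous_comp _ _ _ f h). Qed.

Lemma grad2_expand (U : set 'rV[R]_n) f x u v : open U -> smooth_on U f -> U x ->
  grad (fun y => grad f y v) x u =
  \sum_k \sum_l v 0 k * u 0 l * partial l (partial k f) x.
Proof.
move=> oU h Ux.
rewrite (grad_sum_fun (F := fun k y => v 0 k * partial k f y) _ oU _ Ux); last first.
  by move=> k; apply: (smoothM oU); [exact: smooth_cst | exact: smooth_partial].
apply: eq_bigr => k _; rewrite (gradZ_fun _ _ oU (smooth_partial k h) Ux).
by rewrite /grad mulr_sumr; apply: eq_bigr => l _; rewrite mulrA.
Qed.

Lemma cont_grad2 (T : topologicalType) (U : set 'rV[R]_n) f (c u v : T -> 'rV[R]_n) t :
  open U -> smooth_on U f -> U (c t) -> {for t, continuous c} ->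
  {for t, continuous u} -> {for t, continuous v} ->
  {for t, continuous (fun s => grad (fun y => grad f y (v s)) (c s) (u s))}.
Proof.
move=> oU h Ux hc hu hv.
have nU : \forall s \near t, U (c s) by apply: hc; exact: open_near.
apply: (cont_congr (f := fun s => \sum_k \sum_l v s 0 k * u s 0 l * partial l (partial k f) (c s))).
  by apply: filterS nU => s Us; rewrite (grad2_expand _ _ oU h Us).
apply: cont_sum => k _; apply: cont_sum => l _.
apply: contM; first by apply: contM; exact: cont_coord.
apply: (cont_compose hc).
exact: smooth_cont (smooth_partial l (smooth_partial k h)) Ux.
Qed.

End VectorCalculus.

Section Metric.
Variables (R : realType) (n : nat) (U : set 'rV[R]_n) (g : 'rV[R]_n -> 'M[R]_n).
Hypothesis oU : open U.
Hypothesis gs : forall i j, smooth_on U (fun x => g x i j).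
Hypothesis gsym : forall x, U x -> (g x)^T = g x.
Hypothesis gu : forall x, U x -> g x \in unitmx.

Section Cont.
Variables (T : topologicalType) (t : T) (c : T -> 'rV[R]_n).
Hypothesis Uc : U (c t).
Hypothesis hc : {for t, continuous c}.

Lemma cont_gc i j : {for t, continuous (fun s => g (c s) i j)}.
Proof. by apply: (cont_compose hc) (smooth_cont (gs i j) Uc). Qed.

Lemma cont_dg v i j : {for t, continuous v} -> {for t, continuous (fun s => dg g (c s) (v s) i j)}.
Proof.
move=> hv; apply: (cont_congr (f := fun s => grad (fun y => g y i j) (c s) (v s))).
  by near=> s; rewrite mxE.
by apply: (cont_grad oU (gs i j) Uc hc) => k; exact: cont_coord.
Unshelve. all: by end_near. Qed.

Lemma cont_ddg u v i j : {for t, continuous u} -> {for t, continuous v} ->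
  {for t, continuous (fun s => ddg g (c s) (u s) (v s) i j)}.
Proof.
move=> hu hv; apply: (cont_congr (f := fun s =>
   grad (fun y => grad (fun z => g z i j) y (v s)) (c s) (u s))).
  by near=> s; rewrite mxE.
exact: cont_grad2 oU (gs i j) Uc hc hu hv.
Unshelve. all: by end_near. Qed.

Lemma cont_ipV (G : T -> 'M[R]_n) a b : (forall i j, {for t, continuous (fun s => G s i j)}) ->
  {for t, continuous a} -> {for t, continuous b} ->
  {for t, continuous (fun s => ip (G s) (a s) (b s))}.
Proof. by move=> hG ha hb; apply: cont_ip => // i; exact: cont_coord. Qed.

Lemma cont_chr a b : {for t, continuous a} -> {for t, continuous b} ->
  {for t, continuous (fun s => chr g (c s) (a s) (b s))}.
Proof.
move=> ha hb; apply: cont_rV => k.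
apply: (cont_congr (f := fun s => \sum_i \sum_j a s 0 i * b s 0 j * christoffel g k i j (c s))).
  by near=> s; rewrite mxE.
apply: cont_sum => i _; apply: cont_sum => j _.
apply: contM; first by apply: contM; exact: cont_coord.
by apply: (cont_compose hc) (smooth_cont (smooth_christoffel oU gs gu k i j) Uc).
Unshelve. all: by end_near. Qed.

Lemma cont_curv a b : {for t, continuous a} -> {for t, continuous b} ->
  {for t, continuous (fun s => curv g (c s) (a s) (b s))}.
Proof.
move=> ha hb; rewrite /curv.
apply: contD; first (apply: contB; first (apply: contB; first apply: contB)).
- by apply: cont_ipV => // i j; exact: cont_ddg.
- by apply: contM; [exact: cont_cst | apply: cont_ipV => // i j; exact: cont_ddg].
- by apply: contM; [exact: cont_cst | apply: cont_ipV => // i j; exact: cont_ddg].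
- by apply: cont_ipV; [exact: cont_gc | exact: cont_chr | exact: cont_chr].
- by apply: cont_ipV; [exact: cont_gc | exact: cont_chr | exact: cont_chr].
Qed.

Lemma cont_ricci (a : T -> 'rV[R]_n) : {for t, continuous a} ->
  {for t, continuous (fun s => \sum_j \sum_k ricci_coef g j k (c s) * a s 0 j * a s 0 k)}.
Proof.
move=> ha; apply: cont_sum => j _; apply: cont_sum => k _.
apply: contM; last exact: cont_coord.
apply: contM; last exact: cont_coord.
have sc := smooth_christoffel oU gs gu.
apply: (cont_compose hc); apply: (@smooth_cont _ _ U _ _ _ Uc).
rewrite /ricci_coef; apply: (smooth_sum oU) => i _; rewrite /riemann.
apply: (smoothD oU); first by apply: (smoothB oU); exact: smooth_partial.
by apply: (smooth_sum oU) => m _; apply: (smoothB oU); apply: (smoothM oU); exact: sc.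
Qed.

End Cont.

(* [vary e] is a variation of the curve [x] with field [v]: the indices 1 and 2 denote first and
   second derivatives in [e], and the prefix [d] the derivative in [t].  The term [r], of order
   [e ^ 2], makes the initial point of the variation the one already reached in another chart. *)
Section Energy.
Variables (x T v dv : R -> 'rV[R]_n) (r r1 r2 : R -> 'rV[R]_n) (lam dlam : R -> R).

Definition vary (e t : R) := x t + e *: v t + lam t *: r e.
Definition vary1 (e t : R) := v t + lam t *: r1 e.
Definition vary2 (e t : R) := lam t *: r2 e.
Definition dvary (e t : R) := T t + e *: dv t + dlam t *: r e.
Definition dvary1 (e t : R) := dv t + dlam t *: r1 e.
Definition dvary2 (e t : R) := dlam t *: r2 e.

Definition energy e t := ip (g (vary e t)) (dvary e t) (dvary e t).
Definition energy1 e t := ip (dg g (vary e t) (vary1 e t)) (dvary e t) (dvary e t)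
  + ip (g (vary e t)) (dvary1 e t) (dvary e t) + ip (g (vary e t)) (dvary e t) (dvary1 e t).
Definition energy2 e t :=
  (ip (ddg g (vary e t) (vary1 e t) (vary1 e t) + dg g (vary e t) (vary2 e t)) (dvary e t) (dvary e t)
   + ip (dg g (vary e t) (vary1 e t)) (dvary1 e t) (dvary e t)
   + ip (dg g (vary e t) (vary1 e t)) (dvary e t) (dvary1 e t))
  + (ip (dg g (vary e t) (vary1 e t)) (dvary1 e t) (dvary e t)
     + ip (g (vary e t)) (dvary2 e t) (dvary e t)
     + ip (g (vary e t)) (dvary1 e t) (dvary1 e t))
  + (ip (dg g (vary e t) (vary1 e t)) (dvary e t) (dvary1 e t)
     + ip (g (vary e t)) (dvary1 e t) (dvary1 e t)
     + ip (g (vary e t)) (dvary e t) (dvary2 e t)).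

Section Derivatives.
Variables (e t : R).
Hypothesis hr : is_derive e 1 r (r1 e).
Hypothesis hr1 : is_derive e 1 r1 (r2 e).
Hypothesis Ue : U (vary e t).

Lemma der_vary : is_derive e 1 (vary^~ t) (vary1 e t).
Proof.
apply: (is_derive_eq (derVD (derVD (der_cstV e (x t)) (derVZ (der_id e) (der_cstV e (v t))))
  (derVZ (der_cst (lam t) e 1) hr))).
by rewrite scale1r scaler0 addr0 add0r scale0r add0r.
Qed.

Lemma der_vary1 : is_derive e 1 (vary1^~ t) (vary2 e t).
Proof.
apply: (is_derive_eq (derVD (der_cstV e (v t)) (derVZ (der_cst (lam t) e 1) hr1))).
by rewrite scale0r !add0r.
Qed.

Lemma der_dvary : is_derive e 1 (dvary^~ t) (dvary1 e t).
Proof.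
apply: (is_derive_eq (derVD (derVD (der_cstV e (T t)) (derVZ (der_id e) (der_cstV e (dv t))))
  (derVZ (der_cst (dlam t) e 1) hr))).
by rewrite scale1r scaler0 addr0 add0r scale0r add0r.
Qed.

Lemma der_dvary1 : is_derive e 1 (dvary1^~ t) (dvary2 e t).
Proof.
apply: (is_derive_eq (derVD (der_cstV e (dv t)) (derVZ (der_cst (dlam t) e 1) hr1))).
by rewrite scale0r !add0r.
Qed.

Lemma der_energy : is_derive e 1 (energy^~ t) (energy1 e t).
Proof.
have hg i j := der_g (c := vary^~ t) oU gs i j Ue der_vary.
exact: der_ip hg der_dvary der_dvary.
Qed.

Lemma der_energy1 : is_derive e 1 (energy1^~ t) (energy2 e t).
Proof.
have hg i j := der_g (c := vary^~ t) oU gs i j Ue der_vary.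
have hdg i j := der_dg (c := vary^~ t) (v := vary1^~ t) oU gs i j Ue der_vary der_vary1.
apply: derD; first apply: derD.
- exact: der_ip hdg der_dvary der_dvary.
- exact: der_ip hg der_dvary1 der_dvary.
- exact: der_ip hg der_dvary der_dvary1.
Qed.

End Derivatives.

Section Expansion.
Variables (t0 t1 : R).
Hypothesis xc : forall t, t0 <= t <= t1 -> {for t, continuous x}.
Hypothesis Tc : forall t, t0 <= t <= t1 -> {for t, continuous T}.
Hypothesis vc : forall t, t0 <= t <= t1 -> {for t, continuous v}.
Hypothesis dvc : forall t, t0 <= t <= t1 -> {for t, continuous dv}.
Hypothesis lc : forall t, t0 <= t <= t1 -> {for t, continuous lam}.
Hypothesis dlc : forall t, t0 <= t <= t1 -> {for t, continuous dlam}.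
Hypothesis Ux : forall t, t0 <= t <= t1 -> U (x t).
Hypothesis hr : \forall e \near (0 : R), is_derive (e : R) 1 r (r1 e).
Hypothesis hr1 : \forall e \near (0 : R), is_derive (e : R) 1 r1 (r2 e).
Hypothesis hr2 : {for (0 : R), continuous r2}.
Hypothesis r0 : r 0 = 0.

Let rc : {for (0 : R), continuous r}.
Proof. by have h := nbhs_singleton hr; exact: der_cont h. Qed.

Let r1c : {for (0 : R), continuous r1}.
Proof. by have h := nbhs_singleton hr1; exact: der_cont h. Qed.

Section Joint.
Variable t : R.
Hypothesis tt : t0 <= t <= t1.
Let p0 : R * R := (t, 0).

Lemma joint_fst (W : topologicalType) (f : R -> W) : {for t, continuous f} ->
  {for p0, continuous (fun p : R * R => f p.1)}.
Proof. by move=> hf; apply: (@cont_compose _ _ _ fst f p0) hf; exact: cvg_fst. Qed.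

Lemma joint_snd (W : topologicalType) (f : R -> W) : {for (0 : R), continuous f} ->
  {for p0, continuous (fun p : R * R => f p.2)}.
Proof. by move=> hf; apply: (@cont_compose _ _ _ snd f p0) hf; exact: cvg_snd. Qed.

Let idc : {for p0, continuous (fun p : R * R => p.2)}.
Proof. exact: cvg_snd. Qed.

Let vary_p0 : vary p0.2 p0.1 = x t.
Proof. by rewrite /vary /= r0 scaler0 addr0 scale0r addr0. Qed.

Lemma vary_cont : {for p0, continuous (fun p : R * R => vary p.2 p.1)}.
Proof.
apply: contVD; first apply: contVD.
- exact: (joint_fst (xc tt)).
- by apply: contVZ => //; exact: (joint_fst (vc tt)).
- by apply: contVZ; [exact: (joint_fst (lc tt)) | exact: (joint_snd rc)].
Qed.

Lemma energy2_cont : {for p0, continuous (fun p : R * R => energy2 p.2 p.1)}.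
Proof.
have c0 := vary_cont.
have U0 : U (vary p0.2 p0.1) by rewrite vary_p0; exact: Ux.
have c1 : {for p0, continuous (fun p : R * R => vary1 p.2 p.1)}.
  apply: contVD; first exact: (joint_fst (vc tt)).
  by apply: contVZ; [exact: (joint_fst (lc tt)) | exact: (joint_snd r1c)].
have c2 : {for p0, continuous (fun p : R * R => vary2 p.2 p.1)}.
  by apply: contVZ; [exact: (joint_fst (lc tt)) | exact: (joint_snd hr2)].
have d0 : {for p0, continuous (fun p : R * R => dvary p.2 p.1)}.
  apply: contVD; first apply: contVD.
  - exact: (joint_fst (Tc tt)).
  - by apply: contVZ => //; exact: (joint_fst (dvc tt)).
  - by apply: contVZ; [exact: (joint_fst (dlc tt)) | exact: (joint_snd rc)].
have d1 : {for p0, continuous (fun p : R * R => dvary1 p.2 p.1)}.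
  apply: contVD; first exact: (joint_fst (dvc tt)).
  by apply: contVZ; [exact: (joint_fst (dlc tt)) | exact: (joint_snd r1c)].
have d2 : {for p0, continuous (fun p : R * R => dvary2 p.2 p.1)}.
  by apply: contVZ; [exact: (joint_fst (dlc tt)) | exact: (joint_snd hr2)].
have hG i j : {for p0, continuous (fun p : R * R => g (vary p.2 p.1) i j)}.
  exact: (cont_gc (c := fun p : R * R => vary p.2 p.1) U0 c0).
have hdG i j : {for p0, continuous (fun p : R * R => dg g (vary p.2 p.1) (vary1 p.2 p.1) i j)}.
  exact: (@cont_dg _ _ (fun p : R * R => vary p.2 p.1) U0 c0 _ i j c1).
have hdG2 i j : {for p0, continuous (fun p : R * R => dg g (vary p.2 p.1) (vary2 p.2 p.1) i j)}.
  exact: (@cont_dg _ _ (fun p : R * R => vary p.2 p.1) U0 c0 _ i j c2).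
have hddG i j : {for p0, continuous (fun p : R * R =>
    (ddg g (vary p.2 p.1) (vary1 p.2 p.1) (vary1 p.2 p.1)
     + dg g (vary p.2 p.1) (vary2 p.2 p.1)) i j)}.
  have h1 := @cont_ddg _ _ (fun p : R * R => vary p.2 p.1) U0 c0 _ _ i j c1 c1.
  have h := contD h1 (hdG2 i j).
  by apply: cont_congr h; near=> p; rewrite [RHS]mxE.
apply: contD; first apply: contD; (apply: contD; first apply: contD).
- exact: (cont_ipV hddG d0 d0).
- exact: (cont_ipV hdG d1 d0).
- exact: (cont_ipV hdG d0 d1).
- exact: (cont_ipV hdG d1 d0).
- exact: (cont_ipV hG d2 d0).
- exact: (cont_ipV hG d1 d1).
- exact: (cont_ipV hdG d0 d1).
- exact: (cont_ipV hG d1 d1).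
- exact: (cont_ipV hG d0 d2).
Unshelve. all: by end_near. Qed.

End Joint.

(** [energy2] is jointly continuous at every (t, 0); compactness of the segment gives one
    neighbourhood of e = 0 that works for all t. *)
Let near_energy (eta : R) : 0 < eta -> \forall e \near (0 : R), forall t, t0 <= t <= t1 ->
  U (vary e t) /\ energy2 e t <= energy2 0 t + eta.
Proof.
move=> eta0.
have cpt : compact `[t0, t1] by exact: segment_compact.
move/compact_near_coveringP/near_covering_withinP : cpt => cov.
suff : \forall e \near (0 : R), `[t0, t1] `<=`
    (fun t => U (vary e t) /\ energy2 e t <= energy2 0 t + eta).
  by apply: filterS => e H t tt; apply: H; rewrite /= in_itv.
apply: (cov R (nbhs (0 : R)) (fun e t => U (vary e t) /\ energy2 e t <= energy2 0 t + eta)).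
move=> t; rewrite /= in_itv /= => tt.
pose p0 : R * R := (t, 0).
have e2 : 0 < eta / 2 by rewrite divr_gt0.
have n1 : \forall p \near p0, `|energy2 p0.2 p0.1 - energy2 p.2 p.1| <= eta / 2.
  by have /cvgrPdist_le := energy2_cont tt; exact.
have h2 : {for p0, continuous (fun p : R * R => energy2 0 p.1)}.
  apply: (@joint_fst t _ (energy2 0)).
  apply: (@cont_compose _ _ _ (fun t : R => (t, 0 : R)) (fun p : R * R => energy2 p.2 p.1)).
    by apply: (@cvg_pair _ _ _ (nbhs t) (nbhs t) (nbhs (0 : R))); [exact: cvg_id|exact: cvg_cst].
  exact: energy2_cont tt.
have n2 : \forall p \near p0, `|energy2 0 p0.1 - energy2 0 p.1| <= eta / 2.
  by have /cvgrPdist_le := h2; exact.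
have n3 : \forall p \near p0, U (vary p.2 p.1).
  apply: (vary_cont tt); rewrite /vary /= r0 scaler0 addr0 scale0r addr0.
  by apply: open_near oU _; exact: Ux.
suff : \forall p \near p0, t0 <= p.1 <= t1 -> U (vary p.2 p.1) /\
    energy2 p.2 p.1 <= energy2 0 p.1 + eta by [].
apply: filterS3 n1 n2 n3 => p; rewrite !ler_norml => /andP[a1 a2] /andP[b1 b2] Up _.
split=> //; move: a1 a2 b1 b2; rewrite /p0 /=; lra.
Qed.

Lemma energy_expansion (eta : R) : 0 < eta ->
  (forall t, t0 <= t <= t1 -> energy 0 t = 1) ->
  (forall t, t0 <= t <= t1 -> energy1 0 t = 0) ->
  \forall e \near (0 : R), forall t, t0 <= t <= t1 ->
    U (vary e t) /\ energy e t <= 1 + 2^-1 * e ^+ 2 * (energy2 0 t + eta).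
Proof.
move=> eta0 E0 E1.
have N := near_energy eta0.
have : \forall e \near (0 : R), [/\ is_derive (e : R) 1 r (r1 e), is_derive e 1 r1 (r2 e) &
    forall t, t0 <= t <= t1 -> U (vary e t) /\ energy2 e t <= energy2 0 t + eta].
  by apply: filterS3 hr hr1 N => e; split.
move=> /nbhs_ballP[d /= d0 hd]; apply/nbhs_ballP; exists d => // e.
rewrite -ball_normE /= sub0r normrN => ed t tt.
have hs (s : R) : `|s| <= `|e| -> [/\ is_derive s 1 r (r1 s), is_derive s 1 r1 (r2 s) &
    U (vary s t) /\ energy2 s t <= energy2 0 t + eta].
  move=> se; have [|? ? H] := hd s; last by split => //; exact: H.
  by rewrite -ball_normE /= sub0r normrN; exact: le_lt_trans ed.
split; first by have [_ _ []] := hs e (lexx _).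
have := @taylor2_le R (energy^~ t) (energy1^~ t) (energy2^~ t) e (energy2 0 t + eta).
rewrite E0 // E1 // mulr0 addr0; apply.
- by move=> s /hs[? ? [? _]]; exact: der_energy.
- by move=> s /hs[? ? [? _]]; exact: der_energy1.
- by move=> s /hs[_ _ []].
Qed.

End Expansion.
End Energy.
End Metric.

Section Geodesic.
Variables (R : realType) (n : nat) (U : set 'rV[R]_n) (g : 'rV[R]_n -> 'M[R]_n).
Hypothesis oU : open U.
Hypothesis gs : forall i j, smooth_on U (fun x => g x i j).
Hypothesis gsym : forall x, U x -> (g x)^T = g x.
Hypothesis gu : forall x, U x -> g x \in unitmx.

Definition parallel_at (x T E : R -> 'rV[R]_n) (t : R) :=
  is_derive t 1 E (- chr g (x t) (T t) (E t)).

Definition geodesic_at (x T : R -> 'rV[R]_n) (t : R) :=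
  [/\ U (x t), is_derive t 1 x (T t) & parallel_at x T T t].

Lemma parallel_ip x T E F t : geodesic_at x T t -> parallel_at x T E t ->
  parallel_at x T F t -> is_derive t 1 (fun s => ip (g (x s)) (E s) (F s)) 0.
Proof.
move=> [Ux hx hT] hE hF.
apply: (is_derive_eq (der_ip (fun i j => der_g oU gs i j Ux hx) hE hF)).
rewrite ipNl ipNr (gipC gsym _ (chr _ _ _ _)) // !(koszul gsym gu) //.
by rewrite (dg_compat oU gsym) //; ring.
Qed.

Lemma parallel_ip_const x T E F t0 t1 : t0 <= t1 ->
  (forall t, t0 <= t <= t1 -> geodesic_at x T t) ->
  (forall t, t0 <= t <= t1 -> parallel_at x T E t) ->
  (forall t, t0 <= t <= t1 -> parallel_at x T F t) ->
  ip (g (x t0)) (E t0) (F t0) = ip (g (x t1)) (E t1) (F t1).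
Proof.
move=> t01 hg hE hF.
apply: (zero_der_const (f := fun s => ip (g (x s)) (E s) (F s)) t01) => t tt.
exact: parallel_ip (hg t tt) (hE t tt) (hF t tt).
Qed.

Section Variation.
Variables (x T E : R -> 'rV[R]_n) (phi dphi lam dlam : R -> R) (w : 'rV[R]_n).

Definition field t := phi t *: E t.
Definition dfield t := dphi t *: E t - phi t *: chr g (x t) (T t) (E t).
(** The inner product with T of the covariant acceleration of the transversal curves e |->
    [vary e t] at e = 0: the coordinate part of that acceleration is lam w, and Gamma(v, v) is added
    because straight coordinate lines are not geodesics. *)
Definition boundary t := lam t * ip (g (x t)) (T t) w + chrl g (x t) (field t) (field t) (T t).
(** The derivative of [boundary] once T' has been replaced by means of the geodesic equation. *)
Definition dboundary t :=
  let v := field t in let dv := dfield t in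
  (dlam t * ip (g (x t)) (T t) w
   + lam t * (ip (dg g (x t) (T t)) (T t) w - ip (g (x t)) (chr g (x t) (T t) (T t)) w))
  + (ip (ddg g (x t) (T t) v + dg g (x t) dv) v (T t) + ip (dg g (x t) v) dv (T t)
     - ip (dg g (x t) v) v (chr g (x t) (T t) (T t))
     - 2^-1 * (ip (ddg g (x t) (T t) (T t) - dg g (x t) (chr g (x t) (T t) (T t))) v v
               + 2 * ip (dg g (x t) (T t)) v dv)).

Section At.
Variable t : R.
Hypothesis hg : geodesic_at x T t.
Hypothesis hE : parallel_at x T E t.
Hypothesis hphi : is_derive t 1 phi (dphi t).
Hypothesis hlam : is_derive t 1 lam (dlam t).

Lemma der_field : is_derive t 1 field (dfield t).
Proof.
apply: (is_derive_eq (derVZ hphi hE)).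
by rewrite scalerN.
Qed.

Lemma der_boundary : is_derive t 1 boundary (dboundary t).
Proof.
have [Ux hx hT] := hg; have hv := der_field.
have hG i j := der_g oU gs i j Ux hx.
have h1 := derM hlam (der_ip hG hT (der_cstV t w)).
have h2 := der_ip (fun i j => der_dg oU gs i j Ux hx hv) hv hT.
have h3 := der_ip (fun i j => der_dg oU gs i j Ux hx hT) hv hv.
apply: (der_congr _ _ (derD h1 (derB h2 (derM (der_cst 2^-1 t 1) h3)))).
  by near=> s; rewrite /boundary /chrl /=; field.
rewrite /dboundary /= ip0r addr0 mul0r add0r ipNl ipNr.
rewrite (dgipC oU gsym (T t) (dfield t) (field t)) //.
rewrite (dgN g (x t)).
ring.
Unshelve. all: by end_near. Qed.

(** The integrand itself vanishes, and not only its integral: it is twice the inner product of T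
    with the covariant derivative of phi E, which is normal to T since E is parallel and normal. *)
Lemma energy1_0 (r r1 : R -> 'rV[R]_n) : ip (g (x t)) (E t) (T t) = 0 -> r 0 = 0 -> r1 0 = 0 ->
  energy1 g x T field dfield r r1 lam dlam 0 t = 0.
Proof.
have [Ux hx hT] := hg.
move=> ET r0 r10; rewrite /energy1 /vary /vary1 /dvary /dvary1 r0 r10 !scaler0 !scale0r !addr0.
rewrite /field /dfield dgZ ipZm !(ipBl, ipBr) !ipZl !ipZr (gipC gsym (T t) (E t)) // ET.
rewrite (gipC gsym (T t) (chr _ _ _ _)) // !(koszul gsym gu) // /chrl.
by rewrite (dgipC oU gsym (T t) (T t) (E t)) //; field.
Qed.

Lemma energy2_0 (r r1 r2 : R -> 'rV[R]_n) : ip (g (x t)) (E t) (E t) = 1 -> r 0 = 0 -> r1 0 = 0 -> r2 0 = w ->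
  energy2 g x T field dfield r r1 r2 lam dlam 0 t =
  2 * (dboundary t + dphi t ^+ 2 - phi t ^+ 2 * curv g (x t) (E t) (T t)).
Proof.
have [Ux hx hT] := hg.
move=> EE r0 r10 r20.
have Ecurv : curv g (x t) (field t) (T t) = phi t ^+ 2 * curv g (x t) (E t) (T t).
  rewrite /curv /field (ddgZl _ _ (phi t) (E t) (T t)) (ddgZl _ _ (phi t) (E t) _).
  rewrite (ddgZr oU gs _ (E t) (E t)) // (chrZr oU gsym _ (T t) (E t)) //.
  rewrite (chrZl _ _ _ (E t) (phi t *: E t)) (chrZr oU gsym _ (E t) (E t)) //.
  by rewrite !(ipZm, ipZl, ipZr); ring.
(* The covariant derivative of phi E is phi' E because E is parallel, and E has norm 1. *)
have Enab : ip (g (x t)) (dfield t + chr g (x t) (T t) (field t))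
    (dfield t + chr g (x t) (T t) (field t)) = dphi t ^+ 2.
  rewrite /field (chrZr oU gsym) // /dfield subrK ipZl ipZr EE; ring.
have := second_variation oU gs gsym gu (T t) (field t) (dfield t) w (lam t) (dlam t) Ux.
rewrite Ecurv Enab -/(dboundary t) => <-.
rewrite /energy2 /vary /vary1 /vary2 /dvary /dvary1 /dvary2 r0 r10 r20.
rewrite !scaler0 !scale0r !addr0 ipDm dgZ ipZm !(ipZl, ipZr).
rewrite (gipC gsym w (T t)) // (dgipC oU gsym (field t) (dfield t) (T t)) //.
by field.
Qed.

End At.

Section Interval.
Variables (u0 u1 t0 t1 : R) (r r1 r2 : R -> 'rV[R]_n).
Hypothesis u01 : u0 < t0 /\ t1 < u1.
Hypothesis hg : forall t, u0 < t < u1 -> geodesic_at x T t.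
Hypothesis hE : forall t, u0 < t < u1 -> parallel_at x T E t.
Hypothesis hphi : forall t : R, u0 < t < u1 -> is_derive t 1 phi (dphi t).
Hypothesis hdphi : forall t, u0 < t < u1 -> {for t, continuous dphi}.
Hypothesis hlam : forall t : R, u0 < t < u1 -> is_derive t 1 lam (dlam t).
Hypothesis hdlam : forall t, u0 < t < u1 -> {for t, continuous dlam}.
Hypothesis hr : \forall e \near (0 : R), is_derive (e : R) 1 r (r1 e).
Hypothesis hr1 : \forall e \near (0 : R), is_derive (e : R) 1 r1 (r2 e).
Hypothesis hr2 : {for (0 : R), continuous r2}.
Hypothesis r0 : r 0 = 0.
Hypothesis r10 : r1 0 = 0.
Hypothesis r20 : r2 0 = w.
Hypothesis TT : forall t, u0 < t < u1 -> ip (g (x t)) (T t) (T t) = 1.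
Hypothesis EE : forall t, u0 < t < u1 -> ip (g (x t)) (E t) (E t) = 1.
Hypothesis ET : forall t, u0 < t < u1 -> ip (g (x t)) (E t) (T t) = 0.

Let sub t : t0 <= t <= t1 -> u0 < t < u1.
Proof. by case: u01 => ? ? /andP[? ?]; apply/andP; split; lra. Qed.

Lemma dfield_cont t : u0 < t < u1 -> {for t, continuous dfield}.
Proof.
move=> tt; have [Ux hx hT] := hg tt; have hEt := hE tt; have hp := hphi tt.
apply: contVD; first by apply: contVZ; [exact: hdphi | exact: der_cont hEt].
have h : {for t, continuous (fun s => phi s *: chr g (x s) (T s) (E s))}.
  apply: contVZ; first exact: der_cont hp.
  exact: (cont_chr oU gs gu Ux (der_cont hx) (der_cont hT) (der_cont hEt)).
exact: cvgN h.
Qed.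

Lemma energy_bound (eta : R) : 0 < eta ->
  \forall e \near (0 : R), forall t, t0 <= t <= t1 ->
    U (vary x field r lam e t) /\
    energy g x T field dfield r lam dlam e t <= 1 + e ^+ 2 *
      (dboundary t + dphi t ^+ 2 - phi t ^+ 2 * curv g (x t) (E t) (T t) + eta).
Proof.
move=> eta0; have e2 : 0 < 2 * eta by rewrite mulr_gt0.
have xc t : t0 <= t <= t1 -> {for t, continuous x}.
  by move=> /sub/hg[_ h _]; exact: der_cont h.
have Tc t : t0 <= t <= t1 -> {for t, continuous T}.
  by move=> /sub/hg[_ _ h]; exact: der_cont h.
have vc t : t0 <= t <= t1 -> {for t, continuous field}.
  by move=> /sub tt; have h := der_field (hE tt) (hphi tt); exact: der_cont h.
have dvc t : t0 <= t <= t1 -> {for t, continuous dfield}.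
  by move=> /sub; exact: dfield_cont.
have lc t : t0 <= t <= t1 -> {for t, continuous lam}.
  by move=> /sub/hlam h; exact: der_cont h.
have dlc t : t0 <= t <= t1 -> {for t, continuous dlam} by move=> /sub/hdlam.
have Ux t : t0 <= t <= t1 -> U (x t) by move=> /sub/hg[].
have := energy_expansion oU gs xc Tc vc dvc lc dlc Ux hr hr1 hr2 r0 e2.
move=> H; apply: filterS (H _ _) => [e He t tt|t /sub tt|t /sub tt].
- have [Ut le] := He t tt; split=> //; apply: le_trans le _.
  rewrite (energy2_0 (hg (sub tt)) (EE (sub tt)) r0 r10 r20).
  by rewrite lerD2l le_eqVlt; apply/orP; left; apply/eqP; field.
- by rewrite /energy /vary /dvary r0 !scaler0 !scale0r !addr0 TT.
- by apply: energy1_0; [exact: hg tt | exact: ET tt | exact: r0 | exact: r10].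
Qed.

End Interval.
End Variation.
End Geodesic.

(** * Change of chart *)

Section Glue.
Variables (R : realType) (n : nat) (U U' W : set 'rV[R]_n) (g g' : 'rV[R]_n -> 'M[R]_n).
Variable tau : 'rV[R]_n -> 'rV[R]_n.
Hypothesis oU : open U.
Hypothesis gs : forall i j, smooth_on U (fun x => g x i j).
Hypothesis gsym : forall x, U x -> (g x)^T = g x.
Hypothesis oU' : open U'.
Hypothesis gs' : forall i j, smooth_on U' (fun x => g' x i j).
Hypothesis gsym' : forall x, U' x -> (g' x)^T = g' x.
Hypothesis oW : open W.
Hypothesis WU : forall x, W x -> U x.
Hypothesis WU' : forall x, W x -> U' (tau x).
Hypothesis taus : forall k, smooth_on W (fun x => tau x 0 k).

Definition dtr x u : 'rV[R]_n := \row_k grad (fun y => tau y 0 k) x u.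
Definition ddtr x u v : 'rV[R]_n := \row_k grad (fun y => grad (fun z => tau z 0 k) y v) x u.

Hypothesis gg' : forall x a b, W x -> ip (g x) a b = ip (g' (tau x)) (dtr x a) (dtr x b).

Lemma dtrZ x k u : dtr x (k *: u) = k *: dtr x u.
Proof. by apply/rowP => i; rewrite !mxE linearZ. Qed.

Lemma ddtrC x u v : W x -> ddtr x u v = ddtr x v u.
Proof. by move=> Wx; apply/rowP => k; rewrite !mxE (grad_schwarz _ _ oW (taus k) Wx). Qed.

Lemma der_tau (c : R -> 'rV[R]_n) (t : R) dc : W (c t) -> is_derive t 1 c dc ->
  is_derive t 1 (fun s => tau (c s)) (dtr (c t) dc).
Proof.
by move=> Wc hc; apply/der_rV => k; rewrite mxE; exact: smooth_chain oW (taus k) Wc hc.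
Qed.

Lemma der_dtr (c : R -> 'rV[R]_n) (t : R) dc a : W (c t) -> is_derive t 1 c dc ->
  is_derive t 1 (fun s => dtr (c s) a) (ddtr (c t) dc a).
Proof.
move=> Wc hc; apply/der_rV => k.
apply: (der_congr _ _ (smooth_chain oW (smooth_grad a oW (taus k)) Wc hc)); last by rewrite mxE.
by near=> s; rewrite mxE.
Unshelve. all: by end_near. Qed.

Lemma cont_dtr (S : topologicalType) (s : S) (c v : S -> 'rV[R]_n) : W (c s) ->
  {for s, continuous c} -> {for s, continuous v} -> {for s, continuous (fun s => dtr (c s) (v s))}.
Proof.
move=> Wc hc hv; apply: cont_rV => k.
apply: (cont_congr (f := fun s => grad (fun y => tau y 0 k) (c s) (v s))).
  by near=> z; rewrite mxE.
by apply: (cont_grad oW (taus k) Wc hc) => i; exact: cont_coord.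
Unshelve. all: by end_near. Qed.

Lemma cont_ddtr (S : topologicalType) (s : S) (c u v : S -> 'rV[R]_n) : W (c s) ->
  {for s, continuous c} -> {for s, continuous u} -> {for s, continuous v} ->
  {for s, continuous (fun s => ddtr (c s) (u s) (v s))}.
Proof.
move=> Wc hc hu hv; apply: cont_rV => k.
apply: (cont_congr (f := fun s => grad (fun y => grad (fun z => tau z 0 k) y (v s)) (c s) (u s))).
  by near=> z; rewrite mxE.
exact: cont_grad2 oW (taus k) Wc hc hu hv.
Unshelve. all: by end_near. Qed.

(** The isometry relation [gg'] is differentiated along the line x + s u. *)
Lemma dg_glue x u a b : W x -> ip (dg g x u) a b =
  ip (dg g' (tau x) (dtr x u)) (dtr x a) (dtr x b)
  + ip (g' (tau x)) (ddtr x u a) (dtr x b) + ip (g' (tau x)) (dtr x a) (ddtr x u b).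
Proof.
move=> Wx; pose l (s : R) := x + s *: u.
have l0 : l 0 = x by rewrite /l scale0r addr0.
have hl : is_derive (0 : R) 1 l u by exact: der_lineV.
have Wl : W (l 0) by rewrite l0.
have hz (c : 'rV[R]_n) : is_derive (0 : R) 1 (fun=> c) 0 by exact: der_cstV.
have h1 : is_derive (0 : R) 1 (fun s => ip (g (l s)) a b) (ip (dg g x u) a b).
  apply: (is_derive_eq (der_ip (fun i j => der_g oU gs i j (WU Wl) hl) (hz a) (hz b))).
  by rewrite ip0l ip0r !addr0 l0.
have Wt : U' (tau (l 0)) by exact: WU'.
have hG i j := der_g (c := fun s => tau (l s)) oU' gs' i j Wt (der_tau Wl hl).
have h2 := der_ip hG (der_dtr a Wl hl) (der_dtr b Wl hl).
rewrite l0 in h2; apply: (is_derive_unique h1); apply: (der_congr _ _ h2); last by [].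
by near=> s; rewrite -gg' //; near: s; exact: open_line.
Unshelve. all: by end_near. Qed.

(** The second derivatives of the transition in the directions v, T cancel. What remains is the one
    in the directions v, v, which is also the second-order discrepancy between straight variations
    in the two charts. *)
Lemma chrl_glue x v T : W x -> chrl g x v v T =
  ip (g' (tau x)) (dtr x T) (ddtr x v v) + chrl g' (tau x) (dtr x v) (dtr x v) (dtr x T).
Proof.
move=> Wx; rewrite /chrl (dg_glue v v T Wx) (dg_glue T v v Wx) (ddtrC T v Wx).
rewrite (gipC gsym' (ddtr x v v) _ (WU' Wx)) (gipC gsym' (dtr x v) (ddtr x v T) (WU' Wx)).
by gen_ip; field.
Qed.

End Glue.

(** * Curves and lengths in a Riemannian manifold *)

Lemma differentiable_rV (R : realType) (V : normedModType R) n (f : V -> 'rV[R]_n) x :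
  (forall k, differentiable (fun y => f y 0 k) x) -> differentiable f x.
Proof.
move=> h; rewrite (_ : f = \sum_(k < n) (fun y => f y 0 k *: (delta_mx 0 k : 'rV[R]_n))).
  apply: differentiable_sum => k; exact: differentiableZl.
by apply/funext => y; rewrite fct_sumE [LHS]row_expand.
Qed.

Lemma posdef_unitmx (R : realType) n (G : 'M[R]_n) :
  (forall v, v != 0 -> 0 < ip G v v) -> G \in unitmx.
Proof.
move=> h; rewrite -row_free_unit -kermx_eq0; apply/negPn/negP => /rowV0Pn[v /sub_kermxP vG v0].
by have := h v v0; rewrite /ip vG mul0mx mxE ltxx.
Qed.

Section Manifold.
Variables (R : realType) (n : nat) (M : riemannianManifold R n).
Implicit Types (i j : chart_index M) (p : M) (x : 'rV[R]_n).

Lemma img_open i : open (chart_img i). Proof. exact: chart_img_open. Qed.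

Lemma metric_sm i a b : smooth_on (chart_img i) (fun x => metric i x a b).
Proof. exact: metric_smooth. Qed.

Lemma metric_pos i x v : chart_img i x -> v != 0 -> 0 < ip (metric i x) v v.
Proof. exact: metric_posdef. Qed.

Lemma metric_unit i x : chart_img i x -> metric i x \in unitmx.
Proof. by move=> hx; apply: posdef_unitmx => v; exact: metric_pos. Qed.

Lemma metric_ge0 i x v : chart_img i x -> 0 <= ip (metric i x) v v.
Proof.
move=> hx; have [->|v0] := eqVneq v 0; first by rewrite ip0l.
by apply: ltW; exact: metric_pos.
Qed.

Definition tau i j x : 'rV[R]_n := chart_map j (chart_inv i x).
Definition overlap i j : set 'rV[R]_n := chart_map i @` (chart_dom i `&` chart_dom j).

Lemma overlapP i j x : overlap i j x <-> chart_img i x /\ chart_dom j (chart_inv i x).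
Proof.
split=> [[p [pi pj] <-]|[[p pi <-]]].
  by split; [exists p|rewrite chart_mapK].
by rewrite chart_mapK // => pj; exists p.
Qed.

Lemma map_img i p : chart_dom i p -> chart_img i (chart_map i p).
Proof. by move=> pi; exists p. Qed.

Lemma overlap_map i j p : chart_dom i p -> chart_dom j p -> overlap i j (chart_map i p).
Proof. by move=> pi pj; exists p. Qed.

Lemma overlap_open i j : open (overlap i j).
Proof.
rewrite openE => x /overlapP[xi xj].
have hc := @chart_inv_continuous R n M i x xi.
have n1 : \forall y \near x, chart_dom j (chart_inv i y).
  by apply: hc; apply: open_nbhs_nbhs; split => //; exact: chart_dom_open.
have n2 := open_near (@img_open i) xi.
by apply: filterS2 n1 n2 => y ? ?; apply/overlapP.
Qed.

Lemma tau_sm i j k : smooth_on (overlap i j) (fun x => tau i j x 0 k).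
Proof. exact: transition_smooth. Qed.

Lemma overlap_img i j x : overlap i j x -> chart_img i x.
Proof. by move/overlapP=> []. Qed.

Lemma tau_img i j x : overlap i j x -> chart_img j (tau i j x).
Proof. by move/overlapP=> [xi xj]; exact: map_img. Qed.

Lemma inv_tau i j x : overlap i j x -> chart_inv j (tau i j x) = chart_inv i x.
Proof. by move/overlapP=> [xi xj]; rewrite /tau chart_mapK. Qed.

Lemma mul_jacobian i j x v : overlap i j x ->
  v *m jacobian (chart_map j \o chart_inv i) x = dtr (tau i j) x v.
Proof.
move=> hx.
have hk k := smooth_diff (@overlap_open i j) (@tau_sm i j k) hx.
have df : differentiable (tau i j) x.
  by apply: differentiable_rV => k; have [] := hk k.
rewrite -deriveEjacobian //; apply/rowP => k; rewrite mxE.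
have dv : derivable (tau i j) x v by exact: diff_derivable.
rewrite (derive_mx (M := tau i j)) // mxE deriveE; last by have [] := hk k.
by have [_ ->] := hk k.
Qed.

Lemma metric_tau i j x a b : overlap i j x ->
  ip (metric i x) a b = ip (metric j (tau i j x)) (dtr (tau i j) x a) (dtr (tau i j) x b).
Proof.
move=> hx; have [p [pi pj] E] := hx.
have := metric_transition pi pj; rewrite E /= => ->.
rewrite -!mul_jacobian // /ip /tau -E chart_mapK // trmx_mul.
by rewrite !mulmxA.
Qed.

Section ChartCurve.
Variables (i : chart_index M) (al dal : R -> 'rV[R]_n) (t : R).
Hypothesis img_al : \forall s \near t, chart_img i (al s).
Hypothesis der_al : \forall s \near t, is_derive (s : R) 1 al (dal s).
Hypothesis cont_dal : {for t, continuous dal}.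
Let c (s : R) : M := chart_inv i (al s).

Let al_cont : {for t, continuous al}.
Proof. by have h := nbhs_singleton der_al; exact: der_cont h. Qed.

Lemma chart_curve_cont : {for t, continuous c}.
Proof.
apply: (cont_compose al_cont); apply: chart_inv_continuous.
exact: (nbhs_singleton img_al).
Qed.

Lemma chart_curve_der j : chart_dom j (c t) ->
  \forall s \near t, is_derive (s : R) 1 (chart_map j \o c) (dtr (tau i j) (al s) (dal s)).
Proof.
move=> cj; have Ut : overlap i j (al t).
  by apply/overlapP; split => //; exact: (nbhs_singleton img_al).
have n1 : \forall s \near t, overlap i j (al s).
  by apply: al_cont; exact: open_near (@overlap_open i j) Ut.
apply: filterS2 n1 der_al => s Us hs.
exact: (der_tau (@overlap_open i j) (@tau_sm i j) Us hs).
Qed.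

Lemma chart_curve_C1 j : chart_dom j (c t) ->
  derivable (chart_map j \o c) t 1 /\ {for t, continuous (chart_map j \o c)^`()%classic}.
Proof.
move=> cj; have H := chart_curve_der cj; split.
  by have [] := nbhs_singleton H.
have Ut : overlap i j (al t).
  by apply/overlapP; split => //; exact: (nbhs_singleton img_al).
apply: (cont_congr (f := fun s => dtr (tau i j) (al s) (dal s))).
  by apply: filterS H => s [_ <-]; rewrite derive1E.
exact: (cont_dtr (@overlap_open i j) (@tau_sm i j) Ut al_cont cont_dal).
Qed.

(** [speed] is read in the preferred chart of each point; invariance of the metric brings it back to
    the chart i. *)
Lemma chart_curve_speed : speed c t = Num.sqrt (ip (metric i (al t)) (dal t) (dal t)).
Proof.
have cj : chart_dom (chart_at (c t)) (c t) by exact: chart_atP.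
have [_ E] := nbhs_singleton (chart_curve_der cj).
have Ut : overlap i (chart_at (c t)) (al t).
  by apply/overlapP; split => //; exact: (nbhs_singleton img_al).
rewrite /speed /tangent_norm /velocity derive1E E -[(_ *m _ *m _) 0 0]/(ip _ _ _).
by rewrite (metric_tau _ _ Ut).
Qed.

End ChartCurve.

(** [path_cons] adds a piece in front, whereas paths swept along the geodesic are prolonged at their
    far end. *)
Lemma path_append p q l c : path_length p q l -> C1_segment c -> c 0 = q ->
  path_length p (c 1) (l + \int[lebesgue_measure]_(t in `[0, 1]) speed c t).
Proof.
move=> hl hc; elim: hl => [p' E|c' q' l' hc' _ IH E].
  rewrite -E add0r -[X in path_length _ _ X]addr0; apply: path_cons => //.
  exact: path_nil.
by rewrite -addrA; apply: path_cons => //; exact: IH.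
Qed.

Lemma path_ge0 p q l : path_length p q l -> 0 <= l.
Proof.
elim=> [//|c q' l' _ _ IH]; apply: addr_ge0 => //.
by apply: Rintegral_ge0 => t _; exact: sqrtr_ge0.
Qed.

Lemma dist_le p q l : path_length p q l -> riemannian_dist p q <= l.
Proof.
by move=> h; apply: ge_inf => //; exists 0 => l' /path_ge0.
Qed.

(** The speed of the new piece is compared with the derivative of a known G, so that later length
    estimates only have to exhibit a primitive. *)
Lemma path_extend i (al dal : R -> 'rV[R]_n) (e : R) p l (G dG : R -> R) : 0 < e ->
  (forall s : R, - e < s < 1 + e ->
     [/\ chart_img i (al s), is_derive s 1 al (dal s) & {for s, continuous dal}]) ->
  path_length p (chart_inv i (al 0)) l ->
  (forall s : R, 0 <= s <= 1 -> is_derive s 1 G (dG s)) ->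
  (forall s : R, 0 <= s <= 1 -> Num.sqrt (ip (metric i (al s)) (dal s) (dal s)) <= dG s) ->
  exists2 l', path_length p (chart_inv i (al 1)) l' & l' <= l + (G 1 - G 0).
Proof.
move=> e0 h hl hG le.
have near_itv (s : R) : - e < s < 1 + e -> \forall r \near s, - e < r < 1 + e.
  move=> /andP[s1 s2]; near=> r; apply/andP; split; near: r; [exact: lt_nbhsr|exact: lt_nbhsl].
have n1 (s : R) : - e < s < 1 + e -> \forall r \near s, chart_img i (al r).
  by move/near_itv; apply: filterS => r /h[].
have n2 (s : R) : - e < s < 1 + e -> \forall r \near s, is_derive (r : R) 1 al (dal r).
  by move/near_itv; apply: filterS => r /h[].
pose c (s : R) : M := chart_inv i (al s).
have hc : C1_segment c.
  exists e => // s; rewrite /= in_itv /= => se.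
  have [_ _ h3] := h s se; split; first exact: (chart_curve_cont (n1 s se) (n2 s se)).
  by move=> j cj; exact: (chart_curve_C1 (n1 s se) (n2 s se) h3 cj).
exists (l + \int[lebesgue_measure]_(t in `[0, 1]) speed c t).
  exact: (path_append hl hc).
rewrite lerD2l.
have -> : \int[lebesgue_measure]_(t in `[0, 1]) speed c t =
   \int[lebesgue_measure]_(t in `[0, 1]) Num.sqrt (ip (metric i (al t)) (dal t) (dal t)).
  apply: eq_Rintegral => s; rewrite inE /= in_itv /= => /andP[s0 s1].
  have se : - e < s < 1 + e by apply/andP; split; lra.
  exact: (chart_curve_speed (n1 s se) (n2 s se)).
have e2 : 0 < e / 2 by rewrite divr_gt0.
apply: (integral01_le e2 _ hG le) => s /andP[s0 s1].
have se : - e < s < 1 + e by apply/andP; split; lra.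
have [U1 U2 U3] := h s se.
apply: (cont_compose _ (@sqrt_continuous R _)).
apply: cont_ipV => // a b.
exact: (cont_gc (@metric_sm i) U1 (der_cont U2)).
Unshelve. all: by end_near. Qed.

Section GeodesicInCharts.
Variables (gam e0 : R) (E : R -> M).
Hypothesis hgeo : geodesic_on `](- e0), gam[ E.
Hypothesis e00 : 0 < e0.

Definition chart_coord i (t : R) : 'rV[R]_n := chart_map i (E t).
Definition vel i : R -> 'rV[R]_n := (chart_map i \o E)^`()%classic.

Lemma geo_cont t : - e0 < t < gam -> {for t, continuous E}.
Proof. by move=> tt; have [] := hgeo (t := t); rewrite ?/= ?in_itv. Qed.

Lemma dom_near i t : - e0 < t < gam -> chart_dom i (E t) ->
  \forall s \near t, chart_dom i (E s).
Proof.
move=> tt Ei; apply: (geo_cont tt).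
by apply: open_nbhs_nbhs; split => //; exact: chart_dom_open.
Qed.

Lemma geo_at i t : - e0 < t < gam -> chart_dom i (E t) ->
  geodesic_at (chart_img i) (metric i) (chart_coord i) (vel i) t.
Proof.
move=> tt Ei; have It : [set` `](- e0), gam[] t by rewrite /= in_itv.
have [_ /(_ i Ei)[d1 d2 eqn]] := hgeo It.
split.
- exact: map_img.
- exact: (DeriveDef d1 (esym (derive1E _ _))).
- have E2 : (vel i)^`()%classic t = - chr (metric i) (chart_coord i t) (vel i t) (vel i t).
    apply/rowP => k; have /eqP := eqn k; rewrite addr_eq0 => /eqP E2.
    rewrite [RHS]mxE [in RHS]mxE [LHS]E2; congr (- _).
    by apply: eq_bigr => a _; apply: eq_bigr => b _; rewrite -mulrA mulrC.
  exact: (DeriveDef d2 (etrans (esym (derive1E _ _)) E2)).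
Qed.

Lemma vel_tau i j t : - e0 < t < gam -> chart_dom i (E t) -> chart_dom j (E t) ->
  vel j t = dtr (tau i j) (chart_coord i t) (vel i t).
Proof.
move=> tt Ei Ej; have [_ hx _] := geo_at tt Ei; have [_ hy _] := geo_at tt Ej.
have h := der_tau (@overlap_open i j) (@tau_sm i j) (overlap_map Ei Ej : overlap i j (chart_coord i t)) hx.
have h' : is_derive t 1 (chart_coord j) (dtr (tau i j) (chart_coord i t) (vel i t)).
  apply: near_eq_is_derive h; apply: filterS (dom_near tt Ei) => s Es.
  by rewrite /tau /chart_coord chart_mapK.
by have [_ <-] := hy; have [_ <-] := h'.
Qed.

Lemma tau_coord i j t : chart_dom i (E t) -> tau i j (chart_coord i t) = chart_coord j t.
Proof. by move=> Ei; rewrite /tau /chart_coord chart_mapK. Qed.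

Lemma vel_unit i t : - e0 < t < gam -> chart_dom i (E t) -> speed E t = 1 ->
  ip (metric i (chart_coord i t)) (vel i t) (vel i t) = 1.
Proof.
move=> tt Ei sp; pose j := chart_at (E t).
have Ej : chart_dom j (E t) by exact: chart_atP.
rewrite (metric_tau _ _ (overlap_map Ei Ej : overlap i j (chart_coord i t))).
rewrite -vel_tau // tau_coord //.
have : Num.sqrt (ip (metric j (chart_coord j t)) (vel j t) (vel j t)) = 1 by exact: sp.
move=> h; rewrite -[LHS]sqr_sqrtr ?h ?expr1n //.
by apply: metric_ge0; exact: map_img.
Qed.

End GeodesicInCharts.
End Manifold.

(** * Varying a geodesic along a parallel frame *)

Section Frames.
Variables (R : realType) (m : nat) (G : 'M[R]_m.+1) (T : 'rV[R]_m.+1).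
Hypothesis Gsym : G^T = G.
Hypothesis Gpos : forall v, v != 0 -> 0 < ip G v v.
Hypothesis TT : ip G T T = 1.

Definition orthoframe k (V : 'I_k -> 'rV[R]_m.+1) :=
  (forall a b, ip G (V a) (V b) = (a == b)%:R) /\ (forall a, ip G (V a) T = 0).

(** Orthogonality to T and to the k vectors, encoded in the columns of B, imposes k + 1 <= m linear
    conditions on m + 1 components. A nonzero solution exists and is normalised. *)
Lemma orthoframe_extend k (V : 'I_k -> 'rV[R]_m.+1) : (k < m)%N -> orthoframe V ->
  exists V' : 'I_k.+1 -> 'rV[R]_m.+1, orthoframe V'.
Proof.
move=> km [VV VT].
pose B : 'M[R]_(m.+1, k.+1) := \matrix_(i, j)
  (if unlift ord0 j is Some a then (G *m (V a)^T) i 0 else (G *m T^T) i 0).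
have : kermx B != 0.
  rewrite kermx_eq0 /row_free; apply/negP => /eqP rB.
  by have := rank_leq_col B; rewrite rB ltnS leqNgt km.
move=> /rowV0Pn[v /sub_kermxP vB v0].
have vE j : (v *m B) 0 j = if unlift ord0 j is Some a then ip G v (V a) else ip G v T.
  rewrite mxE; case E : (unlift ord0 j) => [a|]; rewrite /ip -mulmxA mxE;
  by apply: eq_bigr => i _; rewrite /B mxE E.
have vV a : ip G v (V a) = 0 by have := vE (lift ord0 a); rewrite liftK vB mxE => <-.
have vT : ip G v T = 0 by have := vE ord0; rewrite unlift_none vB mxE => <-.
have vv := Gpos v0.
pose s := Num.sqrt (ip G v v).
have s0 : s != 0 by rewrite gt_eqF // sqrtr_gt0.
pose e := s^-1 *: v.
have ee : ip G e e = 1.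
  rewrite /e ipZl ipZr -[X in _ * (_ * X)](sqr_sqrtr (ltW vv)) -/s; field.
  exact: s0.
have eV a : ip G e (V a) = 0 by rewrite /e ipZl vV mulr0.
exists (fun j => if unlift ord0 j is Some a then V a else e); split=> [a b|a].
  case: unliftP => [a' ->|->]; case: unliftP => [b' ->|->].
  - by rewrite VV (inj_eq lift_inj).
  - by rewrite ip_sym // eV eq_sym (negbTE (neq_lift _ _)).
  - by rewrite eV (negbTE (neq_lift _ _)).
  - by rewrite ee eqxx.
by case: unliftP => [a' _|_]; [exact: VT | rewrite /e ipZl vT mulr0].
Qed.

Lemma orthoframe_exists : exists V : 'I_m -> 'rV[R]_m.+1, orthoframe V.
Proof.
have H k : (k <= m)%N -> exists V : 'I_k -> 'rV[R]_m.+1, orthoframe V.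
  elim: k => [_|k IH km]; first by exists (fun _ => 0); split=> [[]|[]].
  by have [V hV] := IH (ltnW km); exact: orthoframe_extend hV.
exact: H.
Qed.

(** Let F have rows T and [V a]. Orthonormality reads F G F^T = 1, hence G F^T F = 1, and by
    cyclicity tr (F rho G F^T) = tr rho. *)
Lemma orthoframe_trace (V : 'I_m -> 'rV[R]_m.+1) (rho : 'M[R]_m.+1) : orthoframe V ->
  \tr rho = ip (rho *m G) T T + \sum_a ip (rho *m G) (V a) (V a).
Proof.
move=> [VV VT].
pose F : 'M[R]_m.+1 := \matrix_(k, l) (if unlift ord0 k is Some a then V a else T) 0 l.
have FE (H : 'M[R]_m.+1) k l : (F *m H *m F^T) k l = ip H (row k F) (row l F).
  rewrite mxE ipE exchange_big; apply: eq_bigr => j _ /=.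
  by rewrite [in LHS]mxE mulr_suml; apply: eq_bigr => i _; rewrite !mxE.
have F0 : row ord0 F = T by apply/rowP => j; rewrite !mxE unlift_none.
have FS a : row (lift ord0 a) F = V a by apply/rowP => j; rewrite !mxE liftK.
have FF : F *m (G *m F^T) = 1%:M.
  apply/matrixP => k l; rewrite mulmxA FE mxE.
  case: (unliftP ord0 k) => [a ->|->]; case: (unliftP ord0 l) => [b ->|->]; rewrite ?F0 ?FS.
  - by rewrite VV (inj_eq lift_inj).
  - by rewrite VT eq_sym (negbTE (neq_lift _ _)).
  - by rewrite ip_sym // VT (negbTE (neq_lift _ _)).
  - by rewrite TT eqxx.
have -> : \tr rho = \tr (F *m (rho *m G) *m F^T).
  by rewrite -mulmxA -(mulmxA rho) mxtrace_mulC -mulmxA (mulmx1C FF) mulmx1.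
rewrite /mxtrace; under eq_bigr do rewrite FE.
rewrite big_ord_recl F0; congr (_ + _).
by apply: eq_bigr => a _; rewrite FS.
Qed.

End Frames.

(** The step around the supremum s of the times with P is used twice: to reach s from an earlier
    such time, then to go beyond s unless s = b. *)
Lemma interval_induction (R : realType) (a b : R) (P : R -> Prop) : a <= b ->
  (forall s, a <= s <= b -> exists2 d : R, 0 < d & forall t0 t1, a <= t0 -> t0 < t1 -> t1 <= b ->
     `|t0 - s| < d -> `|t1 - s| < d -> P t0 -> P t1) ->
  P a -> P b.
Proof.
move=> ab step Pa.
pose S := [set t | a <= t <= b /\ P t].
have Sa : S a by rewrite /S /= lexx ab.
have hS : has_sup S by split; [exists a | exists b => t [/andP[]]].
pose s := sup S.
have as_ : a <= s by apply: ub_le_sup => //; case: hS.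
have sb : s <= b by apply: ge_sup; [exists a | move=> t [/andP[]]].
have [d d0 hd] := step s (introT andP (conj as_ sb)).
have [t0 St0 ht0] := sup_adherent d0 hS.
rewrite -/s in ht0.
have t0s : t0 <= s by apply: ub_le_sup => //; case: hS.
have [/andP[at0 t0b] Pt0] := St0.
have close t : s - d < t -> t < s + d -> `|t - s| < d.
  by move=> ? ?; rewrite ltr_norml; apply/andP; split; lra.
have Ps : P s.
  have [<- //|ne] := eqVneq t0 s.
  have lt : t0 < s by rewrite lt_neqAle ne.
  apply: (hd t0 s) => //; apply: close; lra.
have [<- //|ne] := eqVneq s b.
have lt : s < b by rewrite lt_neqAle ne.
pose t1 := Num.min b (s + d / 2).
have t1b : t1 <= b by rewrite ge_min lexx.
have st1 : s < t1 by rewrite lt_min lt /=; lra.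
have t1d : t1 <= s + d / 2 by rewrite ge_min lexx orbT.
have Pt1 : P t1.
  apply: (hd s t1) => //; apply: close; lra.
have : t1 <= s.
  by apply: ub_le_sup; [case: hS | split=> //; rewrite t1b (le_trans as_ (ltW st1))].
by rewrite leNgt st1.
Qed.

Lemma der_compV (R : realType) n (f : R -> R) (g : R -> 'rV[R]_n) (t df : R) dg :
  is_derive t 1 f df -> is_derive (f t) 1 g dg ->
  is_derive t 1 (fun s => g (f s)) (df *: dg).
Proof.
move=> hf /der_rV hg; apply/der_rV => k; rewrite mxE mulrC.
exact: (der_comp (g := fun s => g s 0 k) hf (hg k)).
Qed.

Lemma der_affine (R : realType) (t a b : R) : is_derive t 1 (fun s : R => a + s * b) b.
Proof.
apply: (is_derive_eq (derD (der_cst a t 1) (derM (der_id t) (der_cst b t 1)))).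
by rewrite mul1r mulr0 addr0 add0r.
Qed.

Lemma near_dist (R : realType) (t : R) (P : R -> Prop) : (\forall s \near t, P s) ->
  exists2 d : R, 0 < d & forall s, `|s - t| < d -> P s.
Proof.
move=> /nbhs_ballP[d /= d0 hd]; exists d => // s sd; apply: hd.
by rewrite -ball_normE /= distrC.
Qed.

(* AM-GM: [sqrt A <= (1 + A) / 2] *)
Lemma sqrt_ipZ_le (R : realType) n (G : 'M[R]_n) (D : R) u : 0 <= D -> 0 <= ip G u u ->
  Num.sqrt (ip G (D *: u) (D *: u)) <= 2^-1 * (1 + ip G u u) * D.
Proof.
move=> D0 A0; rewrite ipZl ipZr mulrA -expr2 sqrtrM ?sqr_ge0 // sqrtr_sqr ger0_norm // mulrC.
apply: ler_wpM2r => //; have := sqr_sqrtr A0; have := sqr_ge0 (Num.sqrt (ip G u u) - 1).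
rewrite sqrrB1 => h1 h2; move: h1; rewrite h2 mulr2n => ?; lra.
Qed.

(** * Prolonging a varied path within one chart *)

Section Step.
Variables (R : realType) (m : nat) (M : riemannianManifold R m.+1).
Variables (gam e0 : R) (E : R -> M).
Hypothesis hgeo : geodesic_on `](- e0), gam[ E.
Hypothesis e00 : 0 < e0.
Hypothesis hspeed : forall t, 0 <= t < gam -> speed E t = 1.
Variables (phi dphi : R -> R).
Hypothesis hphi : forall t : R, 0 < t < gam -> is_derive t 1 phi (dphi t).
Hypothesis hdphi : forall t, 0 < t < gam -> {for t, continuous dphi}.
Variable a0 : R.

Notation x i := (chart_coord E i).
Notation T i := (vel E i).

Let wide t : 0 < t < gam -> - e0 < t < gam.
Proof. by move: e00 => ? /andP[? ?]; apply/andP; split; lra. Qed.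

Let unitT i t : 0 < t < gam -> chart_dom i (E t) -> ip (metric i (x i t)) (T i t) (T i t) = 1.
Proof.
move=> tt Ei; apply: (vel_unit hgeo (wide tt) Ei); apply: hspeed.
by case/andP: tt => ? ?; apply/andP; split; lra.
Qed.

(** Coefficient matrix of parallel transport, in the row form y' = y A expected by [linear_ode]. *)
Definition conn i t : 'M[R]_m.+1 :=
  \matrix_(j, k) - \sum_a T i t 0 a * christoffel (metric i) k a j (x i t).

Lemma conn_chr i t (y : 'rV[R]_m.+1) : y *m conn i t = - chr (metric i) (x i t) (T i t) y.
Proof.
apply/rowP => k; rewrite !mxE.
under eq_bigr do rewrite mxE mulrN mulr_sumr.
rewrite sumrN exchange_big; congr (- _); apply: eq_bigr => a _ /=.
by apply: eq_bigr => j _; ring.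
Qed.

Lemma conn_cont i t j k : 0 < t < gam -> chart_dom i (E t) ->
  {for t, continuous (fun s => conn i s j k)}.
Proof.
move=> tt Ei; have [Ux hx hT] := geo_at hgeo (wide tt) Ei.
apply: (cont_congr (f := fun s => 0 - \sum_a T i s 0 a * christoffel (metric i) k a j (x i s))).
  by near=> s; rewrite mxE sub0r.
apply: contB; first exact: cont_cst.
apply: cont_sum => a _; apply: contM.
  exact: cont_coord (der_cont hT) _.
apply: (cont_compose (der_cont hx)).
exact: smooth_cont (smooth_christoffel (@img_open _ _ M i) (@metric_sm _ _ M i)
  (@metric_unit _ _ M i) k a j) Ux.
Unshelve. all: by end_near. Qed.

(** One d serves every initial time and vector near s, since it depends only on a bound for the
    coefficients; these are frozen outside [s - d, s + d] to become continuous and bounded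
    everywhere. *)
Lemma parallel_local i s : 0 < s < gam -> chart_dom i (E s) ->
  exists2 d : R, 0 < d & (forall t, `|t - s| < d -> 0 < t < gam /\ chart_dom i (E t)) /\
    forall t0 y0, `|t0 - s| < d -> exists2 Y, Y t0 = y0 &
      forall t, `|t - s| < d -> parallel_at (metric i) (x i) (T i) Y t.
Proof.
move=> ss Ei.
(* The added 1 absorbs the variation of the entries near s and keeps K positive for the division
   below. *)
pose K := \sum_j \sum_k `|conn i s j k| + 1.
have K1 : 1 <= K by rewrite lerDr; apply: sumr_ge0 => j _; apply: sumr_ge0.
have : \forall t \near s, [/\ 0 < t < gam, chart_dom i (E t) & forall j k, `|conn i t j k| <= K].
  have n1 : \forall t \near s, 0 < t < gam.
    case/andP: ss => s1 s2; near=> t; apply/andP; split; near: t;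
      [exact: lt_nbhsr|exact: lt_nbhsl].
  have n2 := dom_near hgeo (wide ss) Ei.
  have n3 : \forall t \near s, forall j k, `|conn i t j k| <= K.
    apply: (near_all (F := nbhs s)) => j; apply: (near_all (F := nbhs s)) => k.
    have /cvgrPdist_le/(_ 1 ltr01) := @conn_cont i s j k ss Ei.
    apply: filterS => t ht; apply: (@le_trans _ _ (`|conn i s j k| + 1)).
      have -> : conn i t j k = conn i s j k - (conn i s j k - conn i t j k) by ring.
      by apply: le_trans (ler_normB _ _) _; rewrite lerD2l.
    rewrite lerD2r (bigD1 j) //= (bigD1 k) //= -addrA lerDl addr_ge0 ?sumr_ge0 // => j' _.
    exact: sumr_ge0.
  by apply: filterS3 n1 n2 n3 => t; split.
move=> /near_dist[r r0 hr].
have nK : 0 < 4 * m.+1%:R * K by rewrite !mulr_gt0 ?ltr0n // (lt_le_trans ltr01).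
(* The first bound keeps the closed interval inside the good neighbourhood; the second gives (m + 1)
   K (2 d) <= 1/2, the contraction condition of [linear_ode]. *)
pose d := Num.min (r / 2) (4 * m.+1%:R * K)^-1.
have d0 : 0 < d by rewrite lt_min divr_gt0 //= invr_gt0.
have dr : d <= r / 2 by rewrite ge_min lexx.
have dK : d <= (4 * m.+1%:R * K)^-1 by rewrite ge_min lexx orbT.
have sub t : `|t - s| <= d -> `|t - s| < r by move=> /le_lt_trans; apply; lra.
exists d => //; split=> [t td|t0 y0 t0d].
  by have [] := hr t (sub t (ltW td)).
have cd : s - d < s + d by lra.
have clampd t : `|clamp (s - d) (s + d) t - s| <= d.
  by have /andP[? ?] := clamp_itv t (ltW cd); rewrite ler_norml; apply/andP; split; lra.
have := @linear_ode R m.+1 (fun t => conn i (clamp (s - d) (s + d) t)) (s - d) (s + d) K t0 y0 cd.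
case.
- move=> t j k; apply: (cont_compose (h := fun u => conn i u j k) (@clamp_cont R (s - d) (s + d) t)).
  by have [h1 h2 _] := hr _ (sub _ (clampd t)); exact: conn_cont.
- by move=> t j k; have [_ _] := hr _ (sub _ (clampd t)); apply.
- exact: le_trans ler01 K1.
- have -> : s + d - (s - d) = 2 * d by ring.
  move: dK; rewrite -(ler_pM2l nK) divff ?gt_eqF // => dK.
  have -> : m.+1%:R * K * (2 * d) = 2^-1 * (4 * m.+1%:R * K * d) by field.
  by rewrite ger_pMr.
- by move: t0d; rewrite ltr_norml => /andP[? ?]; apply/andP; split; lra.
move=> Y [Y0 hY]; exists Y => // t td.
have tcd : s - d < t < s + d.
  by move: td; rewrite ltr_norml => /andP[? ?]; apply/andP; split; lra.
have := hY t tcd; rewrite clamp_id ?conn_chr //.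
by case/andP: tcd => ? ?; rewrite !ltW.
Unshelve. all: by end_near. Qed.

(* Up to [o(eps ^ 2)], the point of coordinates [x + eps *: v] in the chart [i]
   is at distance at most [t - a0 + eps ^ 2 * q / 2] from [E a0]. *)
Definition reach t i (v : 'rV[R]_m.+1) (q : R) := forall eta : R, 0 < eta ->
  \forall e \near (0 : R), exists2 l,
    path_length (E a0) (chart_inv i (x i t + e *: v)) l &
    l <= t - a0 + 2^-1 * e ^+ 2 * (q + eta).

Section ReachStep.
Variables (i0 i : chart_index M) (u0 u1 t0 t1 : R) (Y : R -> 'rV[R]_m.+1).
Variables (v0 : 'rV[R]_m.+1) (q : R) (Q : R -> R).
Hypothesis u0t0 : u0 < t0.
Hypothesis t01 : t0 < t1.
Hypothesis t1u1 : t1 < u1.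
Hypothesis hdom : forall t, u0 < t < u1 -> 0 < t < gam /\ chart_dom i (E t).
Hypothesis hY : forall t, u0 < t < u1 -> parallel_at (metric i) (x i) (T i) Y t.
Hypothesis YY : forall t, u0 < t < u1 -> ip (metric i (x i t)) (Y t) (Y t) = 1.
Hypothesis YT : forall t, u0 < t < u1 -> ip (metric i (x i t)) (Y t) (T i t) = 0.
Hypothesis Ei0 : chart_dom i0 (E t0).
Hypothesis hv0 : dtr (tau i0 i) (x i0 t0) v0 = phi t0 *: Y t0.
Hypothesis hq : reach t0 i0 v0 q.
Hypothesis hQ : forall t : R, t0 <= t <= t1 -> is_derive t 1 Q
  (dphi t ^+ 2 - phi t ^+ 2 * curv (metric i) (x i t) (Y t) (T i t)).

Let x0 := x i0 t0.
Let v := field Y phi.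
Let lam (t : R) := (t1 - t) / (t1 - t0).
Let dlam (t : R) := - (t1 - t0)^-1.
Let r (e : R) := tau i0 i (x0 + e *: v0) - (x i t0 + e *: v t0).
Let r1 (e : R) := dtr (tau i0 i) (x0 + e *: v0) v0 - v t0.
Let r2 (e : R) := ddtr (tau i0 i) (x0 + e *: v0) v0 v0.
Let w := ddtr (tau i0 i) x0 v0 v0.

Let it0 : u0 < t0 < u1. Proof. by rewrite u0t0 (lt_trans t01). Qed.
Let it1 : u0 < t1 < u1. Proof. by rewrite t1u1 (lt_trans u0t0). Qed.
Let D0 : t1 - t0 != 0. Proof. by rewrite gt_eqF // subr_gt0. Qed.

Let W0 : overlap i0 i x0.
Proof. by apply: overlap_map => //; have [] := hdom it0. Qed.

Let hlam t : u0 < t < u1 -> is_derive (t : R) 1 lam (dlam t).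
Proof.
move=> _; apply: (is_derive_eq (derM (derB (der_cst t1 t 1) (der_id t)) (der_cst (t1 - t0)^-1 t 1))).
by rewrite /dlam mulr0 addr0 sub0r mulN1r.
Qed.

Let nearW : \forall e \near (0 : R), overlap i0 i (x0 + e *: v0).
Proof. by apply: open_line => //; exact: overlap_open. Qed.

Let hr : \forall e \near (0 : R), is_derive (e : R) 1 r (r1 e).
Proof.
apply: filterS nearW => e We.
have h1 := der_tau (@overlap_open _ _ M i0 i) (@tau_sm _ _ M i0 i) We (der_lineV e x0 v0).
by have h := is_deriveB h1 (der_lineV e (x i t0) (v t0)); exact: h.
Qed.

Let hr1 : \forall e \near (0 : R), is_derive (e : R) 1 r1 (r2 e).
Proof.
apply: filterS nearW => e We.
have h1 := der_dtr (@overlap_open _ _ M i0 i) (@tau_sm _ _ M i0 i) v0 We (der_lineV e x0 v0).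
have h := is_deriveB h1 (der_cstV e (v t0)); apply: (is_derive_eq h).
by rewrite subr0.
Qed.

Let hr2 : {for (0 : R), continuous r2}.
Proof.
have hc : {for (0 : R), continuous (fun e : R => x0 + e *: v0)}.
  exact: der_cont (der_lineV 0 x0 v0).
have hv : {for (0 : R), continuous (fun _ : R => v0)} by exact: cvg_cst.
have W0' : overlap i0 i (x0 + (0 : R) *: v0) by rewrite scale0r addr0.
exact: (@cont_ddtr R m.+1 (overlap i0 i) (tau i0 i) (@overlap_open _ _ M i0 i)
  (@tau_sm _ _ M i0 i) R 0 (fun e : R => x0 + e *: v0) (fun=> v0) (fun=> v0) W0' hc hv hv).
Qed.

Let r00 : r 0 = 0.
Proof. by rewrite /r !scale0r !addr0 (tau_coord _ Ei0) subrr. Qed.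

Let r10 : r1 0 = 0.
Proof. by rewrite /r1 scale0r addr0 hv0 subrr. Qed.

Let r20 : r2 0 = w. Proof. by rewrite /r2 scale0r addr0. Qed.

Let hg t : u0 < t < u1 -> geodesic_at (chart_img i) (metric i) (x i) (T i) t.
Proof. by move=> /hdom[tt Et]; exact: (geo_at hgeo (wide tt) Et). Qed.

Let bnd t := boundary (metric i) (x i) (T i) Y phi lam w t.
Let dbnd t := dboundary (metric i) (x i) (T i) Y phi dphi lam dlam w t.

(** The correction w, of weight 1 at t0, turns the boundary term of the chart i into that of i0. *)
Let bnd0 : bnd t0 = chrl (metric i0) x0 v0 v0 (T i0 t0).
Proof.
rewrite /bnd /boundary /lam (divff D0) mul1r.
have h := chrl_glue (@img_open _ _ M i0) (@metric_sm _ _ M i0) (@img_open _ _ M i)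
  (@metric_sm _ _ M i) (fun x => @Defs.metric_sym _ _ M i x) (@overlap_open _ _ M i0 i)
  (@overlap_img _ _ M i0 i) (@tau_img _ _ M i0 i) (@tau_sm _ _ M i0 i)
  (fun x a b => @metric_tau _ _ M i0 i x a b) v0 (T i0 t0) W0.
have [tt Et] := hdom it0.
rewrite h (tau_coord _ Ei0) hv0 -/w.
by rewrite -(vel_tau hgeo (wide tt) Ei0 Et).
Qed.

Let bnd1 : bnd t1 = chrl (metric i) (x i t1) (phi t1 *: Y t1) (phi t1 *: Y t1) (T i t1).
Proof. by rewrite /bnd /boundary /lam subrr !mul0r add0r. Qed.

Let vary0 e : overlap i0 i (x0 + e *: v0) ->
  chart_inv i (vary (x i) v r lam e t0) = chart_inv i0 (x0 + e *: v0).
Proof.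
move=> We; rewrite /vary /lam (divff D0) scale1r /r addrC subrK.
exact: inv_tau.
Qed.

Let vary1E e : vary (x i) v r lam e t1 = x i t1 + e *: (phi t1 *: Y t1).
Proof. by rewrite /vary /lam subrr mul0r scale0r addr0. Qed.

Let der_vary_t e t : u0 < t < u1 ->
  is_derive (t : R) 1 (vary (x i) v r lam e)
    (dvary (T i) (dfield (metric i) (x i) (T i) Y phi dphi) r dlam e t).
Proof.
move=> tt; have [Ux hx hT] := hg tt; have [tt' _] := hdom tt.
have hv := der_field (hY tt) (hphi tt').
apply: (is_derive_eq (derVD (derVD hx (derVZ (der_cst e t 1) hv)) (derVZ (hlam tt) (der_cstV t (r e))))).
by rewrite scale0r add0r scaler0 addr0.
Qed.

(** The varied curve over [t0, t1], reparametrised by [0, 1], is appended. AM-GM bounds its speed by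
    the energy, whose second-order part is the derivative of the boundary term plus the index
    density with primitive Q. *)
Lemma reach_step : reach t1 i (phi t1 *: Y t1)
  (q + (chrl (metric i) (x i t1) (phi t1 *: Y t1) (phi t1 *: Y t1) (T i t1)
        - chrl (metric i0) x0 v0 v0 (T i0 t0)) + (Q t1 - Q t0)).
Proof.
move=> eta eta0.
have sub t : t0 <= t <= t1 -> u0 < t < u1.
  by case/andP=> h1 h2; rewrite (lt_le_trans u0t0 h1) (le_lt_trans h2 t1u1).
pose D := t1 - t0.
have Dp : 0 < D by rewrite subr_gt0.
have sD01 s : 0 <= s <= 1 -> t0 <= t0 + s * D <= t1.
  move=> /andP[s0 s1]; have h1 := mulr_ge0 s0 (ltW Dp).
  have h2 : s * D <= D by rewrite (ger_pMl _ Dp).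
  have eDD : D = t1 - t0 by [].
  by apply/andP; split; lra.
(* Half of eta is spent on the path already built, and the other half is spread over [t0, t1], as et
   D = eta / 2. *)
pose et := eta / (2 * D).
have et0 : 0 < et by apply: divr_gt0 eta0 _; apply: mulr_gt0 (ltr0Sn _ _) Dp.
have eta2 : 0 < eta / 2 by exact: divr_gt0 eta0 (ltr0Sn _ _).
have n1 := hq eta2.
have hdl (t : R) : u0 < t < u1 -> {for t, continuous dlam} by move=> _; exact: cvg_cst.
have n2 := energy_bound (@img_open _ _ M i) (@metric_sm _ _ M i)
  (fun x => @Defs.metric_sym _ _ M i x) (@metric_unit _ _ M i)
  (conj u0t0 t1u1) hg hY (fun t tt => hphi (hdom tt).1) (fun t tt => hdphi (hdom tt).1)
  hlam hdl hr hr1 hr2 r00 r10 r20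
  (fun t tt => unitT (hdom tt).1 (hdom tt).2) YY YT et0.
apply: filterS3 nearW n1 n2 => e We [l hl le] He.
pose al (s : R) := vary (x i) v r lam e (t0 + s * D).
pose dal (s : R) := D *: dvary (T i) (dfield (metric i) (x i) (T i) Y phi dphi) r dlam e (t0 + s * D).
pose dens t := dbnd t + dphi t ^+ 2 - phi t ^+ 2 * curv (metric i) (x i t) (Y t) (T i t).
pose K (t : R) := t + 2^-1 * e ^+ 2 * (bnd t + Q t + et * t).
pose dK (t : R) := 1 + 2^-1 * e ^+ 2 * (dens t + et).
have hK (t : R) : t0 <= t <= t1 -> is_derive t 1 K (dK t).
  move=> tt; have ut := sub t tt.
  have [tt' _] := hdom ut.
  have hb := der_boundary (@img_open _ _ M i) (@metric_sm _ _ M i)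
    (fun x => @Defs.metric_sym _ _ M i x) w (hg ut) (hY ut) (hphi tt') (hlam ut).
  apply: (is_derive_eq (derD (der_id t) (derM (der_cst (2^-1 * e ^+ 2) t 1)
    (derD (derD hb (hQ tt)) (derM (der_cst et t 1) (der_id t)))))).
  by rewrite !mul0r !add0r /dK /dens /dbnd mulr1; congr (_ + _ * (_ + _)); rewrite addrA.
(* A C^1 piece must extend beyond [0, 1], while [He] locates the curve in the chart on [t0, t1]
   only; openness of the chart image provides the margin dd. *)
have near_img t : t0 <= t <= t1 -> exists2 d : R, 0 < d &
    forall s, `|s - t| < d -> chart_img i (vary (x i) v r lam e s).
  move=> tt; have ut := sub t tt.
  have hc := der_cont (der_vary_t e ut).
  by apply: near_dist; apply: hc; apply: open_near (@img_open _ _ M i) _; have [] := He t tt.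
have [d1 d10 h1] := near_img t0 (introT andP (conj (lexx _) (ltW t01))).
have [d2 d20 h2] := near_img t1 (introT andP (conj (ltW t01) (lexx _))).
pose dd := Num.min (Num.min d1 d2) (Num.min (t0 - u0) (u1 - t1)).
have dd0 : 0 < dd by rewrite !lt_min d10 d20 !subr_gt0 u0t0.
have [dd1 dd2 dd3 dd4] : [/\ dd <= d1, dd <= d2, dd <= t0 - u0 & dd <= u1 - t1].
  by split; rewrite !ge_min lexx ?orbT.
have eD : dd / D * D = dd by apply: divfK; exact: D0.
have inside s : - (dd / D) < s < 1 + dd / D ->
    u0 < t0 + s * D < u1 /\ chart_img i (al s).
  move=> /andP[s1 s2].
  have s1' : - dd < s * D by rewrite -eD -mulNr ltr_pM2r.
  have s2' : s * D < D + dd.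
    have -> : D + dd = (1 + dd / D) * D by rewrite mulrDl mul1r eD.
    by rewrite ltr_pM2r.
  have eDD : D = t1 - t0 by [].
  split; first by apply/andP; split; lra.
  have [s0|s0] := leP 0 s; last first.
    apply: h1; rewrite addrAC subrr add0r ltr_norml; apply/andP; split; first lra.
    have h3 : s * D < 0 by rewrite (pmulr_llt0 _ Dp).
    lra.
  have [s3|s3] := leP s 1.
    exact: (He _ (sD01 s (introT andP (conj s0 s3)))).1.
  apply: h2; have -> : t0 + s * D - t1 = s * D - D by rewrite /D; ring.
  have h3 : D < s * D by rewrite (ltr_pMl _ Dp).
  rewrite ltr_norml; apply/andP; split; lra.
have [|||||l' hl' le'] := @path_extend R m.+1 M i al dal (dd / D) (E a0) l
    (fun s => K (t0 + s * D)) (fun s => dK (t0 + s * D) * D).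
- exact: divr_gt0 dd0 Dp.
- move=> s /inside[us Us]; split; first exact: Us.
    have h := der_compV (der_affine s t0 D) (der_vary_t e us); exact: h.
  have ha : {for s, continuous (fun s : R => t0 + s * D)} by exact: der_cont (der_affine s t0 D).
  apply: contVZ; first exact: cvg_cst.
  apply: (cont_compose ha).
  have [tt' _] := hdom us; have [Ux hx hT] := hg us.
  apply: contVD; first apply: contVD.
  + exact: der_cont hT.
  + apply: contVZ; first exact: cvg_cst.
    exact: (dfield_cont (@img_open _ _ M i) (@metric_sm _ _ M i) (@metric_unit _ _ M i)
      hg hY (fun t tt => hphi (hdom tt).1) (fun t tt => hdphi (hdom tt).1) us).
  + by apply: contVZ; exact: cvg_cst.
- rewrite /al mul0r addr0 (vary0 We); exact: hl.
- move=> s /sD01 h.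
  exact: der_comp (der_affine s t0 D) (hK _ h).
- move=> s /sD01 h.
  have [Ut en] := He _ h.
  have A0 := metric_ge0 (dvary (T i) (dfield (metric i) (x i) (T i) Y phi dphi) r dlam e (t0 + s * D)) Ut.
  apply: le_trans (sqrt_ipZ_le (ltW Dp) A0) _.
  rewrite (ler_pM2r Dp); move: en; rewrite /energy -/(dbnd _) -/(dens _) => en.
  rewrite /dK; lra.
exists l'.
  by rewrite -vary1E; move: hl'; rewrite /al mul1r /D addrC subrK.
apply: le_trans le' _; apply: le_trans (lerD le (lexx _)) _.
rewrite mul1r mul0r addr0.
have -> : t0 + D = t1 by rewrite /D addrC subrK.
rewrite /K -bnd1 -bnd0.
have E1 : et * t1 - et * t0 = eta / 2.
  by rewrite -mulrBr -/D /et; field; exact: D0.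
rewrite le_eqVlt; apply/orP; left; apply/eqP.
have -> : eta = 2 * (et * t1 - et * t0) by rewrite E1; field.
by field.
Qed.

End ReachStep.
End Step.

(** * Carrying a frame of variations along the geodesic *)

Section Sweep.
Variables (R : realType) (m : nat) (M : riemannianManifold R m.+1).
Variables (gam e0 : R) (E : R -> M).
Hypothesis hgeo : geodesic_on `](- e0), gam[ E.
Hypothesis e00 : 0 < e0.
Hypothesis hspeed : forall t, 0 <= t < gam -> speed E t = 1.

Notation x i := (chart_coord E i).
Notation T i := (vel E i).

Definition ricci_along i t :=
  \sum_j \sum_k ricci_coef (metric i) j k (x i t) * T i t 0 j * T i t 0 k.

Let wide t : 0 < t < gam -> - e0 < t < gam.
Proof. by move: e00 => ? /andP[? ?]; apply/andP; split; lra. Qed.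

Let unitT i t : 0 < t < gam -> chart_dom i (E t) -> ip (metric i (x i t)) (T i t) (T i t) = 1.
Proof.
move=> tt Ei; apply: (vel_unit hgeo (wide tt) Ei); apply: hspeed.
by case/andP: tt => ? ?; apply/andP; split; lra.
Qed.

Lemma ricci_along_cont i t : 0 < t < gam -> chart_dom i (E t) -> {for t, continuous (ricci_along i)}.
Proof.
move=> tt Ei; have [Ux hx hT] := geo_at hgeo (wide tt) Ei.
exact: (cont_ricci (@img_open _ _ M i) (@metric_sm _ _ M i) (@metric_unit _ _ M i) Ux
  (der_cont hx) (der_cont hT)).
Qed.

(** In the trace over the orthonormal frame made of T and the [V a], the T term drops out because
    R(T, T) T = 0. *)
Lemma ricci_along_curv i t (V : 'I_m -> 'rV[R]_m.+1) : 0 < t < gam -> chart_dom i (E t) ->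
  orthoframe (metric i (x i t)) (T i t) V ->
  \sum_a curv (metric i) (x i t) (V a) (T i t) = ricci_along i t.
Proof.
move=> tt Ei hV; have Ux : chart_img i (x i t) by exact: map_img.
rewrite /ricci_along ricci_trace.
rewrite (orthoframe_trace (Defs.metric_sym Ux) (unitT tt Ei) _ hV).
rewrite {1}/ip mulmxA (rhomx_self (@img_open _ _ M i) (@metric_sm _ _ M i) (@metric_unit _ _ M i)) //.
rewrite !mul0mx mxE add0r; apply: eq_bigr => a _; symmetry.
exact: (ip_rhomx (@img_open _ _ M i) (@metric_sm _ _ M i)
  (fun y => @Defs.metric_sym _ _ M i y) (@metric_unit _ _ M i)).
Qed.

Lemma frame_glue i j t (V : 'I_m -> 'rV[R]_m.+1) : 0 < t < gam -> chart_dom i (E t) -> chart_dom j (E t) ->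
  orthoframe (metric i (x i t)) (T i t) V ->
  orthoframe (metric j (x j t)) (T j t) (fun a : 'I_m => dtr (tau i j) (x i t) (V a)).
Proof.
move=> tt Ei Ej [VV VT]; have W := overlap_map Ei Ej : overlap i j (x i t).
split=> [a b|a]; first by rewrite -VV (metric_tau _ _ W) (tau_coord _ Ei).
by rewrite -(VT a) (metric_tau _ _ W) (tau_coord _ Ei) (vel_tau hgeo (wide tt) Ei Ej).
Qed.

(** T is parallel along a geodesic, so all inner products involved are constant. The times t0 and t1
    come in either order. *)
Lemma parallel_frame i (u0 u1 t0 t1 : R) (Y : 'I_m -> R -> 'rV[R]_m.+1) :
  (forall t, u0 < t < u1 -> 0 < t < gam /\ chart_dom i (E t)) ->
  (forall a t, u0 < t < u1 -> parallel_at (metric i) (x i) (T i) (Y a) t) ->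
  u0 < t0 < u1 -> u0 < t1 < u1 ->
  orthoframe (metric i (x i t0)) (T i t0) (Y^~ t0) ->
  orthoframe (metric i (x i t1)) (T i t1) (Y^~ t1).
Proof.
move=> hdom hY it0 it1 [YY YT].
have hg t : u0 < t < u1 -> geodesic_at (chart_img i) (metric i) (x i) (T i) t.
  by move=> /hdom[tt Et]; exact: (geo_at hgeo (wide tt) Et).
have C (A B : R -> 'rV[R]_m.+1) :
    (forall t, u0 < t < u1 -> parallel_at (metric i) (x i) (T i) A t) ->
    (forall t, u0 < t < u1 -> parallel_at (metric i) (x i) (T i) B t) ->
    ip (metric i (x i t1)) (A t1) (B t1) = ip (metric i (x i t0)) (A t0) (B t0).
  move=> hA hB; move: it0 it1 => /andP[? ?] /andP[? ?].
  have const p q : p <= q -> u0 < p -> q < u1 ->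
      ip (metric i (x i p)) (A p) (B p) = ip (metric i (x i q)) (A q) (B q).
    move=> pq p0 q1; have sub t : p <= t <= q -> u0 < t < u1.
      by move=> /andP[? ?]; apply/andP; split; lra.
    by apply: (parallel_ip_const (@img_open _ _ M i) (@metric_sm _ _ M i)
      (fun y => @Defs.metric_sym _ _ M i y) (@metric_unit _ _ M i) pq) => t /sub tt;
      [exact: hg | exact: hA | exact: hB].
  by have [le|/ltW le] := leP t0 t1; [symmetry|]; apply: const.
split=> [a b|a].
  exact: etrans (C (Y a) (Y b) (hY a) (hY b)) (YY a b).
by apply: etrans (C (Y a) (T i) (hY a) _) (YT a) => t /hg[].
Qed.

Variables (phi dphi h dh rb : R -> R) (a0 b : R).
Hypothesis a0b : 0 < a0 /\ a0 < b < gam.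
Hypothesis hphi : forall t : R, 0 < t < gam -> is_derive t 1 phi (dphi t).
Hypothesis hdphi : forall t, 0 < t < gam -> {for t, continuous dphi}.
Hypothesis hh : forall t : R, 0 < t < gam -> is_derive t 1 h (dh t).
Hypothesis hrb : forall t, 0 < t < gam -> {for t, continuous rb}.
Hypothesis hric : forall t, a0 <= t <= b -> rb t < ricci_along (chart_at (E t)) t.
Hypothesis hdh : forall t, 0 < t < gam -> m%:R * dphi t ^+ 2 - phi t ^+ 2 * rb t <= dh t.

(** The invariant of the induction. Subtracting the Christoffel terms removes the dependence on the
    chart: [reach_step] adds exactly their increments, so the remaining sum grows by the index form
    alone. *)
Definition swept t := exists i (V : 'I_m -> 'rV[R]_m.+1) (q : 'I_m -> R),
  [/\ chart_dom i (E t), orthoframe (metric i (x i t)) (T i t) V,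
    forall a, reach E a0 t i (phi t *: V a) (q a) &
    \sum_a (q a - chrl (metric i) (x i t) (phi t *: V a) (phi t *: V a) (T i t)) <= h t - h a0].

(** The curvature hypothesis is used at time s only, in the preferred chart of [E s]; being strict,
    it persists near s in that fixed chart by continuity. *)
Lemma swept_step s : a0 <= s <= b -> exists2 d : R, 0 < d &
  forall t0 t1, a0 <= t0 -> t0 < t1 -> t1 <= b ->
     `|t0 - s| < d -> `|t1 - s| < d -> swept t0 -> swept t1.
Proof.
move=> sab; have ss : 0 < s < gam.
  by move: sab a0b => /andP[? ?] [? /andP[? ?]]; apply/andP; split; lra.
pose i := chart_at (E s); have Es : chart_dom i (E s) by exact: chart_atP.
have [d1 d10 [dom1 par]] := parallel_local hgeo e00 ss Es.
have [d2 d20 ric] : exists2 d : R, 0 < d & forall t, `|t - s| < d -> rb t < ricci_along i t.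
  apply: near_dist; have hc := contB (ricci_along_cont ss Es) (hrb ss).
  have pos : 0 < ricci_along i s - rb s by rewrite subr_gt0; exact: hric.
  by near=> t; rewrite -subr_gt0; near: t; apply: (cvgr_gt _ hc).
pose d := Num.min d1 d2.
have dd1 : d <= d1 by rewrite ge_min lexx.
have dd2 : d <= d2 by rewrite ge_min lexx orbT.
exists d; first by rewrite lt_min d10.
move=> t0 t1 at0 t01 t1b; rewrite !ltr_norml => /andP[st0 st0'] /andP[st1 st1'].
move=> [i0 [V [q [Ei0 hV hq hs]]]].
have close t : s - d < t < s + d -> `|t - s| < d.
  by move=> /andP[? ?]; rewrite ltr_norml; apply/andP; split; lra.
have hdom t : s - d < t < s + d -> 0 < t < gam /\ chart_dom i (E t).
  by move=> /close td; apply: dom1; exact: lt_le_trans td dd1.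
have it0 : s - d < t0 < s + d by apply/andP; split; lra.
have it1 : s - d < t1 < s + d by apply/andP; split; lra.
have u0t0 : s - d < t0 by case/andP: it0.
have t1u1 : t1 < s + d by case/andP: it1.
have [tt0 Et0] := hdom t0 it0.
have /choice[Y hY] : forall a, exists Y, Y t0 = dtr (tau i0 i) (x i0 t0) (V a) /\
    forall t, s - d < t < s + d -> parallel_at (metric i) (x i) (T i) Y t.
  move=> a; have [Y Y0 pY] := par t0 (dtr (tau i0 i) (x i0 t0) (V a)) (lt_le_trans (close t0 it0) dd1).
  by exists Y; split=> // t /close td; apply: pY; exact: lt_le_trans td dd1.
have Y0 a : Y a t0 = dtr (tau i0 i) (x i0 t0) (V a) by have [] := hY a.
have pY a t : s - d < t < s + d -> parallel_at (metric i) (x i) (T i) (Y a) t.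
  by have [_] := hY a; apply.
have fr t : s - d < t < s + d -> orthoframe (metric i (x i t)) (T i t) (Y^~ t).
  move=> tt; apply: (parallel_frame hdom pY it0 tt).
  have -> : Y^~ t0 = fun a => dtr (tau i0 i) (x i0 t0) (V a) by apply/funext => a; exact: Y0.
  exact: frame_glue.
(* The primitives Q must be differentiable at t0 and t1, and their integrands continuous on a closed
   interval: [c0, c1] lies strictly between. *)
pose c0 := (s - d + t0) / 2; pose c1 := (t1 + (s + d)) / 2.
have cE : s - d < c0 /\ c0 < t0 /\ t1 < c1 /\ c1 < s + d.
  by rewrite /c0 /c1; do !split; lra.
case: cE => c01 [c02 [c03 c04]].
have /choice[Q hQ] : forall a, exists Q, forall t : R, c0 < t < c1 -> is_derive t 1 Q
    (dphi t ^+ 2 - phi t ^+ 2 * curv (metric i) (x i t) (Y a t) (T i t)).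
  move=> a; apply: antiderivative; first lra.
  move=> t /andP[tc0 tc1]; have ut : s - d < t < s + d by apply/andP; split; lra.
  have [tt Et] := hdom t ut; have [Ux hx hT] := geo_at hgeo (wide tt) Et.
  have hp := hphi tt.
  apply: contB; first by apply: (contM (f := dphi) (g := dphi)); exact: hdphi.
  apply: contM; first by apply: (contM (f := phi) (g := phi)); exact: der_cont hp.
  exact: (cont_curv (@img_open _ _ M i) (@metric_sm _ _ M i) (@metric_unit _ _ M i) Ux
    (der_cont hx) (der_cont (pY a t ut)) (der_cont hT)).
have hQ' a (t : R) : t0 <= t <= t1 -> is_derive t 1 (Q a)
    (dphi t ^+ 2 - phi t ^+ 2 * curv (metric i) (x i t) (Y a t) (T i t)).
  by move=> /andP[? ?]; apply: hQ; apply/andP; split; lra.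
exists i, (Y^~ t1), (fun a => q a +
  (chrl (metric i) (x i t1) (phi t1 *: Y a t1) (phi t1 *: Y a t1) (T i t1)
   - chrl (metric i0) (x i0 t0) (phi t0 *: V a) (phi t0 *: V a) (T i0 t0)) + (Q a t1 - Q a t0)).
split; [by have [] := hdom t1 it1 | exact: fr | move=> a | ].
- apply: (reach_step hgeo e00 hspeed hphi hdphi u0t0 t01 t1u1 hdom (pY a) _ _ Ei0 _ (hq a) (hQ' a)).
  + by move=> t tt; have [YY _] := fr t tt; rewrite YY eqxx.
  + by move=> t tt; have [_ YT] := fr t tt; exact: YT.
  + by rewrite dtrZ Y0.
have -> : h t1 - h a0 = (h t0 - h a0) + (h t1 - h t0) by ring.
pose S t := \sum_a Q a t.
have SE : S t1 - S t0 = \sum_a (Q a t1 - Q a t0) by rewrite /S sumrB.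
(* Summed over the frame, the index densities give m phi'^2 - phi^2 Ric, which is at most m phi'^2 -
   phi^2 rb, hence at most h'. *)
have hS : S t1 - S t0 <= h t1 - h t0.
  rewrite -subr_ge0 (_ : _ - _ = (h t1 - S t1) - (h t0 - S t0)); last by ring.
  rewrite subr_ge0; apply: (nondecr_le (f := fun t => h t - S t)
    (df := fun t => dh t - \sum_a (dphi t ^+ 2 - phi t ^+ 2 * curv (metric i) (x i t) (Y a t) (T i t)))
    (ltW t01)) => t tt.
    have [tt' _] : 0 < t < gam /\ chart_dom i (E t).
      by apply: hdom; case/andP: tt => ? ?; apply/andP; split; lra.
    by apply: derB; [exact: hh | apply: der_sum => a _; exact: hQ'].
  have ut : s - d < t < s + d by case/andP: tt => ? ?; apply/andP; split; lra.
  have [tt' Et] := hdom t ut.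
  rewrite sumrB sumr_const card_ord -mulr_sumr (ricci_along_curv tt' Et (fr t ut)).
  have r := ric t (lt_le_trans (close t ut) dd2).
  have := hdh tt'; have := ler_wpM2l (sqr_ge0 (phi t)) (ltW r).
  rewrite mulr_natl => ? ?; lra.
apply: le_trans (lerD hs hS); rewrite SE -big_split /= ler_sum // => a _.
by rewrite le_eqVlt; apply/orP; left; apply/eqP; ring.
Unshelve. all: by end_near. Qed.

(** As phi b = 0, every varied path ends at [E b] itself. Minimality then forces each [q a] to be
    nonnegative, and their sum is at most h b - h a0. *)
Lemma sweep_bound : minimal_curve gam E -> phi a0 = 0 -> phi b = 0 -> h a0 <= h b.
Proof.
move=> hmin pa pb; have [a00 /andP[ab bg]] := a0b.
have a0i : 0 < a0 < gam by apply/andP; split; lra.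
have Pa : swept a0.
  pose i := chart_at (E a0); have Ea : chart_dom i (E a0) by exact: chart_atP.
  have Ux : chart_img i (x i a0) by exact: map_img.
  have [V hV] := orthoframe_exists (T i a0) (Defs.metric_sym Ux) (fun v => metric_pos Ux (v := v)).
  (* As phi a0 = 0, the varied point is [E a0], reached by the empty path. *)
  exists i, V, (fun=> 0); split=> // [a eta eta0|].
    near=> e; exists 0.
      rewrite pa scale0r scaler0 addr0 /chart_coord chart_mapK //; exact: path_nil.
    by rewrite subrr !add0r; apply: mulr_ge0 (ltW eta0); apply: mulr_ge0 (sqr_ge0 _).
  rewrite big1 ?subrr // => a _.
  by rewrite pa scale0r /chrl !ip0l addr0 subrr mulr0 subrr.
have [i [V [q [Eb hV hq hs]]]] := interval_induction (ltW ab) swept_step Pa.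
rewrite -subr_ge0; apply: le_trans hs; apply: sumr_ge0 => a _.
have chr0 v : chrl (metric i) (x i b) 0 0 v = 0 by rewrite /chrl !ip0l addr0 subrr mulr0.
rewrite pb scale0r chr0 subr0; apply/ler_addgt0Pr => eta eta0.
have /near_dist[d d0 hd] := hq a eta eta0.
have d2 : `|d / 2 - 0| < d by rewrite subr0 gtr0_norm ?divr_gt0 //; lra.
have [l hl le] := hd _ d2.
have := dist_le hl; rewrite pb scale0r scaler0 addr0 /chart_coord chart_mapK //.
rewrite hmin ?in_itv /= ?(ltW a00) ?(lt_trans ab bg) //; last by rewrite bg (ltW (lt_trans a00 ab)).
rewrite distrC gtr0_norm ?subr_gt0 // => le2; have := le_trans le2 le.
rewrite lerDl; have dd : 0 < 2^-1 * (d / 2) ^+ 2 by rewrite mulr_gt0 ?exprn_gt0 ?divr_gt0.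
by rewrite (pmulr_rge0 _ dd).
Unshelve. all: by end_near. Qed.

End Sweep.

(** * The upper bound *)

Section TestFunction.
Variables (R : realType) (gam y0 Y k c : R).

(* In the variable [z = - ln (gam - t) - y0] the index form of [sqrt (gam - t) * psi z] against the
   curvature bound [c / (gam - t) ^ 2] has density [k * (psi' - psi / 2) ^ 2 - c * psi ^ 2], of which
   [test_energy] is the primitive. *)
Definition psi (z : R) := z * (Y - z).
Definition test_var (t : R) := - ln (gam - t) - y0.
Definition test t := Num.sqrt (gam - t) * psi (test_var t).
Definition dtest t := (Y - 2 * test_var t - 2^-1 * psi (test_var t)) / Num.sqrt (gam - t).
Definition test_primitive z := k * (Y ^+ 2 * z - 2 * Y * z ^+ 2 + 4 / 3 * z ^+ 3) - k / 2 * psi z ^+ 2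
  - (c - k / 4) * (Y ^+ 2 * z ^+ 3 / 3 - Y * z ^+ 4 / 2 + z ^+ 5 / 5).
Definition test_energy t := test_primitive (test_var t).
Definition dtest_energy t := k * dtest t ^+ 2 - test t ^+ 2 * (c / (gam - t) ^+ 2).

Section At.
Variable t : R.
Hypothesis tg : t < gam.

Let p0 : 0 < gam - t. Proof. by rewrite subr_gt0. Qed.
Let s0 : 0 < Num.sqrt (gam - t). Proof. by rewrite sqrtr_gt0. Qed.
Let ss : Num.sqrt (gam - t) * Num.sqrt (gam - t) = gam - t.
Proof. by rewrite -expr2 sqr_sqrtr // ltW. Qed.

Let der_rem : is_derive t 1 (fun t : R => gam - t) (- 1).
Proof. by apply: (is_derive_eq (derB (der_cst gam t 1) (der_id t))); rewrite sub0r. Qed.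

Lemma der_test_var : is_derive t 1 test_var (gam - t)^-1.
Proof.
apply: (der_congr _ _ (derB (derB (der_cst 0 t 1) (der_comp der_rem (is_derive1_ln p0))) (der_cst y0 t 1))).
  by near=> s; rewrite /test_var sub0r.
by rewrite subr0 sub0r mulrN1 opprK.
Unshelve. all: by end_near. Qed.

Let der_sqrt : is_derive t 1 (fun t => Num.sqrt (gam - t)) (- (2 * Num.sqrt (gam - t))^-1).
Proof. by apply: (is_derive_eq (der_comp der_rem (is_derive1_sqrt p0))); rewrite mulrN1. Qed.

Let der_psi : is_derive t 1 (fun t => psi (test_var t)) ((Y - 2 * test_var t) / (gam - t)).
Proof.
have h := der_test_var.
apply: (is_derive_eq (derM h (derB (der_cst Y t 1) h))); field.
by rewrite subr_eq0 gt_eqF.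
Qed.

Lemma der_test : is_derive t 1 test (dtest t).
Proof.
apply: (is_derive_eq (derM der_sqrt der_psi)); rewrite /dtest -{3}ss; field.
by rewrite gt_eqF.
Qed.

Lemma cont_dtest : {for t, continuous dtest}.
Proof.
apply: contM; last by apply: contV; [rewrite gt_eqF | exact: der_cont der_sqrt].
apply: contB; last by apply: contM; [exact: cont_cst | exact: der_cont der_psi].
apply: contB; first exact: cont_cst.
by apply: contM; [exact: cont_cst | exact: der_cont der_test_var].
Qed.

Lemma der_test_energy : is_derive t 1 test_energy (dtest_energy t).
Proof.
have E (z : R) : is_derive z 1 test_primitive (k * (Y - 2 * z - 2^-1 * psi z) ^+ 2 - c * psi z ^+ 2).
  have i1 := der_id z; have i2 := derM i1 i1; have i3 := derM i1 i2.
  have i4 := derM i1 i3; have i5 := derM i1 i4.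
  have ip := derM i1 (derB (der_cst Y z 1) i1).
  have C (u : R) := der_cst u z 1.
  have h := derB (derB (derM (C k)
      (derD (derB (derM (C (Y ^+ 2)) i1) (derM (C (2 * Y)) i2)) (derM (C (4 / 3)) i3)))
    (derM (C (k / 2)) (derM ip ip)))
    (derM (C (c - k / 4)) (derD (derB (derM (C (Y ^+ 2 / 3)) i3) (derM (C (Y / 2)) i4)) (derM (C 5^-1) i5))).
  apply: (der_congr _ _ h); last by rewrite /psi; field.
  by near=> u; rewrite /test_primitive /psi; field.
apply: (is_derive_eq (der_comp der_test_var (E (test_var t)))).
have [z0 r0] : gam - t != 0 /\ Num.sqrt (gam - t) != 0 by rewrite !gt_eqF.
rewrite /dtest_energy /dtest /test expr_div_n [(Num.sqrt _ * _) ^+ 2]exprMn (sqr_sqrtr (ltW p0)); field.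
exact: z0.
Unshelve. all: by end_near. Qed.

Lemma cont_pole : {for t, continuous (fun t => c / (gam - t) ^+ 2)}.
Proof.
apply: contM; first exact: cont_cst.
apply: contV; first by rewrite expf_neq0 // gt_eqF.
by have h := der_cont der_rem; exact: (contM h h).
Qed.

End At.
End TestFunction.

(** For psi = z (Y - z) on [0, Y], the integrals of psi'^2 and psi^2 are Y^3 / 3 and Y^5 / 30, so
    the second wins for large Y. With d = c - k / 4 one needs d Y^2 > 10 k, which Y = 1 + 10 k / d
    ensures. *)
Lemma cubic_lt_quintic (R : realType) (k c : R) : 0 <= k -> k / 4 < c ->
  exists2 Y : R, 0 < Y & k * Y ^+ 3 / 3 < (c - k / 4) * Y ^+ 5 / 30.
Proof.
move=> k0 kc; have d0 : 0 < c - k / 4 by rewrite subr_gt0.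
set d := c - k / 4 in d0 *.
pose Y := 1 + 10 * k / d.
have Y1 : 1 <= Y by rewrite lerDl divr_ge0 ?mulr_ge0 // ltW.
have Y0 : 0 < Y by exact: lt_le_trans Y1.
exists Y => //.
have dY : d * Y = d + 10 * k by rewrite /Y; field; rewrite gt_eqF.
have Y2 : d + 10 * k <= d * Y ^+ 2.
  by rewrite -dY expr2 mulrA ler_peMr // ltW // mulr_gt0.
have Y3 : 0 < Y ^+ 3 / 30 by rewrite divr_gt0 ?exprn_gt0.
have -> : k * Y ^+ 3 / 3 = (10 * k) * (Y ^+ 3 / 30) by field.
have -> : d * Y ^+ 5 / 30 = (d * Y ^+ 2) * (Y ^+ 3 / 30) by field.
by rewrite (ltr_pM2r Y3); lra.
Qed.

Section UpperBound.
Variables (R : realType) (m : nat) (M : riemannianManifold R m.+1).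
Variables (gam e0 : R) (E : R -> M).
Hypothesis gam0 : 0 < gam.
Hypothesis hgeo : geodesic_on `](- e0), gam[ E.
Hypothesis e00 : 0 < e0.
Hypothesis hspeed : forall t, 0 <= t < gam -> speed E t = 1.
Hypothesis hmin : minimal_curve gam E.

Lemma ricci_pole_bound (c a1 : R) : a1 < gam ->
  (forall t, a1 < t < gam -> c < (gam - t) ^+ 2 * Ric (E t) (velocity E t) (velocity E t)) ->
  c <= m%:R / 4.
Proof.
move=> a1g hric; rewrite leNgt; apply/negP => mc.
have [Y Y0 hY] := cubic_lt_quintic (ler0n R m) mc.
pose a0 := (Num.max a1 0 + gam) / 2.
have : Num.max a1 0 < gam by rewrite gt_max a1g.
have : a1 <= Num.max a1 0 by rewrite le_max lexx.
have : 0 <= Num.max a1 0 by rewrite le_max lexx orbT.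
move: (Num.max a1 0) @a0 => mx a0 mx0 mx1 mxg.
have [a00 [a01 a0g]] : 0 < a0 /\ a1 < a0 /\ a0 < gam by rewrite /a0; do !split; lra.
(* With this y0 and b, [test_var] runs from 0 at a0 to Y at b, the two zeros of psi. *)
pose y0 := - ln (gam - a0).
pose b := gam - expR (- (y0 + Y)).
have ga : 0 < gam - a0 by rewrite subr_gt0.
have bg : b < gam by rewrite /b ltrBlDr ltrDl expR_gt0.
have ab : a0 < b.
  rewrite /b ltrBrDr -ltrBrDl -[ltRHS](@lnK R) ?posrE // ltr_expR /y0; lra.
have za : test_var gam y0 a0 = 0 by rewrite /test_var /y0 subrr.
have zb : test_var gam y0 b = Y.
  have -> : b = gam - expR (- (y0 + Y)) by [].
  by rewrite /test_var subKr expRK; ring.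
have := @sweep_bound R m M gam e0 E hgeo e00 hspeed (test gam y0 Y) (dtest gam y0 Y)
  (test_energy gam y0 Y m%:R c) (dtest_energy gam y0 Y m%:R c) (fun t => c / (gam - t) ^+ 2) a0 b
  (conj a00 (introT andP (conj ab bg))).
have lt t : 0 < t < gam -> t < gam by case/andP.
move=> H; have : test_energy gam y0 Y m%:R c a0 <= test_energy gam y0 Y m%:R c b.
  apply: H => //.
  - by move=> t /lt; exact: der_test.
  - by move=> t /lt; exact: cont_dtest.
  - by move=> t /lt; exact: der_test_energy.
  - by move=> t /lt; exact: cont_pole.
  - move=> t /andP[t0 t1].
    have tt : a1 < t < gam by apply/andP; split; lra.
    have p2 : 0 < (gam - t) ^+ 2 by rewrite exprn_gt0 // subr_gt0; case/andP: tt.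
    rewrite ltr_pdivrMr // mulrC; exact: hric.
  - by rewrite /test za /psi mul0r mulr0.
  - by rewrite /test zb /psi subrr !mulr0.
(* The inequality now says 0 <= k Y^3 / 3 - (c - k / 4) Y^5 / 30, against the choice of Y. *)
rewrite /test_energy za zb /test_primitive /psi => h.
move: hY; rewrite ltNge => /negP; apply.
rewrite -subr_ge0; move: h; rewrite -subr_ge0 => h.
by apply: le_trans h _; rewrite le_eqVlt; apply/orP; left; apply/eqP; field.
Qed.

End UpperBound.

(** The lower limit is a supremum of infima over left neighbourhoods of gam, so some infimum exceeds
    c; the intermediate d leaves a strict gap on both sides. *)
Lemma lt_limf_einf (R : realType) (f : R -> R) (gam c : R) :
  (c%:E < limf_einf (fun s => (f s)%:E) gam^'-)%E ->
  exists2 d, c < d & exists2 a, a < gam & forall t, a < t < gam -> d < f t.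
Proof.
rewrite limf_einfE => /ereal_sup_gt[_ [V hV <-]] cV.
have [d cd dV] : exists2 d, c < d & (d%:E < ereal_inf [set (f x)%:E | x in V])%E.
  move: cV; case: (ereal_inf _) => [r| |//].
    by rewrite lte_fin => cr; exists ((c + r) / 2); rewrite ?lte_fin; lra.
  by move=> _; exists (c + 1); rewrite ?ltry //; lra.
exists d => //; move: hV => /nbhs_ballP[e /= e0 he].
exists (gam - e); first by rewrite ltrBlDr ltrDl.
move=> t /andP[t0 t1]; rewrite -lte_fin; apply: lt_le_trans dV _.
apply: ereal_inf_lbound; exists t => //; apply: he => //.
by rewrite -ball_normE /= gtr0_norm ?subr_gt0 //; lra.
Qed.

Lemma ricci_liminf (R : realType) n (M : riemannianManifold R n) (gam : R) (C : R -> M) :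
  0 < gam -> unit_speed_geodesic gam C -> minimal_curve gam C ->
  (limf_einf
     (fun s => ((gam - s) ^+ 2 * Ric (C s) (velocity C s) (velocity C s))%:E) gam^'-
   <= ((n%:R - 1) / 4)%:E)%E.
Proof.
move=> gam0 [e [E [e0 hgeo EC hsp]]] hmin.
have hspeed t : 0 <= t < gam -> speed E t = 1 by move=> tt; apply: hsp; rewrite in_itv.
have Emin : minimal_curve gam E by move=> s t hs ht; rewrite !EC //; exact: hmin.
case: n M C E hgeo EC hsp hspeed Emin hmin => [|m] M C E hgeo EC hsp hspeed Emin hmin.
  (* In dimension 0 every speed is 0, so there is no unit-speed curve. *)
  have := hspeed 0; rewrite lexx gam0 => /(_ isT).
  rewrite /speed /tangent_norm mxE big_ord0 sqrtr0 => /eqP.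
  by rewrite eq_sym oner_eq0.
rewrite leNgt; apply/negP => /lt_limf_einf[d cd [a ag ha]].
(* Times are kept positive because E and C agree only from 0 on, whereas [velocity] is a two-sided
   derivative. *)
have := @ricci_pole_bound R m M gam e E gam0 hgeo e0 hspeed Emin d (Num.max a 0).
rewrite gt_max ag gam0 => /(_ isT) H.
suff : d <= m%:R / 4 by move: cd; rewrite -natr1 addrK ltNge => /negP.
apply: H => t /andP[]; rewrite gt_max => /andP[t1 t2] t3.
have -> : E t = C t by apply: EC; rewrite in_itv /= (ltW t2).
have -> : velocity E t = velocity C t.
  rewrite /velocity (EC t); last by rewrite in_itv /= (ltW t2).
  rewrite !derive1E; apply: near_eq_derive.
  near=> s; rewrite /= EC // in_itv /=; apply/andP; split.
    by apply: ltW; near: s; exact: lt_nbhsr.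
  by near: s; exact: lt_nbhsl.
by apply: ha; rewrite t1.
Unshelve. all: by end_near. Qed.

(** * The surface [dr ^ 2 + r dy ^ 2] *)

Lemma der_from_line (R : realType) (V W : normedModType R) (f : V -> W) (x v : V) d :
  is_derive (0 : R) 1 (fun s : R => f (x + s *: v)) d -> is_derive x v f d.
Proof.
move=> [h1 h2].
have E : (fun h : R => h^-1 *: (f (h *: v + x) - f x)) =
  (fun h : R => h^-1 *: (f (x + (h *: (1 : R) + 0) *: v) - f (x + (0 : R) *: v))).
  by apply/funext => h; rewrite addr0 scale0r addr0 [h *: 1]mulr1 (addrC x).
apply: DeriveDef; first by move: h1; rewrite /derivable -E.
by move: h2; rewrite /derive -E.
Qed.

Section CoordinateFunctions.
Variables (R : realType) (n : nat).

Lemma der_coord (k : 'I_n) (x v : 'rV[R]_n) : is_derive x v (fun y => y 0 k) (v 0 k).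
Proof.
apply: der_from_line; have /der_rV h := der_lineV 0 x v; exact: h.
Qed.

Lemma cont_coord_fun (k : 'I_n) (x : 'rV[R]_n) : {for x, continuous (fun y : 'rV[R]_n => y 0 k)}.
Proof. exact: coord_continuous. Qed.

Lemma smooth_coord U (k : 'I_n) : smooth_on U (fun x : 'rV[R]_n => x 0 k).
Proof.
have D c d l x : is_derive x (delta_mx 0 l) (fun y : 'rV[R]_n => c * y 0 k + d)
    (c * (delta_mx 0 l : 'rV_n) 0 k).
  apply: (is_derive_eq (derD (derM (der_cst c _ _) (der_coord k x _)) (der_cst d _ _))).
  by rewrite mul0r add0r addr0.
apply: (smooth_stable (P := fun f => exists c d, f = fun x : 'rV[R]_n => c * x 0 k + d)).
- move=> _ x [c [d ->]] _; split=> [|l]; last by have [] := D c d l x.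
  by apply: contD; [apply: contM; [exact: cont_cst | exact: cont_coord_fun] | exact: cont_cst].
- move=> _ l [c [d ->]]; exists 0, (c * (delta_mx 0 l : 'rV[R]_n) 0 k).
  by apply/funext => x; rewrite mul0r add0r; exact: der_partial (D c d l x).
- by exists 1, 0; apply/funext => x; rewrite mul1r addr0.
Qed.

Lemma der_exp_coord a (k : 'I_n) (x v : 'rV[R]_n) :
  is_derive x v (fun y => expR (a * y 0 k)) (a * v 0 k * expR (a * x 0 k)).
Proof.
apply: der_from_line; have /der_rV/(_ k) h := der_lineV 0 x v.
have h2 := derM (der_cst a (0 : R) 1) h.
have h3 := der_comp h2 (is_derive_expR _).
apply: (is_derive_eq h3).
by rewrite mul0r add0r scale0r addr0 mulrC.
Qed.

Lemma partial_exp c a (k l : 'I_n) x :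
  partial l (fun y : 'rV[R]_n => c * expR (a * y 0 k)) x = c * (a * (k == l)%:R) * expR (a * x 0 k).
Proof.
apply: der_partial.
apply: (is_derive_eq (derM (der_cst c _ _) (der_exp_coord a k x (delta_mx 0 l)))).
by rewrite mul0r add0r mxE eqxx /=; ring.
Qed.

Lemma smooth_exp_coord U a (k : 'I_n) : smooth_on U (fun x : 'rV[R]_n => expR (a * x 0 k)).
Proof.
apply: (smooth_stable (P := fun f => exists c, f = fun x : 'rV[R]_n => c * expR (a * x 0 k))).
- move=> _ x [c ->] _; split=> [|l].
    apply: contM; [exact: cont_cst | apply: cont_compose; last exact: continuous_expR].
    by apply: contM; [exact: cont_cst | exact: cont_coord_fun].
  by have [] := derM (der_cst c _ _) (der_exp_coord a k x (delta_mx 0 l)).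
- move=> _ l [c ->]; exists (c * (a * (k == l)%:R)).
  by apply/funext => x; rewrite partial_exp.
- by exists 1; apply/funext => x; rewrite mul1r.
Qed.

Lemma rV_connected : connected [set: 'rV[R]_n].
Proof.
have -> : [set: 'rV[R]_n] = \bigcup_(v in setT) [set t *: v | t in [set: R]].
  apply/seteqP; split=> // v _; exists v => //; exists 1 => //; exact: scale1r.
apply: bigcup_connected; first by exists 0 => v _; exists 0 => //; exact: scale0r.
move=> v _; apply: connected_continuous_connected.
  by apply/connected_intervalP => x y _ _ z.
apply: continuous_subspaceT => t; apply: (@cvgZr_tmp _ _ _ (nbhs t)); exact: cvg_id.
Qed.

Lemma rV_second_countable : @second_countable 'rV[R]_n.
Proof.
pose B (p : 'rV[rat]_n * rat) : set 'rV[R]_n := ball (map_mx (@ratr R) p.1 : 'rV[R]_n) (ratr p.2).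
exists [set B p | p in setT].
  apply: (sub_countable (card_image_le B setT)); exact: countableP.
split=> [_ [p _ <-]|x A /nbhs_ballP[e /= e0 he]]; first exact: ball_open.
have [r] := @rat_in_itvoo R 0 (e / 2) (divr_gt0 e0 (ltr0Sn _ 1)).
rewrite in_itv /= => /andP[r0 re].
have /choice[q hq] : forall k : 'I_n, exists q : rat, `|ratr q - x 0 k| < ratr r.
  move=> k; have : x 0 k - ratr r < x 0 k + ratr r by lra.
  move=> /(@rat_in_itvoo R)[q]; rewrite in_itv /= => /andP[q1 q2].
  by exists q; rewrite ltr_norml; apply/andP; split; lra.
have xb : ball (map_mx (@ratr R) (\row_k q k)) (ratr r) x.
  by split=> // i k; rewrite (ord1 i) !mxE; exact: hq.
exists (B (\row_k q k, r)); first by split=> //; exists (\row_k q k, r).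
move=> y [_ yb]; apply: he; split=> // i k.
have := yb i k; case: xb => _ /(_ i k); rewrite -!ball_normE /= => h1 h2.
have := ler_distD (map_mx (@ratr R) (\row_k q k) i k) (x i k) (y i k).
rewrite [`|x i k - map_mx _ _ i k|]distrC => h3; lra.
Qed.

End CoordinateFunctions.

Section Cone.
Variable R : realType.
Implicit Types (x v : 'rV[R]_2) (i j k : 'I_2).

(** With the logarithm of r as coordinate, the half plane r > 0 is the whole plane, and one global
    chart suffices. The definition is transparent so that chart maps compute to the identity. *)
Definition rV_manifold n : smoothManifold R n.
Proof.
apply: (@SmoothManifold R n 'rV[R]_n (@norm_hausdorff _ _) (@rV_second_countable R n) unit
  (fun=> setT) (fun=> id) (fun=> id) (fun=> tt)) => //.
- by move=> _; exact: openT.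
- by move=> _; rewrite image_id; exact: openT.
- by move=> _ x _; exact: cvg_id.
- by move=> _ x _; exact: cvg_id.
- by move=> _ _ k; exact: smooth_coord.
Defined.

(* In the coordinate [r = exp (x 0 0)] this is [dr ^ 2 + r dy ^ 2], with [r > 0]: the surface of
   revolution of profile [sqrt r], of curvature [1 / (4 r ^ 2)]. *)
Definition cone_metric x : 'M[R]_2 := diag_mx (\row_j expR ((2 - (j : nat)%:R) * x 0 0)).

Lemma cone_metricE x i j : cone_metric x i j = (i == j)%:R * expR ((2 - (i : nat)%:R) * x 0 0).
Proof. by rewrite !mxE mulr_natl. Qed.

Lemma ip_cone x v : ip (cone_metric x) v v = \sum_j v 0 j ^+ 2 * expR ((2 - (j : nat)%:R) * x 0 0).
Proof.
rewrite ipE; apply: eq_bigr => i _; rewrite (bigD1 i) //= big1 => [|j ji].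
  by rewrite cone_metricE eqxx mul1r addr0 mulrAC expr2.
by rewrite cone_metricE eq_sym (negbTE ji) mul0r mulr0 mul0r.
Qed.

Lemma cone_invmx x : invmx (cone_metric x) = diag_mx (\row_j expR (- ((2 - (j : nat)%:R) * x 0 0))).
Proof.
set h := diag_mx _.
have gh : cone_metric x *m h = 1%:M.
  rewrite mulmx_diag; apply/matrixP => i j; rewrite !mxE -expRD subrr expR0.
  by [].
have [gu _] := mulmx1_unit gh.
by rewrite -[LHS]mulmx1 -gh mulKmx.
Qed.

Lemma partial_cone i j l x :
  partial l (fun y => cone_metric y i j) x =
  (i == j)%:R * ((2 - (i : nat)%:R) * (0 == l)%:R) * expR ((2 - (i : nat)%:R) * x 0 0).
Proof.
rewrite -partial_exp; congr (partial l _ x); apply/funext => y; exact: cone_metricE.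
Qed.

(** The Christoffel symbols are constants A plus B times an exponential: the inverse metric cancels
    the exponential in the first two terms of the formula, and in the third it leaves g_ii / g_00 =
    exp (- i x), for k = 0 only. *)
Definition gammaA k i j : R :=
  2^-1 * ((j == k)%:R * (2 - (j : nat)%:R) * (0 == i)%:R + (i == k)%:R * (2 - (i : nat)%:R) * (0 == j)%:R).
Definition gammaB k i j : R := - 2^-1 * (i == j)%:R * (2 - (i : nat)%:R) * (0 == k)%:R.

Lemma cone_christoffel k i j :
  christoffel cone_metric k i j = (fun x => gammaA k i j + gammaB k i j * expR (- (i : nat)%:R * x 0 0)).
Proof.
apply/funext => x; rewrite /christoffel (bigD1 k) //= big1 => [|l lk]; last first.
  by rewrite cone_invmx !mxE eq_sym (negbTE lk) mulr0n mul0r.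
rewrite addr0 cone_invmx !partial_cone !mxE eqxx mulr1n /gammaA /gammaB.
set X := expR (- _).
have E a : (a == k)%:R * X * expR ((2 - (a : nat)%:R) * x 0 0) = (a == k)%:R.
  have [->|_] := eqVneq a k; last by rewrite !mul0r.
  by rewrite !mul1r -expRD addrC subrr expR0.
have E0 : (0 == k)%:R * X * expR ((2 - (i : nat)%:R) * x 0 0) = (0 == k)%:R * expR (- (i : nat)%:R * x 0 0).
  rewrite /X; have [<-|_] := eqVneq 0 k; last by rewrite !mul0r.
  by rewrite !mul1r -expRD /=; congr expR; ring.
transitivity (2^-1 * ((j == k)%:R * X * expR ((2 - (j : nat)%:R) * x 0 0) * ((2 - (j : nat)%:R) * (0 == i)%:R)
  + (i == k)%:R * X * expR ((2 - (i : nat)%:R) * x 0 0) * ((2 - (i : nat)%:R) * (0 == j)%:R)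
  - (i == j)%:R * (2 - (i : nat)%:R) * ((0 == k)%:R * X * expR ((2 - (i : nat)%:R) * x 0 0)))).
  by ring.
by rewrite !E E0; ring.
Qed.

Lemma partial_christoffel l k i j x : partial l (christoffel cone_metric k i j) x =
  gammaB k i j * (- (i : nat)%:R * (0 == l)%:R) * expR (- (i : nat)%:R * x 0 0).
Proof.
rewrite cone_christoffel -partial_exp; apply: der_partial.
rewrite -[X in is_derive _ _ _ X]add0r; apply: derD; first exact: der_cst.
apply: partial_der.
have h := der_exp_coord (- (i : nat)%:R) 0 x (delta_mx 0 l).
by have [] := derM (der_cst (gammaB k i j) x (delta_mx 0 l)) h.
Qed.

Let exp_index0 (y : R) : expR (- 0%:R * y) = 1.
Proof. by rewrite oppr0 mul0r expR0. Qed.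

Let exp_index1 (y : R) : expR (- 1%:R * y) = expR (- y).
Proof. by rewrite mulN1r. Qed.

Let one_mod2 : (1 %% 2)%N = 1%N. Proof. by []. Qed.

Let bump00 : bump 0 0 = 1%N. Proof. by []. Qed.

(** With curvature K = 1 / (4 r^2) and g_00 = r^2, this is Ric_00 = K g_00. *)
Lemma cone_ricci x : ricci_coef cone_metric 0 0 x = 4^-1.
Proof.
rewrite /ricci_coef /riemann !big_ord_recl !big_ord0 !partial_christoffel !cone_christoffel.
rewrite /gammaA /gammaB /= ?one_mod2 bump00 exp_index0 ?exp_index1.
by field.
Qed.

(** With g_11 = r, this is K g_11 = 1 / (4 r). *)
Lemma cone_riemann x : riemann cone_metric 0 1 0 1 x = 4^-1 * expR (- x 0 0).
Proof.
rewrite /riemann !big_ord_recl !big_ord0 !partial_christoffel !cone_christoffel.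
rewrite /gammaA /gammaB /= ?one_mod2 bump00 exp_index0 ?exp_index1.
by field.
Qed.

Let cone_metric_smooth (i : unit) (a b : 'I_2) :
  smooth_on (@chart_img _ _ (rV_manifold 2) i) (fun x => cone_metric x a b).
Proof.
have oU : open (@chart_img _ _ (rV_manifold 2) i) by exact: chart_img_open.
have -> : (fun x => cone_metric x a b) = (fun x => (a == b)%:R * expR ((2 - (a : nat)%:R) * x 0 0)).
  by apply/funext => x; exact: cone_metricE.
apply: (smoothM oU); [exact: smooth_cst oU | exact: smooth_exp_coord].
Qed.

Let cone_metric_sym (i : unit) x : @chart_img _ _ (rV_manifold 2) i x -> (cone_metric x)^T = cone_metric x.
Proof. by move=> _; rewrite tr_diag_mx. Qed.

Let cone_metric_posdef (i : unit) x v : @chart_img _ _ (rV_manifold 2) i x -> v != 0 ->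
  0 < (v *m cone_metric x *m v^T) 0 0.
Proof.
move=> _ /rV0Pn[j vj]; have -> : (v *m cone_metric x *m v^T) 0 0 = ip (cone_metric x) v v by [].
rewrite ip_cone (bigD1 j) //= ltr_pwDl //.
  by rewrite mulr_gt0 ?expR_gt0 // exprn_even_gt0.
by apply: sumr_ge0 => k _; rewrite mulr_ge0 ?sqr_ge0 // expR_ge0.
Qed.

Let cone_metric_transition (i j : unit) (p : rV_manifold 2) :
  @chart_dom _ _ (rV_manifold 2) i p -> @chart_dom _ _ (rV_manifold 2) j p ->
  let J := jacobian (@chart_map _ _ (rV_manifold 2) j \o @chart_inv _ _ (rV_manifold 2) i)
    (@chart_map _ _ (rV_manifold 2) i p) in
  cone_metric (@chart_map _ _ (rV_manifold 2) i p) =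
  J *m cone_metric (@chart_map _ _ (rV_manifold 2) j p) *m J^T.
Proof.
move=> _ _ /=.
have -> : jacobian (id \o id : 'rV[R]_2 -> 'rV[R]_2) p = 1%:M.
  have [d1 d2] := is_diff_id (p : 'rV[R]_2).
  apply/row_matrixP => k; rewrite !rowE -[id \o id]/id -deriveEjacobian //.
  by rewrite mulmx1 deriveE // d2.
by rewrite mul1mx trmx1 mulmx1.
Qed.

Definition cone : riemannianManifold R 2 :=
  @RiemannianManifold R 2 (rV_manifold 2) (fun=> cone_metric) cone_metric_smooth cone_metric_sym
    cone_metric_posdef cone_metric_transition.

Lemma cone_curvature (p : cone) : 0 < gaussian_curvature p.
Proof.
rewrite /gaussian_curvature; set x := coord_at p.
rewrite -[metric_at p]/cone_metric !big_ord_recl big_ord0.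
have -> : (ord0 : 'I_2) = 0 by [].
rewrite cone_riemann !cone_metricE /= !mul0r mulr0 !addr0 mul1r.
rewrite det_diag; apply: divr_gt0; first by rewrite !mulr_gt0 ?expR_gt0 ?invr_gt0.
by apply: prodr_gt0 => j _; rewrite mxE expR_gt0.
Qed.

Definition cone_ray (t : R) : cone := ln (1 - t) *: (delta_mx 0 0 : 'rV[R]_2).

Lemma der_cone_ray (t : R) : t < 1 ->
  is_derive t 1 (cone_ray : R -> 'rV[R]_2) (- (1 - t)^-1 *: delta_mx 0 0).
Proof.
move=> t1; have p0 : 0 < 1 - t by rewrite subr_gt0.
have h := der_comp (derB (der_cst 1 t 1) (der_id t)) (is_derive1_ln p0).
apply: (is_derive_eq (derVZ h (der_cstV t (delta_mx 0 0 : 'rV[R]_2)))).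
by rewrite sub0r mulrN1 scaler0 addr0.
Qed.

Lemma der_cone_ray' (t : R) : t < 1 ->
  is_derive t 1 (cone_ray : R -> 'rV[R]_2)^`()%classic (- (1 - t)^-1 ^+ 2 *: delta_mx 0 0).
Proof.
move=> t1; have p0 : 1 - t != 0 by rewrite gt_eqF // subr_gt0.
have h := derV (f := fun s : R => 1 - s) p0 (derB (der_cst 1 t 1) (der_id t)).
have h2 := derM (der_cst (- 1) t 1) h.
have h3 := derVZ h2 (der_cstV t (delta_mx 0 0 : 'rV[R]_2)).
have : is_derive t 1 (cone_ray : R -> 'rV[R]_2)^`()%classic
    ((0 * (1 - t)^-1 + -1 * (- (0 - 1) * (1 - t)^-1 * (1 - t)^-1)) *: delta_mx 0 0
     + (-1 * (1 - t)^-1) *: 0).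
  apply: near_eq_is_derive h3; near=> s; rewrite derive1E mulN1r.
  by have [] := @der_cone_ray s _; first by near: s; exact: lt_nbhsl.
move=> h4; apply: (is_derive_eq h4).
by rewrite scaler0 addr0; congr (_ *: _); rewrite expr2; ring.
Unshelve. all: by end_near. Qed.

Lemma cone_ray_velocity t : t < 1 -> velocity cone_ray t = - (1 - t)^-1 *: delta_mx 0 0.
Proof.
move=> t1; rewrite /velocity derive1E.
by have [_ <-] := der_cone_ray t1.
Qed.

Lemma cone_ray_speed t : t < 1 -> speed cone_ray t = 1.
Proof.
move=> t1; have p0 : 0 < 1 - t by rewrite subr_gt0.
rewrite /speed /tangent_norm cone_ray_velocity //.
rewrite -[X in Num.sqrt X]/(ip (cone_metric (cone_ray t)) _ _) ip_cone !big_ord_recl big_ord0.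
rewrite !mxE /= !mulr0 !mulr1 expr0n /= mul0r !addr0 subr0 sqrrN.
have -> : 2 * ln (1 - t) = ln (1 - t) + ln (1 - t) by ring.
rewrite expRD lnK ?posrE // -expr2 -exprMn mulVf ?gt_eqF // expr1n; exact: sqrtr1.
Qed.

Lemma cone_ray_geodesic : geodesic_on `](-1), 1[ cone_ray.
Proof.
move=> t; rewrite /= in_itv /= => /andP[_ t1].
have h1 := der_cone_ray t1; have h2 := der_cone_ray' t1.
split; first exact: der_cont h1.
move=> i _; split; [by have [] := h1 | by have [] := h2 |].
have E1 : (id \o cone_ray : R -> 'rV[R]_2)^`()%classic t = - (1 - t)^-1 *: delta_mx 0 0.
  by have [_ <-] := h1; rewrite -derive1E.
have E2 : ((id \o cone_ray : R -> 'rV[R]_2)^`())^`()%classic t = - (1 - t)^-1 ^+ 2 *: delta_mx 0 0.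
  by have [_ <-] := h2; rewrite -derive1E.
move=> k; rewrite E1 E2.
rewrite !big_ord_recl !big_ord0 !cone_christoffel !mxE /gammaA /gammaB /= exp_index0.
by case: k => [[|[|//]] kk] /=; field; rewrite gt_eqF // subr_gt0.
Qed.

(** The left side is the absolute value of dr on v, as r = exp (x 0 0). *)
Lemma cone_norm_ge x v : `|expR (x 0 0) * v 0 0| <= Num.sqrt (ip (cone_metric x) v v).
Proof.
rewrite -sqrtr_sqr ler_wsqrtr // ip_cone (bigD1 0) //= subr0.
have -> : 2 * x 0 0 = x 0 0 + x 0 0 by ring.
rewrite expRD exprMn mulrC -expr2 lerDl; apply: sumr_ge0 => j _.
by rewrite mulr_ge0 ?sqr_ge0 // expR_ge0.
Qed.

Lemma cone_length_ge (p q : cone) l : path_length p q l ->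
  `|expR ((q : 'rV[R]_2) 0 0) - expR ((p : 'rV[R]_2) 0 0)| <= l.
Proof.
elim=> [p'|c q' l' [e e0 hc] _ IH]; first by rewrite subrr normr0.
pose f (t : R) : 'rV[R]_2 := c t.
have fC (t : R) : - e < t < 1 + e ->
    is_derive t 1 f (f^`()%classic t) /\ {for t, continuous f^`()%classic}.
  move=> ht; have It : [set` `](- e), (1 + e)[] t by rewrite /= in_itv.
  have [_ /(_ tt Logic.I)[d1 d2]] := hc t It.
  by split; [exact: (DeriveDef d1 (esym (derive1E _ _))) | exact: d2].
have e2 : 0 < e / 2 by rewrite divr_gt0.
have sub (t : R) : - (e / 2) <= t <= 1 + e / 2 -> - e < t < 1 + e.
  by move=> /andP[? ?]; apply/andP; split; lra.
have sub2 (t : R) : 0 <= t <= 1 -> - e < t < 1 + e.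
  by move=> /andP[? ?]; apply/andP; split; lra.
have spc (t : R) : - (e / 2) <= t <= 1 + e / 2 -> {for t, continuous (speed c)}.
  move=> /sub /fC[h1 h2].
  apply: (cont_compose (f := fun t => ip (cone_metric (f t)) (f^`()%classic t) (f^`()%classic t)) _
    (@sqrt_continuous R _)).
  have Uf : @chart_img _ _ cone tt (f t) by exists (f t).
  have hg a b : {for t, continuous (fun s => cone_metric (f s) a b)}.
    exact: (cont_gc (@metric_sm _ _ cone tt) Uf (der_cont h1)).
  exact: (cont_ipV hg h2 h2).
have dG (t : R) : 0 <= t <= 1 ->
    is_derive t 1 (fun t => expR (f t 0 0)) (expR (f t 0 0) * f^`()%classic t 0 0).
  move=> /sub2 /fC[/der_rV/(_ 0) h1 _]; exact: der_comp h1 (is_derive_expR _).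
have le (t : R) : `|expR (f t 0 0) * f^`()%classic t 0 0| <= speed c t.
  exact: cone_norm_ge.
have b1 := integral01_ge e2 spc dG (fun t _ => le_trans (ler_norm _) (le t)).
have dG' (t : R) (h : 0 <= t <= 1) := derB (der_cst 0 t 1) (dG t h).
have b2 : - expR (f 1 0 0) + expR (f 0 0 0) <= \int[lebesgue_measure]_(t in `[0, 1]) speed c t.
  apply: le_trans (integral01_ge e2 spc dG' _); first by rewrite !sub0r opprK.
  move=> t _; rewrite sub0r; apply: le_trans (le t); rewrite -normrN; exact: ler_norm.
move: IH; rewrite !ler_norml => /andP[i1 i2].
by move: b1 b2 i1 i2; rewrite /f => ? ? ? ?; apply/andP; split; lra.
Qed.

Lemma cone_ray_length s t : s < 1 -> t < 1 ->
  exists2 l, path_length (cone_ray s) (cone_ray t) l & l <= `|s - t|.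
Proof.
move=> s1 t1; pose D := t - s.
(* Since e |D| is less than 1 - s and 1 - t, the parameter s + r D stays below 1 for - e < r < 1 +
   e, whatever the order of s and t. *)
pose e := Num.min 1 (Num.min (1 - s) (1 - t) / (1 + `|D|)).
have m0 : 0 < Num.min (1 - s) (1 - t) by rewrite lt_min !subr_gt0 s1.
have D1 : 0 < 1 + `|D| by rewrite ltr_pwDl.
have e0 : 0 < e by rewrite lt_min ltr01 divr_gt0.
have eD : e * `|D| < Num.min (1 - s) (1 - t).
  apply: (@lt_le_trans _ _ (e * (1 + `|D|))); first by rewrite ltr_pM2l // ltrDr.
  by rewrite -ler_pdivlMr // ge_min lexx orbT.
have inside r : - e < r < 1 + e -> s + r * D < 1.
  move=> /andP[r0 r1]; move: eD; rewrite lt_min => /andP[eD1 eD2].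
  have [D0|/ltW D0] := leP 0 D.
    rewrite (ger0_norm D0) in eD1 eD2.
    have : r * D <= (1 + e) * D by rewrite ler_wpM2r // ltW.
    rewrite mulrDl mul1r /D in eD2 *; lra.
  rewrite (ler0_norm D0) in eD1 eD2.
  have : r * D <= (- e) * D by rewrite ler_wnM2r // ltW.
  by rewrite mulrN in eD1 *; rewrite mulNr; lra.
pose al (r : R) : 'rV[R]_2 := cone_ray (s + r * D).
pose dal (r : R) : 'rV[R]_2 := D *: (- (1 - (s + r * D))^-1 *: delta_mx 0 0).
have hal r : - e < r < 1 + e -> is_derive r 1 al (dal r).
  by move=> /inside/der_cone_ray h; exact: der_compV (der_affine r s D) h.
have path0 : path_length (cone_ray s) (@chart_inv _ _ cone tt (al 0)) 0.
  by rewrite /al mul0r addr0; exact: path_nil.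
have h1 := @path_extend R 2 cone tt al dal e (cone_ray s) 0 (fun r => r * `|D|) (fun=> `|D|) e0.
have [|||l hl le] := h1 _ path0.
- move=> r hr; split; [by exists (al r) | exact: hal |].
  apply: contVZ; first exact: cont_cst.
  apply: contVZ; last exact: cvg_cst.
  have p0 : 1 - (s + r * D) != 0 by rewrite gt_eqF // subr_gt0; exact: inside.
  have h := derV (f := fun r : R => 1 - (s + r * D)) p0 (derB (der_cst 1 r 1) (der_affine r s D)).
  have h2 := derB (der_cst 0 r 1) h.
  by apply: (cont_congr _ (der_cont h2)); near=> z; rewrite sub0r.
- move=> r _; apply: (is_derive_eq (derM (der_id r) (der_cst `|D| r 1))).
  by rewrite mul1r mulr0 addr0.
- move=> r /andP[r0 r1]; have hr : - e < r < 1 + e by apply/andP; split; lra.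
  have := cone_ray_speed (inside r hr).
  rewrite /speed /tangent_norm (cone_ray_velocity (inside r hr)) => sp.
  rewrite /dal ipZl ipZr mulrA -expr2 sqrtrM ?sqr_ge0 // sqrtr_sqr.
  by rewrite -[X in _ * X <= _]/(Num.sqrt ((_ *m _ *m _) 0 0)) sp mulr1.
exists l; last by move: le; rewrite mul1r mul0r subr0 add0r distrC.
by move: hl; rewrite /al mul1r /D addrC subrK.
Unshelve. all: by end_near. Qed.

Lemma cone_ray_minimal : minimal_curve 1 cone_ray.
Proof.
move=> s t; rewrite !in_itv /= => /andP[_ s1] /andP[_ t1].
have [l hl le] := cone_ray_length s1 t1.
apply/eqP; rewrite eq_le (le_trans (dist_le hl) le) /=.
apply: lb_le_inf; first by exists l.
move=> l' /cone_length_ge.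
rewrite !mxE !eqxx /= !mulr1 !lnK ?posrE ?subr_gt0 //.
by rewrite (_ : 1 - t - (1 - s) = s - t) //; ring.
Qed.

Lemma cone_ray_unit_speed : unit_speed_geodesic 1 cone_ray.
Proof.
exists 1, cone_ray; split; [exact: ltr01 | exact: cone_ray_geodesic | by [] |].
by move=> t; rewrite in_itv /= => /andP[_ t1]; exact: cone_ray_speed.
Qed.

Lemma cone_ray_ricci t : t < 1 ->
  (1 - t) ^+ 2 * Ric (cone_ray t) (velocity cone_ray t) (velocity cone_ray t) = 1 / 4.
Proof.
move=> t1; rewrite cone_ray_velocity // /Ric -[metric_at _]/cone_metric.
rewrite !big_ord_recl !big_ord0 !mxE /= cone_ricci !mulr0 !addr0 !mulr1.
by field; rewrite gt_eqF // subr_gt0.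
Qed.

Lemma limf_einf_at_left (f : R -> R) (a c : R) : (forall t, t < a -> f t = c) ->
  limf_einf (fun s => (f s)%:E) a^'- = c%:E.
Proof.
move=> fc; rewrite limf_einfE.
have imE (V : set R) : (\forall t \near a^'-, V t) -> (ereal_inf [set (f x)%:E | x in V] <= c%:E)%E.
  move=> /nbhs_ballP[e /= e0 he]; have ta : a - e / 2 < a by lra.
  apply: ereal_inf_lbound; exists (a - e / 2); last by rewrite fc.
  by apply: he => //; rewrite -ball_normE /= subKr gtr0_norm ?divr_gt0 //; lra.
apply/eqP; rewrite eq_le; apply/andP; split.
  by apply: ge_ereal_sup => _ [V hV <-]; exact: imE.
apply: le_trans (_ : (ereal_inf [set (f x)%:E | x in [set t | (t < a)%R]] <= _)%E).
  by apply: le_ereal_inf_tmp => _ [t ta <-]; rewrite fc.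
by apply: ereal_sup_ubound; exists [set t | (t < a)%R] => //; exact: nbhs_left_lt.
Unshelve. all: by end_near. Qed.

End Cone.

Theorem proposition1p5 (R : realType) :
  (forall (n : nat) (M : riemannianManifold R n) (gam : R) (C : R -> M),
     connected [set: M] -> 0 < gam ->
     unit_speed_geodesic gam C -> minimal_curve gam C ->
     (limf_einf
        (fun s => ((gam - s) ^+ 2 *
                   Ric (C s) (velocity C s) (velocity C s))%:E) gam^'-
      <= ((n%:R - 1) / 4)%:E)%E) /\
  (exists (M : riemannianManifold R 2) (gam : R) (C : R -> M),
     [/\ connected [set: M],
         forall p : M, 0 < gaussian_curvature p,
         0 < gam,
         unit_speed_geodesic gam C /\ minimal_curve gam C &
         limf_einf
           (fun s => ((gam - s) ^+ 2 *
                      Ric (C s) (velocity C s) (velocity C s))%:E) gam^'-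
         = (1 / 4)%:E]).
Proof.
split=> [n M gam C _ gam0 hC hmin|]; first exact: ricci_liminf.
exists (cone R), 1, (@cone_ray R); split.
- exact: rV_connected.
- exact: cone_curvature.
- exact: ltr01.
- by split; [exact: cone_ray_unit_speed | exact: cone_ray_minimal].
- by apply: limf_einf_at_left => t; exact: cone_ray_ricci.
Qed.
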